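(* Let $S=\mathrm{diag}(s_1,s_2,s_3)$ with $0<s_1<s_2<s_3$ and $s_1+s_2+s_3=1$. Let $T=\mathrm{diag}(t_1,t_2,t_3)\in\mathcal T^2(S)$, let $$(\lambda_1,\lambda_2)=\left(\tfrac{t_1}{s_2},\tfrac{t_2}{s_2}\right)\ \text{if } T \text{ satisfies condition (a)},\qquad (\lambda_1,\lambda_2)=\left(\tfrac{t_3}{s_2},\tfrac{t_2}{s_2}\right)\ \text{if } T\text{ satisfies condition (b)},$$ and let $R_1,R_2\in SO(3)$ and a unit vector $n\in\mathbb R^3$ be such that $$R_1^tTR_1=\lambda_1S+(1-\lambda_1)\,n\otimes n,\qquad R_2^tTR_2=\lambda_2S+(1-\lambda_2)\,n\otimes n .$$ Then for each $A$ in the closed segment $[\lambda_1S,R_1^tTR_1]$ there exists $R\in SO(3)$ such that the matrix $\frac{1}{\mathrm{Tr}A}R^tAR$ belongs to $K^*(S)$.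
   Context: **The set $\mathcal T^2(S)$.** Let $$F(x,y)=\frac{s_1s_3}{s_2}\cdot\frac{xy}{x^2+xy+y^2-s_2(x+y)},\qquad (x,y)\in[s_1,s_3]^2$$ (an equation involving $F(x,y)$ is understood to require that the denominator be nonzero). For $T=\mathrm{diag}(t_1,t_2,t_3)$ with $s_1\le t_1\le t_2\le t_3\le s_3$ and $t_1+t_2+t_3=1$ put $$\alpha_-(T,S)=\max\left(\tfrac{t_1}{s_2},\tfrac{t_2}{s_3}\right),\quad \alpha_+(T,S)=\min\left(\tfrac{t_2}{s_2},\tfrac{t_3}{s_3}\right),\quad \beta_-(T,S)=\max\left(\tfrac{t_1}{s_1},\tfrac{t_2}{s_2}\right),\quad \beta_+(T,S)=\min\left(\tfrac{t_2}{s_1},\tfrac{t_3}{s_2}\right).$$ $\mathcal T^2(S)$ is the set of all such $T$ that satisfy either (a) $(\alpha_-(T,S),\alpha_+(T,S))=\left(\frac{t_1}{s_2},\frac{t_2}{s_2}\right)$ and $t_3=F(t_1,t_2)$, or (b) $(\beta_-(T,S),\beta_+(T,S))=\left(\frac{t_2}{s_2},\frac{t_3}{s_2}\right)$ and $t_1=F(t_3,t_2)$. **The set $K^*(S)$.** Let $K(S)=\{\lambda R^tSR:\lambda\in\mathbb R,\ R\in SO(3)\}$. Let $C=[0,1]^3$ and let $W^{1,2}_C(\mathbb R^3;\mathbb R^3)$ be the space of $C$-periodic vector fields in $W^{1,2}_{\rm loc}(\mathbb R^3;\mathbb R^3)$. $K^{app}(S)$ is the set of real symmetric $3\times3$ matrices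 $A$ for which there is a sequence $u_j\in W^{1,2}_C(\mathbb R^3;\mathbb R^3)+Ax$, bounded in $W^{1,2}_{\rm loc}(\mathbb R^3;\mathbb R^3)$, with $\{\nabla u_j\}$ $L^2_{\rm loc}$-equi-integrable (i.e. $\{|\nabla u_j|^2\}$ is equi-integrable on bounded sets), such that $\mathrm{dist}(\nabla u_j,K(S))\to0$ locally in measure. $K^*(S)$ is the set of diagonal matrices $A=\mathrm{diag}(a_1,a_2,a_3)\in K^{app}(S)$ with $a_i\in[s_1,s_3]$ for $i=1,2,3$ and $a_1+a_2+a_3=1$. *)

(* Defs.v *)
From HB Require Import structures.
From mathcomp Require Import all_boot all_order all_algebra.
From mathcomp Require Import all_classical all_reals all_analysis.
Set Implicit Arguments.
Unset Strict Implicit.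
Unset Printing Implicit Defensive.
Import Order.TTheory GRing.Theory Num.Theory.
Import numFieldNormedType.Exports.
Local Open Scope classical_set_scope.
Local Open Scope ring_scope.

Section Matrices.
Context {R : realType}.
Implicit Types (S T A B M Q : 'M[R]_3) (n : 'cV[R]_3).

Definition diag3 (a b c : R) : 'M[R]_3 := diag_mx (\row_i [:: a; b; c]`_i).

(* The ordinals 0, 1, 2 : 'I_3 index entries 1, 2, 3. *)
Definition d1 M : R := M 0 0.
Definition d2 M : R := M 1 1.
Definition d3 M : R := M 2 2.

Definition SO3 : set 'M[R]_3 := [set Q | Q^T *m Q = 1%:M /\ \det Q = 1].

(* Euclidean norm of a matrix or column vector; the library's norm on
   matrices is the maximum norm. *)
Definition norm2 m k (M : 'M[R]_(m, k)) : R :=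
  Num.sqrt (\sum_i \sum_j M i j ^+ 2).

Definition tensor n : 'M[R]_3 := n *m n^T.

Definition segment A B : set 'M[R]_3 :=
  [set (1 - theta) *: A + theta *: B | theta in `[0, 1]].

Definition K S : set 'M[R]_3 :=
  [set M | exists lambda : R, exists2 Q, SO3 Q & M = lambda *: (Q^T *m S *m Q)].

Definition dist M (E : set 'M[R]_3) : R := inf [set norm2 (M - B) | B in E].

Definition F_denom S (x y : R) : R :=
  x ^+ 2 + x * y + y ^+ 2 - d2 S * (x + y).

Definition F S (x y : R) : R :=
  d1 S * d3 S / d2 S * (x * y / F_denom S x y).

Definition alpha_minus T S : R := Num.max (d1 T / d2 S) (d2 T / d3 S).
Definition alpha_plus T S : R := Num.min (d2 T / d2 S) (d3 T / d3 S).
Definition beta_minus T S : R := Num.max (d1 T / d1 S) (d2 T / d2 S).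
Definition beta_plus T S : R := Num.min (d2 T / d1 S) (d3 T / d2 S).

Definition condition_a S T : Prop :=
  [/\ (alpha_minus T S, alpha_plus T S) = (d1 T / d2 S, d2 T / d2 S),
      F_denom S (d1 T) (d2 T) != 0
    & d3 T = F S (d1 T) (d2 T)].

Definition condition_b S T : Prop :=
  [/\ (beta_minus T S, beta_plus T S) = (d2 T / d2 S, d3 T / d2 S),
      F_denom S (d3 T) (d2 T) != 0
    & d1 T = F S (d3 T) (d2 T)].

Definition T2 S : set 'M[R]_3 :=
  [set T | [/\ T = diag3 (d1 T) (d2 T) (d3 T),
               [&& d1 S <= d1 T, d1 T <= d2 T, d2 T <= d3 T & d3 T <= d3 S],
               d1 T + d2 T + d3 T = 1
             & condition_a S T \/ condition_b S T]].

End Matrices.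

(* Points of R^3 are iterated pairs, the form for which the library provides
   the product topology, norm and measure; [vec] gives their coordinates. *)
Notation pt R := (R * R * R)%type.

Section Sobolev.
Context {R : realType}.

Definition vec (x : pt R) : 'cV[R]_3 := \col_i [:: x.1.1; x.1.2; x.2]`_i.

Definition e (j : 'I_3) : pt R := ((j == 0)%:R, (j == 1)%:R, (j == 2)%:R).

Definition leb := ((@lebesgue_measure R \x @lebesgue_measure R)
  \x @lebesgue_measure R)%E.

(* Local notions are tested on these cubes, which exhaust R^3: every bounded
   set lies in one of them. *)
Definition cube (r : R) : set (pt R) :=
  (`[- r, r] `*` `[- r, r]) `*` `[- r, r].

Fixpoint Cn (n : nat) (phi : pt R -> R) : Prop :=
  continuous phi /\
  if n is m.+1 then
    forall j, (forall x, derivable phi x (e j)) /\ Cn m ('D_(e j) phi)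
  else True.

Definition test_function (phi : pt R -> R) : Prop :=
  (forall n, Cn n phi) /\ compact (closure [set x | phi x != 0]).

(* Measurability is Borel; every Lebesgue class has a Borel representative. *)
Definition L2loc (f : pt R -> R) : Prop :=
  measurable_fun setT f /\
  forall r, (\int[leb]_(x in cube r) (f x ^+ 2)%:E < +oo)%E.

(* u is in W^{1,2}_loc(R^3; R^3) with weak gradient G, (G x) i j being the
   j-th partial derivative of the i-th component of u. *)
Definition W12loc_grad (u : pt R -> 'cV[R]_3) (G : pt R -> 'M[R]_3) : Prop :=
  [/\ forall i, L2loc (fun x => u x i 0),
      forall i j, L2loc (fun x => G x i j)
    & forall i j phi, test_function phi ->
        (\int[leb]_x (u x i 0 * 'D_(e j) phi x)%:E =
         - \int[leb]_x (G x i j * phi x)%:E)%E].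

Definition W12loc (u : pt R -> 'cV[R]_3) : Prop := exists G, W12loc_grad u G.

Definition W12C (v : pt R -> 'cV[R]_3) : Prop :=
  W12loc v /\ forall j, {ae leb, forall x, v (x + e j) = v x}.

Definition bounded_W12loc (u : nat -> pt R -> 'cV[R]_3)
    (G : nat -> pt R -> 'M[R]_3) : Prop :=
  forall r, exists c : R, forall k,
    (\int[leb]_(x in cube r) (norm2 (u k x) ^+ 2 + norm2 (G k x) ^+ 2)%:E
      <= c%:E)%E.

Definition L2loc_equi_integrable (G : nat -> pt R -> 'M[R]_3) : Prop :=
  forall r eps : R, 0 < eps -> exists2 delta : R, 0 < delta &
    forall k (E : set (pt R)), measurable E -> E `<=` cube r ->
      (leb E < delta%:E)%E ->
      (\int[leb]_(x in E) (norm2 (G k x) ^+ 2)%:E < eps%:E)%E.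

Definition cvg0_locally_in_measure (f : nat -> pt R -> R) : Prop :=
  forall r eps : R, 0 < eps ->
    leb (cube r `&` [set x | eps <= `|f k x|]) @[k --> \oo] --> 0%E.

Definition Kapp (S : 'M[R]_3) : set 'M[R]_3 :=
  [set A | A^T = A /\
    exists (u : nat -> pt R -> 'cV[R]_3) (G : nat -> pt R -> 'M[R]_3),
      [/\ forall k, exists2 v, W12C v & u k = (fun x => v x + A *m vec x),
          forall k, W12loc_grad (u k) (G k),
          bounded_W12loc u G,
          L2loc_equi_integrable G
        & cvg0_locally_in_measure (fun k x => dist (G k x) (K S))]].

Definition Kstar (S : 'M[R]_3) : set 'M[R]_3 :=
  [set A | exists a1 a2 a3 : R,
    [/\ A = diag3 a1 a2 a3, Kapp S A,
        [/\ d1 S <= a1 <= d3 S, d1 S <= a2 <= d3 S & d1 S <= a3 <= d3 S]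
      & a1 + a2 + a3 = 1]].

End Sobolev.

(* Main.v *)
(* Let f_j(M) = |M|^3 + j min(1, dist(M, K(S))). If the quasiconvex envelopes of the
   f_j at A are bounded uniformly in j, almost optimal periodic fields form an
   approximating sequence, so A lies in K^app(S). The envelope is convex along
   rank-one lines, which is proved with smoothed simple laminates whose phases
   carry oscillations of a higher frequency.

   Write B_i = R_i^t T R_i = lambda_i S + (1 - lambda_i) n (x) n. Then
   B_2 = theta lambda_2 S + (1 - theta) (lambda_2 / lambda_1) B_1 is a rank-one
   splitting in which B_1 is a rotation of B_2, so it can be iterated. After N steps
   the phases outside K(S) have volume (1 - theta)^N, and the energy is a geometric
   series of ratio (1 - theta) (lambda_2 / lambda_1)^3, which is below 1 because the
   denominator of F is positive. If lambda_1 = lambda_2 <> 1 there is no such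
   splitting, but B_1 is a limit of matrices of the same kind with distinct
   parameters and uniformly bounded envelopes. Every A in the segment is a rank-one
   combination of lambda_1 S and B_1. *)

(* When lambda_1 < lambda_2 < 1 the factor lambda_2 / lambda_1 exceeds 1, so the iterated phases
   grow without bound and the construction gives no sup bound on the gradients; hence the
   superquadratic energy. The scaled phases remain admissible because K(S) is closed under
   multiplication by reals. The exponent 3 fits the data: matching coefficients gives 1 - theta =
   lambda_1 (1 - lambda_2) / (lambda_2 (1 - lambda_1)), and then 1 - (1 - theta) (lambda_2 /
   lambda_1)^3 equals (lambda_2 - lambda_1) D / (lambda_1^2 (1 - lambda_1)), where D is the
   denominator of F at (s_2 lambda_1, s_2 lambda_2) divided by s_2^2. The series sums to |S|^3
   lambda_1^2 lambda_2^2 / D: the factor lambda_2 - lambda_1 has cancelled, so the bound survives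
   lambda_1 -> lambda_2 as long as D stays positive. In that limit the approximating pair may depend
   on j, since a perturbation of size 1 / (j + 1) changes f_j in a way controlled uniformly in j. *)
Require Import Defs.
From HB Require Import structures.
From mathcomp Require Import all_boot all_order all_algebra.
From mathcomp Require Import all_classical all_reals all_analysis.
From mathcomp Require Import measurable_realfun.
From mathcomp Require Import ring lra.
Set Implicit Arguments.
Unset Strict Implicit.
Unset Printing Implicit Defensive.
Import Order.TTheory GRing.Theory Num.Theory.
Import numFieldNormedType.Exports.
Local Open Scope classical_set_scope.
Local Open Scope ring_scope.

(** * Measurability and periodic integrals *)

Section Caratheodory.
Context {R : realType}.

Lemma floor_approx_cvg (y : R) :
  (Num.floor (n.+1%:R * y))%:~R / n.+1%:R @[n --> \oo] --> y.
Proof.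
apply/cvgrPdist_le => eps e0.
have H : \forall n \near \oo, `|n.+1%:R^-1 : R| < eps.
  by have /cvgrPdist_lt/(_ _ e0) := @cvg_harmonic R; apply: filterS => n; rewrite sub0r normrN.
apply: filterS H => n /= /ltW; rewrite ger0_norm// => hn; apply: le_trans hn.
have n0 : 0 < n.+1%:R :> R by [].
have /andP[h1 h2] := floor_itv (n.+1%:R * y).
rewrite ger0_norm; last by rewrite subr_ge0 ler_pdivrMr// [leRHS]mulrC.
rewrite lerBlDr -[X in X + _]div1r -mulrDl ler_pdivlMr// [leLHS]mulrC.
by rewrite addrC (le_trans (ltW h2))// intrD.
Qed.

(** Rounding the second argument down to the grid of step 1 / (n + 1) gives functions that are
    measurable on countably many strips and converge to [F] by continuity. Used one coordinate at a
    time, this makes continuous functions measurable for the product sigma-algebra on iterated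
    pairs. *)
Lemma caratheodory_measurable d (X : measurableType d) (F : X * R -> R) :
  (forall x, continuous (fun y => F (x, y))) ->
  (forall y, measurable_fun setT (fun x => F (x, y))) ->
  measurable_fun setT F.
Proof.
move=> cF mF.
pose h (n : nat) (p : X * R) := F (p.1, (Num.floor (n.+1%:R * p.2))%:~R / n.+1%:R).
apply: (@measurable_fun_cvg _ _ _ _ h) => [n _ Y mY|[x y] _]; last first.
  by apply: (continuous_cvg _ (cF x y)); exact: floor_approx_cvg.
rewrite setTI.
have -> : h n @^-1` Y = \bigcup_(i : int)
   (((fun x => F (x, i%:~R / n.+1%:R)) @^-1` Y) `*`
     [set y | i%:~R / n.+1%:R <= y < (i + 1)%:~R / n.+1%:R]).
  apply/seteqP; split=> [[x y] hY|[x y] [i _ [/= hY hy]]].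
    exists (Num.floor (n.+1%:R * y)) => //; split => //=.
    have /andP[h1 h2] := floor_itv (n.+1%:R * y).
    by rewrite ler_pdivrMr// ltr_pdivlMr// [y * _]mulrC h1.
  rewrite /h /= (_ : Num.floor (n.+1%:R * y) = i)//.
  by apply/eqP; rewrite floor_eq [_ * y]mulrC -ler_pdivrMr// -ltr_pdivlMr.
apply: countable_bigcupT_measurable => // i; apply: measurableX.
  by rewrite -[X in measurable X]setTI; exact: mF.
rewrite (_ : [set _ | _] = `[(i%:~R / n.+1%:R : R), ((i + 1)%:~R / n.+1%:R)[%classic).
  exact: measurable_itv.
by apply/seteqP; split=> y; rewrite /= in_itv.
Qed.

Lemma continuous_measurable2 (F : R * R -> R) : continuous F -> measurable_fun setT F.
Proof.
move=> cF; apply: caratheodory_measurable => [x y|y].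
  by apply: continuous_comp; [exact: cvg_pair (cvg_cst _) cvg_id|exact: cF].
apply: continuous_measurable_fun => x.
by apply: continuous_comp; [exact: cvg_pair cvg_id (cvg_cst _)|exact: cF].
Qed.

Lemma continuous_measurable3 (F : pt R -> R) : continuous F -> measurable_fun setT F.
Proof.
move=> cF; apply: caratheodory_measurable => [x y|y].
  by apply: continuous_comp; [exact: cvg_pair (cvg_cst _) cvg_id|exact: cF].
apply: continuous_measurable2 => x.
by apply: continuous_comp; [exact: cvg_pair cvg_id (cvg_cst _)|exact: cF].
Qed.

Lemma continuous_measurable4 (F : pt R * R -> R) : continuous F -> measurable_fun setT F.
Proof.
move=> cF; apply: caratheodory_measurable => [x y|y].
  by apply: continuous_comp; [exact: cvg_pair (cvg_cst _) cvg_id|exact: cF].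
apply: continuous_measurable3 => x.
by apply: continuous_comp; [exact: cvg_pair cvg_id (cvg_cst _)|exact: cF].
Qed.

End Caratheodory.

Section SigmaFiniteProduct.
Context {R : realType}.
Local Open Scope ereal_scope.
Context d1 d2 (T1 : measurableType d1) (T2 : measurableType d2).
Variables (m1 : {sigma_finite_measure set T1 -> \bar R})
  (m2 : {sigma_finite_measure set T2 -> \bar R}).

(** A name for the product measure that carries the sigma-finite instance, so that products can be
    iterated and Tonelli's theorem applied at each stage. *)
Definition sf_prod : set (T1 * T2) -> \bar R := m1 \x m2.

HB.instance Definition _ := Measure.on sf_prod.

Let sf_prod_sigma_finite : sigma_finite setT sf_prod.
Proof.
have /sigma_finiteP[F [TF ndF Foo]] := sigma_finiteT m1.
have /sigma_finiteP[G [TG ndG Goo]] := sigma_finiteT m2.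
exists (fun n => F n `*` G n) => [|k].
  apply/seteqP; split=> // -[x y] _.
  have [[n _ Fx] [k _ Gy]] : (\bigcup_n F n) x /\ (\bigcup_n G n) y.
    by rewrite -TF -TG.
  exists (maxn n k) => //; split.
    by move/subsetPset: (ndF _ _ (leq_maxl n k)); exact.
  by move/subsetPset: (ndG _ _ (leq_maxr n k)); exact.
have [mF Fk] := Foo k; have [mG Gk] := Goo k.
split; first exact: measurableX.
by rewrite /sf_prod product_measure1E// lte_mul_pinfty// ge0_fin_numE.
Qed.

HB.instance Definition _ := Measure_isSigmaFinite.Build _ _ _ sf_prod
  sf_prod_sigma_finite.

End SigmaFiniteProduct.

(* The bundled form of [leb], carrying the sigma-finiteness that Tonelli's theorem needs. *)
Definition lebs (R : realType) : {sigma_finite_measure set (pt (measurableTypeR R)) -> \bar R} :=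
  sf_prod (sf_prod (@lebesgue_measure R) (@lebesgue_measure R)) (@lebesgue_measure R).
Definition leb4 (R : realType) :
    {sigma_finite_measure set (pt (measurableTypeR R) * measurableTypeR R)%type -> \bar R} :=
  sf_prod (lebs R) (@lebesgue_measure R).

Lemma lebE (R : realType) : @leb R = lebs R.
Proof. by []. Qed.

Section Tonelli.
Context {R : realType}.
Local Open Scope ereal_scope.
Context d1 d2 (X1 : measurableType d1) (X2 : measurableType d2).
Variables (m1 : {sigma_finite_measure set X1 -> \bar R})
  (m2 : {sigma_finite_measure set X2 -> \bar R}).

Lemma measurable_integral_section (F : X1 * X2 -> \bar R) (D : set X2) :
  measurable D -> measurable_fun setT F -> (forall x, 0 <= F x) ->
  measurable_fun setT (fun x => \int[m2]_(y in D) F (x, y)).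
Proof.
move=> mD mF F0.
have mG : measurable_fun setT (F \_ (setT `*` D)).
  by apply/(measurable_restrictT _ _).1 => //; [exact: measurableX|exact: measurable_funTS].
have := measurable_fun_fubini_tonelli_F (m2 := m2) (F \_ (setT `*` D)) mG.
rewrite /fubini_F => H; apply: eq_measurable_fun (H _) => [x _|x]; last exact: erestrict_ge0.
rewrite [RHS]integral_mkcond; apply: eq_integral => y _.
by rewrite /patch in_setX in_setT.
Qed.

Lemma tonelli_setX (F : X1 * X2 -> \bar R) (D1 : set X1) (D2 : set X2) :
  measurable D1 -> measurable D2 -> measurable_fun setT F -> (forall x, 0 <= F x) ->
  \int[sf_prod m1 m2]_(z in D1 `*` D2) F z =
  \int[m1]_(x in D1) \int[m2]_(y in D2) F (x, y).
Proof.
move=> mD1 mD2 mF F0.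
have mG : measurable_fun setT (F \_ (D1 `*` D2)).
  by apply/(measurable_restrictT _ _).1 => //; [exact: measurableX|exact: measurable_funTS].
rewrite integral_mkcond (fubini_tonelli1 _ mG); last by move=> x; exact: erestrict_ge0.
rewrite [RHS]integral_mkcond; apply: eq_integral => x _; rewrite /fubini_F /patch.
case: ifPn => xD1; last by apply: integral0_eq => y _; rewrite in_setX (negbTE xD1).
by rewrite [RHS]integral_mkcond; apply: eq_integral => y _; rewrite /patch in_setX xD1.
Qed.

End Tonelli.

Section PeriodicIntegral.
Context {R : realType}.
Local Notation mu := (@lebesgue_measure R).
Local Open Scope ereal_scope.

Lemma measurable_shift (c : R) : measurable_fun setT (fun x : R => x + c)%R.
Proof. exact: measurable_funD. Qed.

(** By uniqueness of Lebesgue measure it suffices to compare both sides on half-open intervals. *)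
Lemma lebesgue_measure_shift (c : R) (A : set R) : measurable A ->
  pushforward mu (fun x : measurableTypeR R => (x + c)%R : measurableTypeR R) A = mu A.
Proof.
move=> mA; have mc := measurable_shift c.
apply/esym/lebesgue_measure_unique => //=.
move=> X /ocitvP[->|[[a b] /= ab ->]]; first by rewrite !measure0.
rewrite /pushforward (_ : _ @^-1` _ = `](a - c)%R, (b - c)%R]%classic).
  rewrite [RHS]lebesgue_measure_itv/= lebesgue_measure_itv/= !lte_fin ltrD2r ab.
  by rewrite -!EFinD; congr EFin; ring.
by apply/seteqP; split=> x; rewrite /= !in_itv/= ltrBlDr lerBrDr.
Qed.

Lemma integral_shift_itv (F : R -> \bar R) (a b c : R) :
  measurable_fun setT F -> (forall x, 0 <= F x) ->
  \int[mu]_(x in `[a, b[) F (x + c)%R = \int[mu]_(x in `[(a + c)%R, (b + c)%R[) F x.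
Proof.
move=> mF F0; have mc := measurable_shift c.
rewrite (_ : `[a, b[%classic = (fun x : measurableTypeR R => (x + c)%R : measurableTypeR R)
   @^-1` `[(a + c)%R, (b + c)%R[); last first.
  by apply/seteqP; split=> x; rewrite /= !in_itv/= lerD2r ltrD2r.
transitivity (\int[pushforward mu (fun x : measurableTypeR R =>
    (x + c)%R : measurableTypeR R)]_(y in `[(a + c)%R, (b + c)%R[) F y).
  by apply/esym/ge0_integral_pushforward => //; exact: measurable_funTS.
by apply: eq_measure_integral => //= A mA _; exact: lebesgue_measure_shift.
Qed.

Lemma periodic_intz T (f : R -> T) : (forall x, f (x + 1)%R = f x) ->
  forall (i : int) x, f (x + i%:~R)%R = f x.
Proof.
move=> f1.
have fn (n : nat) x : f (x + n%:R)%R = f x.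
  by elim: n => [|n <-]; rewrite ?addr0// -natr1 addrA f1.
by case=> n x; rewrite ?fn// NegzE -[in RHS](subrK n.+1%:R x)%R fn mulrNz.
Qed.

Lemma integral_itv_cat (F : R -> \bar R) (a b c : R) : (a <= b <= c)%R ->
  measurable_fun setT F -> (forall x, 0 <= F x) ->
  \int[mu]_(x in `[a, c[) F x = \int[mu]_(x in `[a, b[) F x + \int[mu]_(x in `[b, c[) F x.
Proof.
move=> /andP[ab bc] mF F0.
rewrite -(ge0_integral_setU mu)//; last 2 first.
- exact: measurable_funTS.
- apply/disj_setPS => x []/=; rewrite !in_itv/= => /andP[_ xb] /andP[bx _].
  by move: (lt_le_trans xb bx); rewrite ltxx.
congr (integral mu _ F); apply/seteqP; split=> x; rewrite /= !in_itv/=.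
  by move=> /andP[-> ->]; rewrite !andbT; case: (ltP x b) => h; [left|right].
by case=> /andP[h1 h2]; apply/andP; split => //; [exact: lt_le_trans bc|exact: le_trans h1].
Qed.

Lemma integral_periodic_intz (F : R -> \bar R) (a b : R) (i : int) :
  measurable_fun setT F -> (forall x, 0 <= F x) -> (forall x, F (x + 1)%R = F x) ->
  \int[mu]_(x in `[(a + i%:~R)%R, (b + i%:~R)%R[) F x = \int[mu]_(x in `[a, b[) F x.
Proof.
move=> mF F0 F1; rewrite -integral_shift_itv//.
by apply: eq_integral => x _; rewrite (periodic_intz F1).
Qed.

Lemma integral_periodic_shift (F : R -> \bar R) (c : R) :
  measurable_fun setT F -> (forall x, 0 <= F x) -> (forall x, F (x + 1)%R = F x) ->
  \int[mu]_(x in `[0%R, 1%R[) F (x + c)%R = \int[mu]_(x in `[0%R, 1%R[) F x.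
Proof.
move=> mF F0 F1; rewrite integral_shift_itv// add0r.
have /andP[h1 h2] := floor_itv c; set n := Num.floor c in h1 h2.
(* The period starting at c is cut at the integer n + 1; translating the two pieces by -n and -(n +
   1) reassembles [0, 1[. *)
rewrite (@integral_itv_cat F c (n + 1)%:~R)//; last first.
  by rewrite (ltW h2)/= intrD addrC lerD2l.
rewrite (@integral_itv_cat F 0%R (c - n%:~R)%R)//; last first.
  by rewrite subr_ge0 h1/= lerBlDr (le_trans (ltW h2))// intrD addrC.
rewrite [RHS]addeC -(integral_periodic_intz (c - n%:~R) 1 n mF F0 F1) subrK.
rewrite -(integral_periodic_intz 0 (c - n%:~R) (n + 1) mF F0 F1) add0r.
by rewrite (_ : c - _ + _ = 1 + c)%R ?(intrD, addrC 1%R)//; ring.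
Qed.

Lemma integral_periodic_itv (F : R -> \bar R) (N : nat) :
  measurable_fun setT F -> (forall x, 0 <= F x) -> (forall x, F (x + 1)%R = F x) ->
  \int[mu]_(x in `[(- N%:R)%R, N%:R%R[) F x = (N.*2%:R)%R%:E * \int[mu]_(x in `[0%R, 1%R[) F x.
Proof.
move=> mF F0 F1; have unit_itv (i : int) :
    \int[mu]_(x in `[i%:~R%R, (i + 1)%:~R%R[) F x = \int[mu]_(x in `[0%R, 1%R[) F x.
  by rewrite -(integral_periodic_intz 0%R 1%R i)// add0r intrD [(1 + _)%R]addrC.
elim: N => [|N IH]; first by rewrite oppr0 set_itvco0 integral_set0 mul0e.
rewrite (@integral_itv_cat F _ (- N%:R)%R)//; last first.
  by rewrite lerN2 ler_nat leqnSn/= (@le_trans _ _ 0%R)// oppr_le0.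
rewrite (@integral_itv_cat F (- N%:R)%R N%:R)//; last first.
  by rewrite ler_nat leqnSn andbT (@le_trans _ _ 0%R)// oppr_le0.
have := unit_itv (- N.+1%:Z)%R.
rewrite (_ : - N.+1%:Z + 1 = - N%:Z)%R; last by rewrite intS; ring.
rewrite !mulrNz => ->; rewrite IH.
have := unit_itv N%:Z; rewrite (_ : N%:Z + 1 = N.+1%:Z)%R; last by rewrite intS addrC.
move=> ->; rewrite doubleS -addn2 natrD EFinD.
set I := integral _ _ _; have I0 : 0 <= I by exact: integral_ge0.
rewrite ge0_muleDl ?lee_fin// addeCA; congr (_ + _).
by rewrite (_ : 2 = 1 + 1)%E ?ge0_muleDl ?mul1e.
Qed.
End PeriodicIntegral.

Section ProductPeriodic.
Context {R : realType}.
Local Open Scope ereal_scope.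

(** A common form for translation invariance over one period ([c] = 1) and for counting the unit
    cells of an interval ([g] the identity). [H] collects the periods of the integrand. The property
    passes to products, so both facts need a proof in dimension one only. *)
Definition invariant_integral d (X : measurableType d) (m : set X -> \bar R)
    (H : set (X -> X)) (D' : set X) (g : X -> X) (D : set X) (c : R) :=
  forall F : X -> \bar R, measurable_fun setT F -> (forall x, 0 <= F x) ->
    (forall h, H h -> forall x, F (h x) = F x) ->
    \int[m]_(x in D') F (g x) = c%:E * \int[m]_(x in D) F x.

Definition product_maps X1 X2 (H1 : set (X1 -> X1)) (H2 : set (X2 -> X2)) :
    set (X1 * X2 -> X1 * X2) :=
  [set (fun p => (h p.1, p.2)) | h in H1] `|` [set (fun p => (p.1, h p.2)) | h in H2].

Lemma invariant_integral_prod d1 d2 (X1 : measurableType d1) (X2 : measurableType d2)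
  (m1 : {sigma_finite_measure set X1 -> \bar R})
  (m2 : {sigma_finite_measure set X2 -> \bar R})
  H1 H2 D1' D2' g1 g2 D1 D2 c1 c2 :
  measurable D1 -> measurable D1' -> measurable D2 -> measurable D2' ->
  measurable_fun setT g1 -> measurable_fun setT g2 -> (0 <= c2)%R ->
  invariant_integral m1 H1 D1' g1 D1 c1 -> invariant_integral m2 H2 D2' g2 D2 c2 ->
  invariant_integral (sf_prod m1 m2) (product_maps H1 H2) (D1' `*` D2')
    (fun p => (g1 p.1, g2 p.2)) (D1 `*` D2) (c1 * c2)%R.
Proof.
move=> mD1 mD1' mD2 mD2' mg1 mg2 c20 I1 I2 F mF F0 HF.
have mFg : measurable_fun setT (fun p => F (g1 p.1, g2 p.2)).
  apply: (measurableT_comp mF); apply: measurable_fun_pair.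
    exact: measurableT_comp.
  exact: measurableT_comp.
rewrite !tonelli_setX//=.
have mS := measurable_integral_section m2 mD2 mF F0.
transitivity (\int[m1]_(x in D1') (c2%:E * \int[m2]_(y in D2) F (g1 x, y))).
  apply: eq_integral => x _; apply: (I2 (fun y => F (g1 x, y))) => //.
    exact: measurable_fun_pair2.
  by move=> h Hh y; apply: (HF (fun p => (p.1, h p.2)) _ (g1 x, y)); right; exists h.
have mSg : measurable_fun D1' (fun x => \int[m2]_(y in D2) F (g1 x, y)).
  by apply: measurable_funTS; exact: (measurableT_comp mS).
rewrite (ge0_integralZl_EFin m1 mD1' _ mSg c20); last first.
  by move=> x _; exact: integral_ge0.
rewrite (I1 (fun x => \int[m2]_(y in D2) F (x, y)))//.
- by rewrite muleA -EFinM mulrC.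
- by move=> x; exact: integral_ge0.
- move=> h Hh x; apply: eq_integral => y _.
  by apply: (HF (fun p => (h p.1, p.2)) _ (x, y)); left; exists h.
Qed.

Local Notation mu := (@lebesgue_measure R).
Definition unit_shift : set (R -> R) := [set fun x => (x + 1)%R].

Lemma invariant_integral_shift (c : R) :
  invariant_integral mu unit_shift `[0%R, 1%R[ (fun x => x + c)%R `[0%R, 1%R[ 1%R.
Proof.
move=> F mF F0 HF; rewrite mul1e integral_periodic_shift//.
by move=> x; exact: (HF _ erefl).
Qed.

Lemma invariant_integral_itv (N : nat) :
  invariant_integral mu unit_shift `[(- N%:R)%R, N%:R%R[ id `[0%R, 1%R[ N.*2%:R.
Proof.
move=> F mF F0 HF; rewrite integral_periodic_itv//.
by move=> x; exact: (HF _ erefl).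
Qed.

(** Half-open, so that integer translates tile the space without overlap. *)
Definition cell : set (pt R) := (`[0%R, 1%R[ `*` `[0%R, 1%R[) `*` `[0%R, 1%R[.
(** The fourth coordinate is the phase of the laminate profile, treated as independent of the
    position. *)
Definition cell4 : set (pt R * R) := cell `*` `[0%R, 1%R[.

Lemma measurable_cell : measurable cell.
Proof. by apply: measurableX => //; exact: measurableX. Qed.

Lemma product_maps_pt (T : Type) (F : pt R -> T) : (forall j x, F (x + e j)%R = F x) ->
  forall h, product_maps (product_maps unit_shift unit_shift) unit_shift h ->
  forall x, F (h x) = F x.
Proof.
move=> HF h [[k [[_ -> <-]|[_ -> <-]] <-]|[_ -> <-]] [[x y] z] /=.
- by rewrite -[RHS](HF (0%R : 'I_3) (x, y, z)) /e /=; congr (F (_, _, _)) => /=; rewrite ?addr0.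
- by rewrite -[RHS](HF (1%R : 'I_3) (x, y, z)) /e /=; congr (F (_, _, _)) => /=; rewrite ?addr0.
- by rewrite -[RHS](HF (2%R : 'I_3) (x, y, z)) /e /=; congr (F (_, _, _)) => /=; rewrite ?addr0.
Qed.

Lemma integral_cube_periodic (F : pt R -> \bar R) (N : nat) :
  measurable_fun setT F -> (forall x, 0 <= F x) -> (forall j x, F (x + e j)%R = F x) ->
  \int[leb]_(x in (`[(- N%:R)%R, N%:R%R[ `*` `[(- N%:R)%R, N%:R%R[) `*` `[(- N%:R)%R, N%:R%R[) F x =
  (N.*2 ^ 3)%:R%R%:E * \int[leb]_(x in cell) F x.
Proof.
move=> mF F0 HF.
have I := @invariant_integral_itv N.
have m01 : measurable (`[0%R, 1%R[%classic : set R) by exact: measurable_itv.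
have mN : measurable (`[(- N%:R)%R, N%:R%R[%classic : set R) by exact: measurable_itv.
have mi : measurable_fun setT (@id R) by exact: measurable_id.
have N0 : (0 <= N.*2%:R :> R)%R by [].
have I2 := @invariant_integral_prod _ _ (measurableTypeR R) (measurableTypeR R) mu mu _ _ _ _ _ _ _ _ _ _ m01 mN m01 mN mi mi N0 I I.
have m2 : measurable_fun setT (fun p : measurableTypeR R * measurableTypeR R => (p.1, p.2)).
  exact: measurable_fun_pair.
have I3 := @invariant_integral_prod _ _ (measurableTypeR R * measurableTypeR R)%type (measurableTypeR R) (sf_prod mu mu) mu _ _ _ _ _ _ _ _ _ _ (measurableX m01 m01) (measurableX mN mN) m01 mN m2 mi N0 I2 I.
rewrite lebE !expnS expn0 muln1 !natrM mulrA -(I3 F mF F0 (product_maps_pt HF)).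
by apply: eq_integral => -[[x y] z] _.
Qed.

Lemma integral_cell_shift (F : pt R -> \bar R) (a : pt R) :
  measurable_fun setT F -> (forall x, 0 <= F x) -> (forall j x, F (x + e j)%R = F x) ->
  \int[leb]_(x in cell) F (x + a)%R = \int[leb]_(x in cell) F x.
Proof.
move=> mF F0 HF.
have m01 : measurable (`[0%R, 1%R[%classic : set R) by exact: measurable_itv.
have I2 := @invariant_integral_prod _ _ (measurableTypeR R) (measurableTypeR R) mu mu _ _ _ _ _ _ _ _ _ _
  m01 m01 m01 m01 (measurable_shift a.1.1) (measurable_shift a.1.2) ler01
  (invariant_integral_shift a.1.1) (invariant_integral_shift a.1.2).
have m2 : measurable_fun setT (fun p : measurableTypeR R * measurableTypeR R => (p.1 + a.1.1, p.2 + a.1.2)%R).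
  apply: measurable_fun_pair.
    by apply: (measurableT_comp (measurable_shift _)).
  by apply: (measurableT_comp (measurable_shift _)).
have I3 := @invariant_integral_prod _ _ (measurableTypeR R * measurableTypeR R)%type (measurableTypeR R) (sf_prod mu mu) mu _ _ _ _ _ _ _ _ _ _ (measurableX m01 m01) (measurableX m01 m01) m01 m01 m2 (measurable_shift a.2) ler01 I2
  (invariant_integral_shift a.2).
have := I3 F mF F0 (product_maps_pt HF); rewrite !mulr1 mul1e => <-.
by apply: eq_integral => -[[x y] z] _.
Qed.

Lemma integral_cell4_shift (F : pt R * R -> \bar R) (a : pt R) (c : R) :
  measurable_fun setT F -> (forall x, 0 <= F x) ->
  (forall j x t, F ((x + e j)%R, t) = F (x, t)) -> (forall x t, F (x, t + 1)%R = F (x, t)) ->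
  \int[leb4 R]_(p in cell4) F (p.1 + a, p.2 + c)%R = \int[leb4 R]_(p in cell4) F p.
Proof.
move=> mF F0 HF1 HF2.
have m01 : measurable (`[0%R, 1%R[%classic : set R) by exact: measurable_itv.
have mc := measurable_cell.
have ma : measurable_fun setT (fun x : pt (measurableTypeR R) => x + a)%R.
  apply: measurable_fun_pair; last first.
    by apply: (measurableT_comp (measurable_shift _)).
  apply: measurable_fun_pair => /=.
    by apply: (measurableT_comp (measurable_shift a.1.1)); apply: (measurableT_comp measurable_fst).
  by apply: (measurableT_comp (measurable_shift a.1.2)); apply: (measurableT_comp measurable_snd).
have I3 : @invariant_integral _ (pt (measurableTypeR R)) (lebs R)
    [set h | exists j, h = fun x => (x + e j)%R] cell (fun x => x + a)%R cell 1%R.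
  move=> G mG G0 HG; rewrite mul1e; apply: integral_cell_shift => //.
  by move=> j x; apply: (HG (fun x => (x + e j)%R)); exists j.
have I4 := @invariant_integral_prod _ _ (pt (measurableTypeR R)) (measurableTypeR R)
  (lebs R) mu _ _ _ _ _ _ _ _ _ _ mc mc m01 m01 ma (measurable_shift c) ler01 I3
  (invariant_integral_shift c).
have := I4 F mF F0; rewrite !mulr1 mul1e; apply.
move=> h [[k [j ->] <-]|[k -> <-]] [x t] /=; [exact: HF1|exact: HF2].
Qed.

End ProductPeriodic.

(** * Laminates and rank-one convexity *)

Section Profile.
Context {R : realType}.
Variable theta : R.
Hypothesis theta01 : 0 < theta < 1.

(* As N tends to infinity, [chi N] tends to the indicator of the points of [0, 1[
   at distance less than theta / 2 from 1 / 2. *)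
Definition bump (s : R) : R := cos (pi * (2 * s - 1)) - cos (pi * theta).
Definition chi (N : nat) (s : R) : R := (1 + expR (- (N%:R * bump s)))^-1.
Definition dchi (N : nat) (s : R) : R :=
  - N%:R * expR (- (N%:R * bump s)) * (chi N s) ^+ 2 * (2 * pi * sin (pi * (2 * s - 1))).
(** The middle value is that of the logistic function at 0, reached where [bump] vanishes, so that
    convergence holds at every point of [0, 1[. *)
Definition chi_lim (s : R) : R :=
  if `|2 * s - 1| < theta then 1 else if `|2 * s - 1| == theta then 2^-1 else 0.

Lemma chi_ge0_le1 (N : nat) (s : R) : 0 <= chi N s <= 1.
Proof.
rewrite invr_ge0 addr_ge0 ?expR_ge0//= invf_le1 ?ltr_pwDl ?expR_ge0//.
by rewrite lerDl expR_ge0.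
Qed.

Lemma bump_periodic (s : R) : bump (s + 1) = bump s.
Proof.
rewrite /bump (_ : pi * (2 * (s + 1) - 1) = pi * (2 * s - 1) + pi *+ 2); last by ring.
by rewrite cosD2pi.
Qed.

Lemma chi_periodic (N : nat) (s : R) : chi N (s + 1) = chi N s.
Proof. by rewrite /chi bump_periodic. Qed.

Lemma dchi_periodic (N : nat) (s : R) : dchi N (s + 1) = dchi N s.
Proof.
rewrite /dchi chi_periodic bump_periodic.
rewrite (_ : pi * (2 * (s + 1) - 1) = pi * (2 * s - 1) + pi *+ 2); last by ring.
by rewrite sinD2pi.
Qed.

Lemma is_derive_chi (N : nat) (s : R) : is_derive s 1 (chi N) (dchi N s).
Proof.
have d1 : is_derive s 1 (fun s => pi * (2 * s - 1) : R) (pi * 2).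
  by apply: is_derive_eq; rewrite /GRing.scale/=; ring.
have d2 : is_derive s 1 bump (- sin (pi * (2 * s - 1)) * (pi * 2)).
  have := @is_derive1_comp _ cos _ _ _ _ (is_derive_cos _) d1.
  by move=> d; apply: is_derive_eq; rewrite /GRing.scale/=; ring.
have d3 : is_derive s 1 (fun s => expR (- (N%:R * bump s)))
    (expR (- (N%:R * bump s)) * (- (N%:R * (- sin (pi * (2 * s - 1)) * (pi * 2))))).
  exact: (@is_derive1_comp _ expR (fun s => - (N%:R * bump s))).
have d4 : is_derive s 1 (fun s => 1 + expR (- (N%:R * bump s)))
    (expR (- (N%:R * bump s)) * (- (N%:R * (- sin (pi * (2 * s - 1)) * (pi * 2))))).
  by have := is_deriveD (is_derive_cst (1 : R) s 1) d3; rewrite add0r.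
have h0 : 1 + expR (- (N%:R * bump s)) != 0 by rewrite gt_eqF// addr_gt0 ?expR_gt0.
have := @is_deriveV _ (fun s => 1 + expR (- (N%:R * bump s))) _ _ _ h0 d4.
rewrite (_ : _ *: _ = dchi N s)//.
by rewrite /dchi /chi /GRing.scale/= exprVn; ring.
Qed.

Lemma continuous_chi (N : nat) : continuous (chi N).
Proof.
move=> s; apply: differentiable_continuous; apply/derivable1_diffP.
by have [] := is_derive_chi N s.
Qed.

Lemma continuous_bump : continuous bump.
Proof.
move=> s; apply: cvgB; last exact: cvg_cst.
apply: continuous_comp; last exact: continuous_cos.
apply: cvgM; first exact: cvg_cst.
by apply: cvgB; [apply: cvgM; [exact: cvg_cst|exact: cvg_id]|exact: cvg_cst].
Qed.

Lemma continuous_dchi (N : nat) : continuous (dchi N).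
Proof.
move=> s; apply: cvgM; [apply: cvgM|].
- apply: cvgM; first exact: cvg_cst.
  apply: continuous_comp; last exact: continuous_expR.
  by apply: cvgN; apply: cvgM; [exact: cvg_cst|exact: continuous_bump].
- by rewrite expr2; apply: cvgM; exact: continuous_chi.
- apply: cvgM; first exact: cvg_cst.
  apply: continuous_comp; last exact: continuous_sin.
  apply: cvgM; first exact: cvg_cst.
  by apply: cvgB; [apply: cvgM; [exact: cvg_cst|exact: cvg_id]|exact: cvg_cst].
Qed.

(** Cosine is even and decreasing on [0, pi], so comparing the cosines compares the arguments in
    reverse. *)
Lemma bump_sign (s : R) : 0 <= s < 1 ->
  [/\ (0 < bump s) = (`|2 * s - 1| < theta) & (bump s < 0) = (theta < `|2 * s - 1|)].
Proof.
move=> /andP[s0 s1]; have /andP[t0 t1] := theta01.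
have pi0 : 0 < pi :> R := pi_gt0 R.
have n1 : `|2 * s - 1| <= 1 by rewrite ler_norml; apply/andP; split; lra.
have cosn : cos (pi * (2 * s - 1)) = cos (pi * `|2 * s - 1|).
  by rewrite -[in RHS](gtr0_norm pi0) -normrM cos_norm.
have in1 (x : R) : 0 <= x -> x <= 1 -> pi * x \in `[0, pi].
  by move=> x0 x1; rewrite in_itv/= mulr_ge0 ?(ltW pi0)//=; rewrite ler_piMr// ltW.
have i1 := in1 _ (normr_ge0 _) n1; have i2 := in1 _ (ltW t0) (ltW t1).
rewrite /bump cosn subr_gt0 subr_lt0; split; rewrite ltr_cos// ltr_pM2l//.
Qed.

Lemma cvg_chi (s : R) : 0 <= s < 1 -> chi N s @[N --> \oo] --> chi_lim s.
Proof.
move=> s01; have [h1 h2] := bump_sign s01; rewrite /chi_lim.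
have E N : expR (- (N%:R * bump s)) = expR (- bump s) ^+ N.
  by rewrite -mulrN expRM_natl.
case: ltgtP => h.
- have : expR (- bump s) ^+ N @[N --> \oo] --> (0 : R).
    by apply: cvg_expr; rewrite ger0_norm ?expR_ge0// expR_lt1 oppr_lt0 h1.
  move=> c; rewrite (_ : 1 = (1 + 0 : R)^-1); last by rewrite addr0 invr1.
  apply: cvgV; first by rewrite addr0 oner_eq0.
  by apply: cvgD; [exact: cvg_cst|under eq_fun do rewrite E].
- have c : expR (bump s) ^+ N @[N --> \oo] --> (0 : R).
    by apply: cvg_expr; rewrite ger0_norm ?expR_ge0// expR_lt1 h2.
  apply: (@squeeze_cvgr _ _ _ _ (fun=> 0) (fun N => expR (bump s) ^+ N)) => //; last exact: cvg_cst.
  near=> N; have /andP[-> _] := chi_ge0_le1 N s => /=.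
  rewrite /chi E expRN exprVn -[leRHS]invrK lef_pV2 ?posrE ?addr_gt0 ?invr_gt0 ?exprn_gt0 ?expR_gt0//.
  by rewrite lerDr.
- have b0 : bump s = 0 by apply/eqP; case: (ltgtP (bump s) 0) h1 h2; rewrite h ltxx.
  rewrite (_ : chi ^~ s = fun=> 2^-1); first exact: cvg_cst.
  by apply/funext => N; rewrite /chi b0 mulr0 oppr0 expR0.
Unshelve. all: by end_near. Qed.
End Profile.

Section ProfileIntegral.
Context {R : realType}.
Variable theta : R.
Hypothesis theta01 : 0 < theta < 1.
Local Notation mu := (@lebesgue_measure R).
Local Open Scope ereal_scope.

Lemma measurable_cell4 : measurable (@cell4 R).
Proof. by apply: measurableX => //; exact: measurable_cell. Qed.

Lemma leb_cell : @leb R cell = 1.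
Proof.
have m01 : mu `[0%R, 1%R[ = 1.
  by rewrite lebesgue_measure_itv/= lte_fin ltr01 oppr0 adde0.
have m2 : (mu \x mu) (`[0%R, 1%R[ `*` `[0%R, 1%R[) = 1.
  transitivity (mu `[0%R, 1%R[ * mu `[0%R, 1%R[); first exact: product_measure1E.
  by rewrite m01 mule1.
transitivity ((mu \x mu) (`[0%R, 1%R[ `*` `[0%R, 1%R[) * mu `[0%R, 1%R[).
  by apply: product_measure1E => //; exact: measurableX.
by rewrite m2 m01 mule1.
Qed.

Lemma leb4_cell4 : leb4 R cell4 = 1.
Proof.
transitivity (leb (@cell R) * mu `[0%R, 1%R[).
  by apply: (@product_measure1E _ _ _ _ _ (lebs R) mu) => //; exact: measurable_cell.
by rewrite leb_cell mul1e lebesgue_measure_itv/= lte_fin ltr01 oppr0 adde0.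
Qed.

Lemma chi_lim_integral (g : R -> R) : (forall c, 0 <= g c)%R ->
  measurable_fun setT (fun s => g (chi_lim theta s)) ->
  \int[mu]_(s in `[0%R, 1%R[) (g (chi_lim theta s))%:E =
  (theta * g 1 + (1 - theta) * g 0)%R%:E.
Proof.
move=> g0 mg; have /andP[t0 t1] := theta01.
set a := ((1 - theta) / 2)%R; set b := ((1 + theta) / 2)%R.
have m : measurable_fun setT (fun s => (g (chi_lim theta s))%:E) by exact/measurable_EFinP.
have ab : (0 < a < b)%R /\ (b < 1)%R by rewrite /a /b; split; [apply/andP; split|]; lra.
case: ab => /andP[a0 ab] b1.
have p s : 0 <= (g (chi_lim theta s))%:E by rewrite lee_fin.
have mT (D : set R) : measurable_fun D (fun s => (g (chi_lim theta s))%:E) by exact: measurable_funTS.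
have i1 : (0 <= a <= 1)%R by rewrite (ltW a0) (ltW (lt_trans ab b1)).
have i2 : (a <= b <= 1)%R by rewrite (ltW ab) (ltW b1).
rewrite (integral_itv_cat i1 m p) (integral_itv_cat i2 m p).
rewrite -(integral_itv_obnd_cbnd (r := a))// -(integral_itv_obnd_cbnd (r := b))//.
have C (i : interval R) (c : R) : \int[mu]_(s in [set` i]) cst c%:E s = c%:E * mu [set` i].
  by apply: integral_cst; exact: measurable_itv.
have E1 : \int[mu]_(s in `[0%R, a[) (g (chi_lim theta s))%:E = (a * g 0)%R%:E.
  transitivity (\int[mu]_(s in `[0%R, a[) cst (g 0%R)%:E s).
    apply: eq_integral => s; rewrite inE/= in_itv/= => /andP[s0 sa].
    have h : (theta < `|2 * s - 1|)%R by rewrite ltr_normr; apply/orP; right; rewrite /a in sa; lra.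
    by rewrite /chi_lim ltNge (ltW h)/= gt_eqF.
  by rewrite C lebesgue_measure_itv/= lte_fin a0 oppr0 adde0 -EFinM mulrC.
have E2 : \int[mu]_(s in `]a, b[) (g (chi_lim theta s))%:E = (theta * g 1)%R%:E.
  transitivity (\int[mu]_(s in `]a, b[) cst (g 1%R)%:E s).
    apply: eq_integral => s; rewrite inE/= in_itv/= => /andP[sa sb].
    have h : (`|2 * s - 1| < theta)%R.
      by rewrite ltr_norml; rewrite /a in sa; rewrite /b in sb; apply/andP; split; lra.
    by rewrite /chi_lim h.
  rewrite C lebesgue_measure_itv/= lte_fin ab -EFinB -EFinM mulrC.
  by congr EFin; rewrite /a /b; field.
have E3 : \int[mu]_(s in `]b, 1%R[) (g (chi_lim theta s))%:E = ((1 - b) * g 0)%R%:E.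
  transitivity (\int[mu]_(s in `]b, 1%R[) cst (g 0%R)%:E s).
    apply: eq_integral => s; rewrite inE/= in_itv/= => /andP[sb s1].
    have h : (theta < `|2 * s - 1|)%R by rewrite ltr_normr; apply/orP; left; rewrite /b in sb; lra.
    by rewrite /chi_lim ltNge (ltW h)/= gt_eqF.
  by rewrite C lebesgue_measure_itv/= lte_fin b1 -EFinB -EFinM mulrC.
by rewrite E1 E2 E3 -!EFinD; congr EFin; rewrite /a /b; field.
Qed.

(** Dominated convergence on a cell of measure one, then Tonelli: in the limit the phase variable
    only selects the value 1 with weight [theta] or 0 with weight [1 - theta]. *)
Lemma cvg_chi_integral (G : pt R * R -> R) (L : R) :
  continuous G -> (forall p, (0 <= G p)%R) -> (forall y c, (0 <= c <= 1 -> G (y, c) <= L)%R) ->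
  \int[leb4 R]_(p in cell4) (G (p.1, chi theta N p.2))%:E @[N --> \oo] -->
  theta%:E * \int[leb]_(y in cell) (G (y, 1%R))%:E +
  (1 - theta)%:E * \int[leb]_(y in cell) (G (y, 0%R))%:E.
Proof.
move=> cG G0 GL; have /andP[t0 t1] := theta01.
have mchi N : measurable_fun setT (chi theta N) by apply: continuous_measurable_fun; exact: continuous_chi.
have mG : measurable_fun setT G by exact: continuous_measurable4.
have mN N : measurable_fun setT (fun p : pt (measurableTypeR R) * measurableTypeR R => G (p.1, chi theta N p.2)).
  by apply: (measurableT_comp mG); apply: measurable_fun_pair => //; apply: (measurableT_comp (mchi N)).
have lim_p (p : pt R * R) : cell4 p ->
    G (p.1, chi theta N p.2) @[N --> \oo] --> G (p.1, chi_lim theta p.2).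
  case: p => y s [_ /=]; rewrite in_itv/= => s01.
  apply: (continuous_cvg _ (cG _)).
  exact: (cvg_pair (cvg_cst y) (cvg_chi theta01 s01)).
have mc4 := measurable_cell4.
have mlim : measurable_fun setT (chi_lim theta).
  have mn : measurable_fun setT (fun s : R => `|2 * s - 1|%R).
    by apply: continuous_measurable_fun => s; apply: cvg_norm; apply: cvgB;
      [apply: cvgM; [exact: cvg_cst|exact: cvg_id]|exact: cvg_cst].
  apply: measurable_fun_ifT => //; first exact: measurable_fun_ltr.
  by apply: measurable_fun_ifT => //; exact: measurable_fun_eqr.
have mGlim : measurable_fun setT (fun p : pt (measurableTypeR R) * measurableTypeR R => G (p.1, chi_lim theta p.2)).
  by apply: (measurableT_comp mG); apply: measurable_fun_pair => //; apply: (measurableT_comp mlim).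
rewrite [X in _ --> X](_ : _ = \int[leb4 R]_(p in cell4) (G (p.1, chi_lim theta p.2))%:E).
  apply: (@dominated_cvg _ _ _ (leb4 R) cell4 mc4 (fun N p => (G (p.1, chi theta N p.2))%:E)
    (fun p => (G (p.1, chi_lim theta p.2))%:E) (cst L%:E)).
  - by move=> N; apply: measurable_funTS; apply/measurable_EFinP; exact: (mN N).
  - by move=> p cp; apply: cvg_EFin; [exact: nearW|exact: lim_p].
  - by [].
  - apply/integrableP; split; first exact: measurable_cst.
    rewrite (_ : \int[_]_(x in _) _ = `|L|%:E * leb4 R cell4); last by apply: integral_cst.
    by rewrite leb4_cell4 mule1 ltry.
  - move=> N [y s] [cy _] /=; rewrite lee_fin ger0_norm//; apply: GL; exact: chi_ge0_le1.
have mc := @measurable_cell R.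
have m1 (c : R) : measurable_fun setT (fun y => (G (y, c))%:E).
  by apply/measurable_EFinP; exact: (measurable_fun_pair1 _ mG).
have m01 : measurable (`[0%R, 1%R[%classic : set R) by exact: measurable_itv.
have mGE : measurable_fun setT (fun p : pt (measurableTypeR R) * measurableTypeR R =>
  (G (p.1, chi_lim theta p.2))%:E) by exact/measurable_EFinP.
have pGE (p : pt (measurableTypeR R) * measurableTypeR R) : 0 <= (G (p.1, chi_lim theta p.2))%:E.
  by rewrite lee_fin.
have T := @tonelli_setX R _ _ _ _ (lebs R) mu _ _ _ mc m01 mGE pGE.
apply/esym; apply: (etrans T).
apply/esym; transitivity (\int[lebs R]_(y in cell) (theta%:E * (G (y, 1%R))%:E + (1 - theta)%:E * (G (y, 0%R))%:E)).
  rewrite ge0_integralD//=; last 4 first.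
  - by move=> y _; rewrite lee_fin mulr_ge0// ltW.
  - by apply: measurable_funTS; apply: measurable_funeM; exact: m1.
  - by move=> y _; rewrite lee_fin mulr_ge0// subr_ge0 ltW.
  - by apply: measurable_funTS; apply: measurable_funeM; exact: m1.
  have Z (k c : R) : (0 <= k)%R -> k%:E * \int[leb]_(y in cell) (G (y, c))%:E =
      \int[lebs R]_(y in cell) (k%:E * (G (y, c))%:E).
    move=> k0; apply/esym/ge0_integralZl_EFin => //.
      by move=> y _; rewrite lee_fin.
    by apply: measurable_funTS; exact: (m1 c).
  congr (_ + _); apply: Z; first exact: ltW.
  by rewrite subr_ge0 ltW.
apply: eq_integral => y _; rewrite -!EFinM -EFinD.
apply/esym/(@chi_lim_integral (fun c => G (y, c))) => //.
exact: (measurable_fun_pair2 _ mGlim).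
Qed.
End ProfileIntegral.

(** * Antiderivatives and derivatives along lines *)

Section Antiderivative.
Context {R : realType}.
Local Notation mu := (@lebesgue_measure R).

Lemma continuous_integrable_itv (g : R -> R) (a b : R) : continuous g ->
  mu.-integrable `[a, b] (EFin \o g).
Proof.
move=> cg; apply: continuous_compact_integrable; first exact: segment_compact.
exact: continuous_subspaceT.
Qed.

Lemma antiderivative (g : R -> R) : continuous g ->
  exists G : R -> R, forall x : R, is_derive x 1 G (g x).
Proof.
move=> cg.
pose G (x : R) := if 0 <= x then \int[mu]_(t in `]0, x]) g t
                  else - \int[mu]_(t in `]x, 0]) g t.
exists G => x.
(* The fundamental theorem is applied from a base point to the left of both 0 and x; near x, [G]
   differs from that integral by the constant [F 0]. *)
pose a : R := - (`|x| + 1); pose F (y : R) := \int[mu]_(t in `[a, y]) g t.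
have a0 : a < 0 by rewrite oppr_lt0 ltr_pwDr.
have ax : a < x by rewrite /a ltrNl ltr_pwDr// -normrN ler_norm.
have [dF F'] := continuous_FTC1_closed (ltr_pwDr ltr01 (lexx x))
  (@continuous_integrable_itv g a (x + 1) cg) ax (cg x).
have dFx : is_derive x 1 (fun y => F y - F 0) (g x).
  have d1 : is_derive x 1 F (g x) by apply: (DeriveDef dF); rewrite -F' derive1E.
  by have := is_deriveB d1 (is_derive_cst (F 0) x 1); rewrite subr0.
apply: near_eq_is_derive dFx; near=> y.
have ay : a < y by near: y; exact: lt_nbhsr.
rewrite /G /F; case: (leP 0 y) => y0.
  by apply: Rintegral_itvB; [exact: continuous_integrable_itv|rewrite bnd_simp ltW|rewrite bnd_simp].
apply: oppr_inj; rewrite opprB opprK.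
by apply: Rintegral_itvB; [exact: continuous_integrable_itv|rewrite bnd_simp ltW|rewrite bnd_simp ltW].
Unshelve. all: by end_near. Qed.

Lemma is_derive_continuous (f : R -> R) (x d : R) : is_derive x 1 f d -> {for x, continuous f}.
Proof. by move=> [df _]; apply: differentiable_continuous; apply/derivable1_diffP. Qed.

(** [G (y + 1) - G y] has derivative zero, hence is constant, and at 0 it is the integral of [g]
    over one period. *)
Lemma periodic_antiderivative (g : R -> R) : continuous g -> (forall x, g (x + 1) = g x) ->
  (\int[mu]_(x in `[0%R, 1%R[) (g x)%:E = 0)%E ->
  exists G : R -> R, (forall x : R, is_derive x 1 G (g x)) /\ forall x, G (x + 1) = G x.
Proof.
move=> cg gper int0; have [G dG] := antiderivative cg; exists G; split => // x.
have cG : continuous G by move=> y; exact: is_derive_continuous (dG y).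
have G01 : G 1 = G 0.
  have := @continuous_FTC2 R g G 0 1 ltr01 (continuous_subspaceT cg) _ _.
  rewrite -integral_itv_bndo_bndc; last first.
    by apply/measurable_EFinP; apply: measurable_funTS; exact: continuous_measurable_fun.
  rewrite int0 => /(_ _ _)/esym H; apply/eqP; rewrite -subr_eq0 -eqe EFinB H//.
    split; first by move=> y _; have [] := dG y.
      exact/cvg_at_right_filter/cG.
    exact/cvg_at_left_filter/cG.
  by move=> y _; rewrite derive1E; have [_ ->] := dG y.
have d0 (y : R) : is_derive y 1 (fun y => G (y + 1) - G y) 0.
  have d1 : is_derive y 1 (fun y => y + 1 : R) 1.
    by have := is_deriveD (is_derive_id y 1) (is_derive_cst (1 : R) y 1); rewrite addr0.
  have d2 := @is_derive1_comp R G (fun y => y + 1) y _ _ (dG (y + 1)) d1.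
  by have := is_deriveB d2 (dG y); rewrite gper mulr1 subrr.
have := is_derive_0_is_cst x 0 d0; rewrite /= add0r G01 subrr => /eqP.
by rewrite subr_eq0 => /eqP.
Qed.

End Antiderivative.

Section LineDerivative.
Context {R : realType}.

(** Reduces directional derivatives to one real variable, where the chain rule for functions of a
    real argument applies. *)
Lemma is_derive_lineP (V : normedModType R) (f : V -> R) (x v : V) (d : R) :
  is_derive x v f d <-> is_derive (0 : R) 1 (fun t : R => f (x + t *: v)) d.
Proof.
have E : (fun h : R => h^-1 *: ((f \o shift x) (h *: v) - f x)) =
    (fun h : R => h^-1 *: (((fun t : R => f (x + t *: v)) \o shift 0) (h *: (1 : R)) -
       (fun t : R => f (x + t *: v)) 0)).
  apply/funext => h; congr (_ *: (_ - _)); rewrite /= ?scale0r ?addr0//.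
  by rewrite addrC /GRing.scale/= mulr1.
split=> [[df Df]|[df Df]].
  have df' : derivable (fun t : R => f (x + t *: v)) 0 1 by rewrite /derivable -E.
  by apply: (DeriveDef df'); rewrite -Df /derive E.
have df' : derivable f x v by rewrite /derivable E.
by apply: (DeriveDef df'); rewrite -Df /derive E.
Qed.

Lemma is_derive_affine (x c : R) (a : R) : is_derive x 1 (fun t : R => c + a * t) a.
Proof.
have d2 : is_derive x 1 (fun t : R => a * t) (a * 1).
  exact: (is_deriveZ a (is_derive_id x (1 : R))).
by have := is_deriveD (is_derive_cst c x (1 : R)) d2; rewrite add0r mulr1.
Qed.

Definition dot (z : 'I_3 -> R) (x : pt R) : R := z 0 * x.1.1 + z 1 * x.1.2 + z 2 * x.2.

Lemma I3P (j : 'I_3) : [\/ j = 0, j = 1 | j = 2].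
Proof.
by case: j => -[|[|[|//]]] h; [apply: Or31|apply: Or32|apply: Or33]; apply: val_inj.
Qed.

Lemma dotD (z : 'I_3 -> R) (x : pt R) (t : R) j : dot z (x + t *: e j) = dot z x + z j * t.
Proof.
case: x => -[x y] w; rewrite /dot /e /GRing.scale/= /GRing.scale/=.
by case: (I3P j) => ->/=; ring.
Qed.

Lemma is_derive_comp_dot (phi dphi : R -> R) (z : 'I_3 -> R) (c : R) (x : pt R) j :
  (forall s : R, is_derive s 1 phi (dphi s)) ->
  is_derive x (e j) (fun x => phi (dot z x + c)) (dphi (dot z x + c) * z j).
Proof.
move=> dp; apply/is_derive_lineP.
rewrite (_ : (fun t => _) = phi \o (fun t => dot z x + c + z j * t)).
  apply: is_derive1_comp; last exact: is_derive_affine.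
  by rewrite mulr0 addr0.
by apply/funext => t /=; rewrite dotD addrAC.
Qed.

Lemma is_derive_comp_scale (w : pt R -> R) (k d : R) (x y : pt R) j :
  is_derive (k *: x + y) (e j) w d ->
  is_derive x (e j) (fun x => w (k *: x + y)) (d * k).
Proof.
move=> /is_derive_lineP dw; apply/is_derive_lineP.
rewrite (_ : (fun t => _) = (fun t => w (k *: x + y + t *: e j)) \o (fun t => 0 + k * t)).
  apply: is_derive1_comp; last exact: is_derive_affine.
  by rewrite mulr0 addr0.
by apply/funext => t /=; rewrite add0r scalerDr scalerA addrAC.
Qed.

Lemma is_deriveM_fun (f g : pt R -> R) (x v : pt R) (df dg : R) :
  is_derive x v f df -> is_derive x v g dg ->
  is_derive x v (fun x => f x * g x) (f x * dg + g x * df).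
Proof. by move=> h1 h2; have := is_deriveM h1 h2; rewrite /GRing.scale. Qed.

Lemma is_deriveD_fun (f g : pt R -> R) (x v : pt R) (df dg : R) :
  is_derive x v f df -> is_derive x v g dg ->
  is_derive x v (fun x => f x + g x) (df + dg).
Proof. by move=> h1 h2; exact: is_deriveD. Qed.

Lemma continuous_dot (z : 'I_3 -> R) (c : R) : continuous (fun x : pt R => dot z x + c).
Proof.
have c1 : continuous (fun x : pt R => x.1.1).
  by move=> x; apply: (@continuous_comp _ _ _ fst fst); [exact: cvg_fst|exact: cvg_fst].
have c2 : continuous (fun x : pt R => x.1.2).
  by move=> x; apply: (@continuous_comp _ _ _ fst snd); [exact: cvg_fst|exact: cvg_snd].
have c3 : continuous (fun x : pt R => x.2) by move=> x; exact: cvg_snd.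
move=> x; apply: cvgD; last exact: cvg_cst.
apply: cvgD; first apply: cvgD; (apply: cvgM; [exact: cvg_cst|]).
- exact: c1.
- exact: c2.
- exact: c3.
Qed.

Lemma continuous_scale_shift (k : R) (y : pt R) : continuous (fun x : pt R => k *: x + y).
Proof.
by move=> x; apply: cvgD; [apply: cvgZr; exact: cvg_id|exact: cvg_cst].
Qed.

Lemma periodic_reduce (T : Type) (F : pt R -> T) : (forall j x, F (x + e j) = F x) ->
  forall x, exists2 y, F x = F y & ((`[0, 1] `*` `[0, 1]) `*` `[0, 1])%classic y.
Proof.
move=> HF [[x y] z].
have h1 (y z : R) := periodic_intz (f := fun x => F (x, y, z))
  (fun x => product_maps_pt HF (or_introl (ex_intro2 _ _ _ (or_introl (ex_intro2 _ _ _ erefl erefl)) erefl)) (x, y, z)).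
have h2 (x z : R) := periodic_intz (f := fun y => F (x, y, z))
  (fun y => product_maps_pt HF (or_introl (ex_intro2 _ _ _ (or_intror (ex_intro2 _ _ _ erefl erefl)) erefl)) (x, y, z)).
have h3 (x y : R) := periodic_intz (f := fun z => F (x, y, z))
  (fun z => product_maps_pt HF (or_intror (ex_intro2 _ _ _ erefl erefl)) (x, y, z)).
have fr (w : R) : 0 <= w + (- Num.floor w)%:~R <= 1.
  have /andP[a b] := floor_itv w; rewrite intrN subr_ge0 a/= lerBlDr.
  by rewrite (le_trans (ltW b))// intrD addrC.
exists (x + (- Num.floor x)%:~R, y + (- Num.floor y)%:~R, z + (- Num.floor z)%:~R).
  by rewrite (h1 _ _ (- _)) (h2 _ _ (- _)) (h3 _ _ (- _)).
by split; [split|] => /=; rewrite in_itv/=; exact: fr.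
Qed.

Lemma periodic_bounded (F : pt R -> R) : continuous F -> (forall j x, F (x + e j) = F x) ->
  exists L, forall x, `|F x| <= L.
Proof.
move=> cF HF.
have comp : compact ((`[0, 1] `*` `[0, 1]) `*` `[0, 1] : set (pt R)).
  by apply: compact_setX; [apply: compact_setX|]; exact: segment_compact.
have [M [_ HM]] := compact_bounded (continuous_compact (continuous_subspaceT cF) comp).
exists (M + 1) => x; have [y -> cy] := periodic_reduce HF x.
by apply: (HM (M + 1)); [rewrite ltrDl|exists y].
Qed.

(** Uniform continuity on bounded sets, entry by entry: it compares [f] at an ideal gradient and at
    a perturbed one with a tolerance independent of the point. *)
Definition uniform_on_bounded (f : 'M[R]_3 -> R) := forall L eps : R, 0 < eps ->
  exists2 del, 0 < del & forall M N : 'M[R]_3,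
    (forall i j, `|M i j| <= L) -> (forall i j, `|N i j| <= L) ->
    (forall i j, `|M i j - N i j| <= del) -> `|f M - f N| <= eps.

Lemma uniform_on_bounded_continuous (X : topologicalType) (f : 'M[R]_3 -> R)
    (Phi : X -> 'M[R]_3) : uniform_on_bounded f ->
  (forall i j, continuous (fun x => Phi x i j)) -> continuous (fun x => f (Phi x)).
Proof.
move=> uf cP x; apply/cvgrPdist_le => eps e0.
pose L := \sum_i \sum_j `|Phi x i j| + 1.
have HL i j : `|Phi x i j| + 1 <= L.
  rewrite lerD2r (bigD1 i)//= (bigD1 j)//= -addrA lerDl addr_ge0//.
    by apply: sumr_ge0.
  by apply: sumr_ge0 => k _; apply: sumr_ge0.
have [del d0 H] := uf L eps e0.
have m0 : 0 < Num.min del 1 by rewrite lt_min d0 ltr01.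
have N : \forall y \near x, forall i j, `|Phi x i j - Phi y i j| <= Num.min del 1.
  apply: filter_forall => i; apply: filter_forall => j.
  by have /cvgrPdist_le/(_ _ m0) := cP i j x.
apply: filterS N => y hy; apply: H => [i j|i j|i j].
- by apply: le_trans (HL i j); rewrite lerDl.
- apply: le_trans (HL i j); rewrite -(subrK (Phi x i j) (Phi y i j)) addrC.
  rewrite (le_trans (ler_normD _ _))// lerD2l distrC (le_trans (hy i j))//.
  by rewrite ge_min lexx orbT.
- by rewrite (le_trans (hy i j))// ge_min lexx.
Qed.

End LineDerivative.

(** * Averaging over translations *)

Section Averaging.
Context {R : realType}.
Local Notation mu := (@lebesgue_measure R).
Local Open Scope ereal_scope.

Lemma tonelli_swap d1 d2 (X1 : measurableType d1) (X2 : measurableType d2)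
  (m1 : {sigma_finite_measure set X1 -> \bar R})
  (m2 : {sigma_finite_measure set X2 -> \bar R})
  (F : X1 * X2 -> \bar R) (D1 : set X1) (D2 : set X2) :
  measurable D1 -> measurable D2 -> measurable_fun setT F -> (forall x, 0 <= F x) ->
  \int[m1]_(x in D1) \int[m2]_(y in D2) F (x, y) =
  \int[m2]_(y in D2) \int[m1]_(x in D1) F (x, y).
Proof.
move=> mD1 mD2 mF F0.
have mG : measurable_fun setT (F \_ (D1 `*` D2)).
  by apply/(measurable_restrictT _ _).1 => //; [exact: measurableX|exact: measurable_funTS].
have := fubini_tonelli (m1 := m1) (m2 := m2) _ mG (fun x => erestrict_ge0 (fun y _ => F0 y) x).
rewrite /fubini_F /fubini_G => H.
transitivity (\int[m1]_x \int[m2]_y (F \_ (D1 `*` D2)) (x, y)).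
  rewrite integral_mkcond; apply: eq_integral => x _; rewrite /patch.
  case: ifPn => xD1; last first.
    by apply/esym/integral0_eq => y _; rewrite in_setX (negbTE xD1).
  by rewrite integral_mkcond; apply: eq_integral => y _; rewrite /patch in_setX xD1.
apply: (etrans H).
rewrite [RHS]integral_mkcond; apply: eq_integral => y _; rewrite /patch.
case: ifPn => yD2; last first.
  by apply/integral0_eq => x _; rewrite in_setX (negbTE yD2) andbF.
by rewrite [RHS]integral_mkcond; apply: eq_integral => x _; rewrite /patch in_setX yD2 andbT.
Qed.

Lemma integral_cell_cst (r : \bar R) : \int[leb]_(x in @cell R) cst r x = r.
Proof.
rewrite lebE integral_cst; last exact: measurable_cell.
by rewrite -[RHS]mule1; congr (_ * _); exact: leb_cell.
Qed.

Lemma integral_cell4_cst (r : \bar R) : \int[leb4 R]_(x in @cell4 R) cst r x = r.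
Proof.
rewrite integral_cst; last exact: measurable_cell4.
by rewrite -[RHS]mule1; congr (_ * _); exact: leb4_cell4.
Qed.

(* Averaging over all translations makes the oscillating integral exact, so some
   translation does as well as the mean. *)
Lemma exists_translation (H : pt R * R -> R) (k : R) (z : 'I_3 -> R) (r : R) :
  continuous H -> (forall p, (0 <= H p)%R) ->
  (forall j x t, H ((x + e j)%R, t) = H (x, t)) -> (forall x t, H (x, t + 1)%R = H (x, t)) ->
  \int[leb4 R]_(p in cell4) (H p)%:E < r%:E ->
  exists p : pt R * R, \int[leb]_(x in cell) (H (k *: x + p.1, dot z x + p.2)%R)%:E < r%:E.
Proof.
move=> cH H0 Hp1 Hp2 Hr; apply: contrapT => /forallNP no.
have mc := @measurable_cell R.
have mH := continuous_measurable4 cH.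
pose K (q : (pt (measurableTypeR R) * measurableTypeR R) * pt (measurableTypeR R)) : \bar R :=
  (H (k *: q.2 + q.1.1, dot z q.2 + q.1.2)%R)%:E.
have q1 : measurable_fun setT (fun x : pt (measurableTypeR R) => x.1.1).
  by apply: (measurableT_comp measurable_fst); exact: measurable_fst.
have q2 : measurable_fun setT (fun x : pt (measurableTypeR R) => x.1.2).
  by apply: (measurableT_comp measurable_snd); exact: measurable_fst.
have q3 : measurable_fun setT (fun x : pt (measurableTypeR R) => x.2).
  exact: measurable_snd.
pose Q := ((pt (measurableTypeR R) * measurableTypeR R) * pt (measurableTypeR R))%type.
have mp : measurable_fun setT (fun q : Q => q.1.1).
  by apply: (measurableT_comp measurable_fst); exact: measurable_fst.
have ms (g : pt (measurableTypeR R) -> measurableTypeR R) (c : R) : measurable_fun setT g ->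
    measurable_fun setT (fun q : Q => c * (g q.2 : R) + (g q.1.1 : R))%R.
  move=> mg; apply: measurable_funD; last exact: (measurableT_comp mg mp).
  by apply: measurable_funM => //; apply: (measurableT_comp mg measurable_snd).
have mK : measurable_fun setT K.
  apply/measurable_EFinP; apply: (measurableT_comp mH); apply: measurable_fun_pair.
    rewrite (_ : (fun q => _) = (fun q : Q => (k * q.2.1.1 + q.1.1.1.1, k * q.2.1.2 + q.1.1.1.2,
      k * q.2.2 + q.1.1.2)%R)); last by apply/funext => -[[[[a b] c] t] [[x y] w]].
    apply: measurable_fun_pair; first apply: measurable_fun_pair.
    - exact: ms q1.
    - exact: ms q2.
    - exact: ms q3.
  apply: measurable_funD; last first.
    by apply: (measurableT_comp measurable_snd); exact: measurable_fst.
  rewrite /dot; apply: measurable_funD; first apply: measurable_funD.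
  - by apply: measurable_funM => //; exact: (measurableT_comp q1 measurable_snd).
  - by apply: measurable_funM => //; exact: (measurableT_comp q2 measurable_snd).
  - by apply: measurable_funM => //; exact: (measurableT_comp q3 measurable_snd).
have K0 q : 0 <= K q by rewrite lee_fin.
have mc4 := @measurable_cell4 R.
have S := tonelli_swap (leb4 R) (lebs R) mc4 mc mK K0.
(* For fixed x, the argument of [H] is p translated by (k x, z . x), so by periodicity the inner
   integral does not depend on x. *)
have E2 : \int[lebs R]_(x in cell) \int[leb4 R]_(p in cell4) K (p, x) =
    \int[leb4 R]_(p in cell4) (H p)%:E.
  transitivity (\int[lebs R]_(x in cell) cst (\int[leb4 R]_(p in cell4) (H p)%:E) x).
    apply: eq_integral => x _ /=.
    rewrite -(integral_cell4_shift (k *: x)%R (dot z x) (F := fun p => (H p)%:E)) //.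
    - by apply: eq_integral => p _; rewrite /K /= addrC [(dot z x + _)%R]addrC.
    - exact/measurable_EFinP.
    - by move=> j y t; rewrite Hp1.
    - by move=> y t; rewrite Hp2.
  exact: integral_cell_cst.
have : r%:E <= \int[leb4 R]_(p in cell4) (H p)%:E.
  rewrite -E2 -S.
  apply: (@le_trans _ _ (\int[leb4 R]_(p in cell4) cst r%:E p)).
    by rewrite integral_cell4_cst.
  apply: ge0_le_integral => //.
  - move=> p _; apply: ltW; apply: le_lt_trans Hr; apply: integral_ge0 => q _.
    by rewrite lee_fin.
  - by apply: measurable_funTS; exact: (measurable_integral_section (lebs R) mc mK K0).
  - by move=> p _; rewrite leNgt; apply/negP; exact: (no p).
by rewrite leNgt Hr.
Qed.
End Averaging.

(** * Laminates whose phases oscillate *)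

Section Laminate.
Context {R : realType}.

Definition C1periodic (v : pt R -> 'cV[R]_3) (G : pt R -> 'M[R]_3) : Prop :=
  [/\ forall i, continuous (fun x => v x i 0),
      forall i j, continuous (fun x => G x i j),
      forall i j x, is_derive x (e j) (fun x => v x i 0) (G x i j)
    & forall j x, v (x + e j) = v x /\ G (x + e j) = G x].

Variables (vA vB : pt R -> 'cV[R]_3) (GA GB : pt R -> 'M[R]_3).
Variables (phi dphi chi dchi : R -> R) (a : 'cV[R]_3) (z : 'I_3 -> int) (m : R) (k : nat).
Hypotheses (C1A : C1periodic vA GA) (C1B : C1periodic vB GB) (k0 : (0 < k)%N) (m0 : m != 0).
Hypotheses (dphiE : forall s : R, is_derive s 1 phi (dphi s)) (cdphi : continuous dphi)
  (pphi : forall s, phi (s + 1) = phi s) (pdphi : forall s, dphi (s + 1) = dphi s).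
Hypotheses (dchiE : forall s : R, is_derive s 1 chi (dchi s)) (cdchi : continuous dchi)
  (pchi : forall s, chi (s + 1) = chi s) (pdchi : forall s, dchi (s + 1) = dchi s).

Lemma is_derive_congr (V : normedModType R) (f : V -> R) (x v : V) (d d' : R) :
  is_derive x v f d -> d = d' -> is_derive x v f d'.
Proof. by move=> h <-. Qed.

(** Position [y] and phase [s] are kept as independent arguments, the form that averaging needs. The
    first term is the coarse rank-one oscillation in the direction [z / m]; the last comes from
    differentiating the profile and is of order 1 / k. *)
Definition lam_grad (y : pt R) (s : R) : 'M[R]_3 := \matrix_(i, j)
  (dphi s * (a i 0 * ((z j)%:~R / m)) + (chi s * GA y i j + (1 - chi s) * GB y i j) +
   dchi s * (vA y i 0 - vB y i 0) * ((z j)%:~R / k%:R)).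

Definition zR (j : 'I_3) : R := (z j)%:~R.

(** An integer vector [z] and an integer frequency [k] keep the map periodic, while [z / m] can
    approximate any direction. The shifts [y0] and [tau] are left free, to be chosen by
    averaging. *)
Definition lam_fun (y0 : pt R) (tau : R) (x : pt R) : 'cV[R]_3 :=
  let y := k%:R *: x + y0 in let s := dot zR x + tau in
  \col_i (phi s * (a i 0 / m) + (chi s * vA y i 0 + (1 - chi s) * vB y i 0) * k%:R^-1).

Let cphi : continuous phi. Proof. by move=> s; exact: is_derive_continuous (dphiE s). Qed.
Let cchi : continuous chi. Proof. by move=> s; exact: is_derive_continuous (dchiE s). Qed.

Lemma lam_grad_continuous i j : continuous (fun p : pt R * R => lam_grad p.1 p.2 i j).
Proof.
case: C1A => cA cGA _ _; case: C1B => cB cGB _ _.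
rewrite (_ : (fun p => _) = (fun p : pt R * R =>
  dphi p.2 * (a i 0 * ((z j)%:~R / m)) + (chi p.2 * GA p.1 i j + (1 - chi p.2) * GB p.1 i j) +
  dchi p.2 * (vA p.1 i 0 - vB p.1 i 0) * ((z j)%:~R / k%:R))); last first.
  by apply/funext => p; rewrite mxE.
have c1 (f : pt R -> R) : continuous f -> continuous (fun p : pt R * R => f p.1).
  by move=> cf p; apply: (@continuous_comp _ _ _ fst f); [exact: cvg_fst|exact: cf].
have c2 (f : R -> R) : continuous f -> continuous (fun p : pt R * R => f p.2).
  by move=> cf p; apply: (@continuous_comp _ _ _ snd f); [exact: cvg_snd|exact: cf].
move=> p; apply: cvgD; first apply: cvgD.
- by apply: cvgM; [exact: c2|exact: cvg_cst].
- apply: cvgD; apply: cvgM.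
  + exact: c2.
  + exact: (c1 (fun y => GA y i j)).
  + by apply: cvgB; [exact: cvg_cst|exact: c2].
  + exact: (c1 (fun y => GB y i j)).
- apply: cvgM; last exact: cvg_cst.
  apply: cvgM; first exact: c2.
  by apply: cvgB; [exact: (c1 (fun y => vA y i 0))|exact: (c1 (fun y => vB y i 0))].
Qed.

Lemma lam_periodic j (x : pt R) (y0 : pt R) (tau : R) (T : Type) (H : pt R -> R -> T) :
  (forall j x s, H (x + e j) s = H x s) -> (forall x s, H x (s + 1) = H x s) ->
  H (k%:R *: (x + e j) + y0) (dot zR (x + e j) + tau) = H (k%:R *: x + y0) (dot zR x + tau).
Proof.
move=> H1 H2.
have -> : dot zR (x + e j) + tau = dot zR x + tau + (z j)%:~R.
  by have := dotD zR x 1 j; rewrite scale1r mulr1 => ->; rewrite addrAC.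
rewrite (periodic_intz (H2 _)).
have Hk (n : nat) y s : H (y + n%:R *: e j) s = H y s.
  by elim: n => [|n <-]; rewrite ?scale0r ?addr0// -natr1 scalerDl scale1r addrA H1.
by rewrite scalerDr addrAC Hk.
Qed.

Lemma lam_gradD y s j : lam_grad (y + e j) s = lam_grad y s.
Proof.
case: C1A => _ _ _ /(_ j y) [hA hGA]; case: C1B => _ _ _ /(_ j y) [hB hGB].
by apply/matrixP => i l; rewrite !mxE hA hGA hB hGB.
Qed.

Lemma lam_grad1 y s : lam_grad y (s + 1) = lam_grad y s.
Proof. by apply/matrixP => i l; rewrite !mxE pdphi pchi pdchi. Qed.

Lemma C1periodic_laminate (y0 : pt R) (tau : R) :
  C1periodic (lam_fun y0 tau) (fun x => lam_grad (k%:R *: x + y0) (dot zR x + tau)).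
Proof.
case: (C1A) => cA cGA dA pA; case: (C1B) => cB cGB dB pB.
have E i : (fun x => lam_fun y0 tau x i 0) = (fun x =>
    phi (dot zR x + tau) * (a i 0 / m) + (chi (dot zR x + tau) * vA (k%:R *: x + y0) i 0 +
    (1 - chi (dot zR x + tau)) * vB (k%:R *: x + y0) i 0) * k%:R^-1).
  by apply/funext => x; rewrite mxE.
have cd (f : R -> R) : continuous f -> continuous (fun x : pt R => f (dot zR x + tau)).
  by move=> cf x; apply: continuous_comp; [exact: continuous_dot|exact: cf].
have cs (f : pt R -> R) : continuous f -> continuous (fun x : pt R => f (k%:R *: x + y0)).
  by move=> cf x; apply: continuous_comp; [exact: continuous_scale_shift|exact: cf].
split.
- move=> i; rewrite E => x; apply: cvgD; first by apply: cvgM; [exact: cd|exact: cvg_cst].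
  apply: cvgM; last exact: cvg_cst.
  apply: cvgD; apply: cvgM.
  + exact: cd.
  + exact: (cs (fun x => vA x i 0)).
  + by apply: cvgB; [exact: cvg_cst|exact: cd].
  + exact: (cs (fun x => vB x i 0)).
- move=> i j.
  rewrite (_ : (fun x => _) = (fun x : pt R =>
    dphi (dot zR x + tau) * (a i 0 * ((z j)%:~R / m)) +
    (chi (dot zR x + tau) * GA (k%:R *: x + y0) i j + (1 - chi (dot zR x + tau)) * GB (k%:R *: x + y0) i j) +
    dchi (dot zR x + tau) * (vA (k%:R *: x + y0) i 0 - vB (k%:R *: x + y0) i 0) * ((z j)%:~R / k%:R)));
    last by apply/funext => x; rewrite mxE.
  move=> x; apply: cvgD; first apply: cvgD.
  + by apply: cvgM; [exact: cd|exact: cvg_cst].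
  + apply: cvgD; apply: cvgM.
    * exact: cd.
    * exact: (cs (fun y => GA y i j)).
    * by apply: cvgB; [exact: cvg_cst|exact: cd].
    * exact: (cs (fun y => GB y i j)).
  + apply: cvgM; last exact: cvg_cst.
    apply: cvgM; first exact: cd.
    by apply: cvgB; [exact: (cs (fun y => vA y i 0))|exact: (cs (fun y => vB y i 0))].
- move=> i j x; rewrite E.
  have d1 := is_derive_comp_dot zR tau x j dphiE.
  have d2 := is_derive_comp_dot zR tau x j dchiE.
  have d3 := is_derive_comp_scale (dA i j (k%:R *: x + y0)).
  have d4 := is_derive_comp_scale (dB i j (k%:R *: x + y0)).
  have d5 : is_derive x (e j) (fun x => 1 - chi (dot zR x + tau)) _ := is_deriveB (is_derive_cst (1 : R) x (e j)) d2.
  have d6 := is_deriveM_fun (is_deriveD_fun (is_deriveM_fun d2 d3) (is_deriveM_fun d5 d4))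
    (is_derive_cst (k%:R^-1 : R) x (e j)).
  have d7 := is_deriveD_fun (is_deriveM_fun d1 (is_derive_cst (a i 0 / m) x (e j))) d6.
  have kn0 : k%:R != 0 :> R by rewrite pnatr_eq0 -lt0n.
  apply: (is_derive_congr d7).
  rewrite mxE /zR /cst; move: (dot _ _ + tau) (k%:R *: x + y0) (z j)%:~R => s y Z.
  by field; rewrite m0 kn0.
- move=> j x; split.
    apply: (@lam_periodic _ _ _ _ _ (fun y s => \col_i (phi s * (a i 0 / m) +
      (chi s * vA y i 0 + (1 - chi s) * vB y i 0) * k%:R^-1) : 'cV[R]_3)) => [l y s|y s].
      by case: (pA l y) => -> _; case: (pB l y) => -> _.
    by rewrite pphi pchi.
  by apply: lam_periodic; [move=> *; exact: lam_gradD|exact: lam_grad1].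
Qed.

End Laminate.

Section RankOneConvex.
Context {R : realType}.
Local Notation mu := (@lebesgue_measure R).

(* The quasiconvex envelope of f at A is at most c; the amplitude bound on v is
   what later bounds the maps in L^2. *)
Definition envelope_le (f : 'M[R]_3 -> R) (A : 'M[R]_3) (c : R) : Prop :=
  forall del, 0 < del -> exists v G,
    [/\ C1periodic v G, forall x i, `|v x i 0| <= 1
      & (\int[leb]_(x in cell) (f (A + G x))%:E <= (c + del)%:E)%E].

(** A periodic antiderivative exists only for an integrand of mean zero, so [chi theta N] must be
    centred at its own mean [t N], which equals [theta] only in the limit. *)
Lemma chi_mean (theta : R) : 0 < theta < 1 -> exists t : nat -> R,
  [/\ forall N, 0 <= t N <= 1,
      forall N, (\int[mu]_(s in `[0%R, 1%R[) (chi theta N s - t N)%:E = 0)%E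
    & t N @[N --> \oo] --> theta].
Proof.
move=> t01.
have mchi N : measurable_fun setT (chi theta N).
  by apply: continuous_measurable_fun; exact: continuous_chi.
have mE (D : set R) N : measurable_fun D (fun s => (chi theta N s)%:E).
  by apply/measurable_EFinP; apply: measurable_funTS.
have c01 N s := chi_ge0_le1 theta N s.
have m01 : measurable (`[0%R, 1%R[%classic : set R) by exact: measurable_itv.
have cst1 (c : R) : (\int[mu]_(s in `[0%R, 1%R[) cst c%:E s = c%:E)%E.
  have -> : (\int[mu]_(s in `[0%R, 1%R[) cst c%:E s = c%:E * mu `[0%R, 1%R[)%E by exact: integral_cst.
  by rewrite lebesgue_measure_itv/= lte_fin ltr01 oppr0 adde0 mule1.
have bound N : (0 <= \int[mu]_(s in `[0%R, 1%R[) (chi theta N s)%:E <= 1)%E.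
  apply/andP; split.
    by apply: integral_ge0 => s _; rewrite lee_fin; have /andP[] := c01 N s.
  rewrite -[leRHS](cst1 1); apply: ge0_le_integral => //.
  - by move=> s _; rewrite lee_fin; have /andP[] := c01 N s.
  - exact: mE.
  - by move=> s _; rewrite lee_fin; have /andP[] := c01 N s.
have fin N : (\int[mu]_(s in `[0%R, 1%R[) (chi theta N s)%:E)%E \is a fin_num.
  by have /andP[h1 h2] := bound N; rewrite ge0_fin_numE// (le_lt_trans h2)// ltry.
exists (fun N => fine (\int[mu]_(s in `[0%R, 1%R[) (chi theta N s)%:E)%E); split.
- by move=> N; rewrite -!lee_fin fineK//; exact: bound.
- move=> N; set t := fine _.
  have i1 : mu.-integrable `[0%R, 1%R[ (fun s => (chi theta N s)%:E).
    apply/integrableP; split; first exact: mE.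
    rewrite (_ : (\int[mu]_(x in _) _)%E = (\int[mu]_(s in `[0%R, 1%R[) (chi theta N s)%:E)%E); last first.
      by apply: eq_integral => s _; rewrite gee0_abs// lee_fin; have /andP[] := c01 N s.
    by have /andP[_ h2] := bound N; rewrite (le_lt_trans h2)// ltry.
  have i2 : mu.-integrable `[0%R, 1%R[ (cst t%:E).
    apply/integrableP; split => //.
    rewrite (_ : (\int[mu]_(x in _) _)%E = `|t|%:E); first by rewrite ltry.
    by rewrite -(cst1 `|t|); apply: eq_integral.
  have m01' : measurable (`[0%R, 1%R[%classic : set (measurableTypeR R)) by exact: measurable_itv.
  have := integralB m01' i1 i2; rewrite cst1 /t fineK// subee// => <-.
  by apply: eq_integral => s _; rewrite EFinB fineK.
(* The absolute value makes the integrand nonnegative on the whole space; on the values of [chi] it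
   changes nothing. *)
- have cG : continuous (fun p : pt R * R => `|p.2|).
    by move=> p; apply: cvg_norm; exact: cvg_snd.
  have H := @cvg_chi_integral R theta t01 (fun p => `|p.2|) 1 cG (fun p => normr_ge0 _) _.
  have E N : (\int[leb4 R]_(p in cell4) `|chi theta N p.2|%:E)%E =
      (\int[mu]_(s in `[0%R, 1%R[) (chi theta N s)%:E)%E.
    have mG : measurable_fun setT (fun p : pt (measurableTypeR R) * measurableTypeR R =>
        `|chi theta N p.2|%:E).
      apply/measurable_EFinP; apply: measurableT_comp => //.
      by apply: (measurableT_comp (mchi N)); exact: measurable_snd.
    have T := @tonelli_setX R _ _ _ _ (lebs R) mu _ _ _ (@measurable_cell R) m01 mG.
    apply: (etrans (T _)) => [p|]; first by rewrite lee_fin.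
    rewrite -[RHS]integral_cell_cst lebE; apply: eq_integral => y _ /=.
    by apply: eq_integral => s _; rewrite ger0_norm//; have /andP[] := c01 N s.
  have : (\int[mu]_(s in `[0%R, 1%R[) (chi theta N s)%:E)%E @[N --> \oo] --> theta%:E.
    have -> : theta%:E = (theta%:E * \int[leb]_(y in @cell R) `|1 : R|%:E + (1 - theta)%:E * \int[leb]_(y in @cell R) `|0 : R|%:E)%E.
      have -> : (\int[leb]_(y in @cell R) `|1 : R|%:E = 1)%E.
        by rewrite normr1; exact: integral_cell_cst.
      have -> : (\int[leb]_(y in @cell R) `|0 : R|%:E = 0)%E.
        by rewrite normr0; exact: integral_cell_cst.
      by rewrite mule1 mule0 adde0.
    under eq_fun do rewrite -E; apply: H => y c /=.
    by move=> /andP[c0 c1]; rewrite ger0_norm.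
  by move=> /fine_cvg.
Qed.

End RankOneConvex.

Section RankOneConvexity.
Context {R : realType}.

Lemma exists_natr_ge (x : R) : exists n : nat, x <= n.+1%:R.
Proof.
exists (Num.truncn `|x|); apply: le_trans (ler_norm x) _.
by have /andP[_ /ltW] := truncn_itv (normr_ge0 x).
Qed.

Lemma entries_bounded (M : 'I_3 -> 'I_3 -> R) : exists L, forall i j, `|M i j| <= L.
Proof.
exists (\sum_i \sum_j `|M i j|) => i j.
rewrite (bigD1 i)//= (bigD1 j)//= -addrA lerDl addr_ge0//; first exact: sumr_ge0.
by apply: sumr_ge0 => k _; apply: sumr_ge0.
Qed.

Lemma periodic_mx_bounded (G : pt R -> 'M[R]_3) :
  (forall i j, continuous (fun x => G x i j)) -> (forall j x, G (x + e j) = G x) ->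
  exists L, forall x i j, `|G x i j| <= L.
Proof.
move=> cG pG.
have /choice[L HL] : forall p : 'I_3 * 'I_3, exists L, forall x, `|G x p.1 p.2| <= L.
  by move=> p; apply: periodic_bounded => // j x; rewrite pG.
have [M HM] := entries_bounded (fun i j => L (i, j)).
by exists M => x i j; apply: le_trans (HL (i, j) x) (le_trans (ler_norm _) (HM i j)).
Qed.

Lemma periodic_bounded1 (g : R -> R) : continuous g -> (forall s, g (s + 1) = g s) ->
  exists2 L, 0 <= L & forall s, `|g s| <= L.
Proof.
move=> cg pg.
have c : continuous (fun x : pt R => g x.2).
  by move=> x; apply: (@continuous_comp _ _ _ snd g); [exact: cvg_snd|exact: cg].
have p (j : 'I_3) (x : pt R) : g (x + e j).2 = g x.2.
  by case: (I3P j) => -> /=; rewrite ?addr0.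
have [L HL] := periodic_bounded c p.
by exists L => [|s]; [exact: le_trans (normr_ge0 _) (HL 0)|exact: (HL (0, s))].
Qed.

Lemma norm_sub01 (x y : R) : 0 <= x <= 1 -> 0 <= y <= 1 -> `|x - y| <= 1.
Proof. by move=> /andP[? ?] /andP[? ?]; rewrite ler_norml; apply/andP; split; lra. Qed.

Lemma half_bound (x y z : R) : 0 < z -> 2 * x * y <= z -> x * (y / z) <= 2^-1.
Proof. by move=> z0 h; rewrite mulrA ler_pdivrMr//; lra. Qed.

Lemma half_quarter_le (x : R) : 0 <= x -> x / 2 + x / 4 <= x.
Proof. lra. Qed.

(** The parameters are chosen in the order N (profile), M (integer direction and coarse amplitude),
    k (frequency of the phases): the bound on [dchi] depends on N and the size of [z] on M, and k
    has to beat both. *)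
Lemma envelope_le_rank1 (f : 'M[R]_3 -> R) (A B : 'M[R]_3) (a n : 'cV[R]_3) (theta c d : R) :
  (forall M, 0 <= f M) -> uniform_on_bounded f ->
  (forall L, exists C, forall M : 'M[R]_3, (forall i j, `|M i j| <= L) -> f M <= C) ->
  0 < theta < 1 -> A - B = a *m n^T ->
  envelope_le f A c -> envelope_le f B d ->
  envelope_le f (theta *: A + (1 - theta) *: B) (theta * c + (1 - theta) * d).
Proof.
move=> f0 uf bf t01 AB HA HB del del0; have /andP[t0 t1] := t01.
have del4 : 0 < del / 4 by rewrite divr_gt0.
have [vA [GA [C1A vA1 IA]]] := HA _ del4; have [vB [GB [C1B vB1 IB]]] := HB _ del4.
case: (C1A) => cA cGA dA pA; case: (C1B) => cB cGB dB pB.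
have shift_bounded (M : 'M[R]_3) (G : pt R -> 'M[R]_3) :
    (forall i j, continuous (fun x => G x i j)) -> (forall j x, G (x + e j) = G x) ->
    exists L, forall x i j, `|(M + G x) i j| <= L.
  move=> cG pG; apply: (periodic_mx_bounded (G := fun x => M + G x)) => [i j x|j x]; last by rewrite pG.
  rewrite (_ : (fun x => _) = fun x => M i j + G x i j); last by apply/funext => y; rewrite mxE.
  by apply: cvgD; [exact: cvg_cst|exact: cG].
have [LA HLA] := shift_bounded A GA cGA (fun j x => (pA j x).2).
have [LB HLB] := shift_bounded B GB cGB (fun j x => (pB j x).2).
pose L := Num.max LA LB.
(* The ideal gradient; the actual one is shown to be entrywise close to [mix (chi theta N s) y]. *)
pose mix (x : R) (y : pt R) := x *: (A + GA y) + (1 - x) *: (B + GB y).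
have mixL x y i j : 0 <= x <= 1 -> `|mix x y i j| <= L.
  move=> /andP[x0 x1]; rewrite /mix mxE [X in X + _]mxE [X in _ + X]mxE.
  rewrite (le_trans (ler_normD _ _))// !normrM (ger0_norm x0) (@ger0_norm _ (1 - x)) ?subr_ge0//.
  rewrite [leRHS](_ : L = x * L + (1 - x) * L); last by ring.
  by apply: lerD; apply: ler_wpM2l; rewrite ?subr_ge0// /L le_max ?HLA ?HLB ?orbT.
have [Cf HCf] := bf L.
have cst_c (X : topologicalType) (r : R) : continuous (fun _ : X => r) by move=> x; exact: cvg_cst.
have c1 (g : pt R -> R) : continuous g -> continuous (fun p : pt R * R => g p.1).
  by move=> cg p; apply: (@continuous_comp _ _ _ fst g); [exact: cvg_fst|exact: cg].
have c2 (g : R -> R) : continuous g -> continuous (fun p : pt R * R => g p.2).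
  by move=> cg p; apply: (@continuous_comp _ _ _ snd g); [exact: cvg_snd|exact: cg].
have cmix (g : R -> R) : continuous g -> continuous (fun p : pt R * R => f (mix (g p.2) p.1)).
  move=> cg; apply: uniform_on_bounded_continuous => // i j.
  rewrite (_ : (fun p => _) = fun p : pt R * R => g p.2 * (A i j + GA p.1 i j) + (1 - g p.2) * (B i j + GB p.1 i j)); last first.
    by apply/funext => p; rewrite !mxE.
  move=> p; apply: cvgD; apply: cvgM.
  - exact: (c2 g).
  - by apply: cvgD; [exact: cvg_cst|exact: (c1 (fun y => GA y i j))].
  - by apply: cvgB; [exact: cvg_cst|exact: (c2 g)].
  - by apply: cvgD; [exact: cvg_cst|exact: (c1 (fun y => GB y i j))].
have cvgF := @cvg_chi_integral R theta t01 (fun p => f (mix p.2 p.1)) Cf (cmix id (fun x => cvg_id))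
  (fun p => f0 _) (fun y x x01 => HCf _ (fun i j => mixL x y i j x01)).
have limF : (theta%:E * \int[leb]_(y in cell) (f (mix 1 y))%:E +
    (1 - theta)%:E * \int[leb]_(y in cell) (f (mix 0 y))%:E <
    (theta * c + (1 - theta) * d + del / 2)%:E)%E.
  have E1 y : mix 1 y = A + GA y by rewrite /mix subrr scale0r scale1r addr0.
  have E0 y : mix 0 y = B + GB y by rewrite /mix subr0 scale0r scale1r add0r.
  under eq_integral do rewrite E1; under [X in (_ + _ * X)%E]eq_integral do rewrite E0.
  apply: (@le_lt_trans _ _ (theta%:E * (c + del / 4)%:E + (1 - theta)%:E * (d + del / 4)%:E)%E).
    by apply: leeD; apply: lee_wpmul2l => //; rewrite lee_fin ?subr_ge0 ltW.
  by rewrite -!EFinM -EFinD lte_fin; lra.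
have [t [t_01 t_int t_cvg]] := chi_mean t01.
have [del' del'0 Huf] := uf (L + 1) _ del4.
(* The cap at 1 keeps perturbed entries within [L + 1], the bound for which [del'] was obtained. *)
pose eps := Num.min del' 1.
have eps0 : 0 < eps by rewrite lt_min del'0 ltr01.
have [La HLa] := entries_bounded (fun i j => a i 0 * n j 0).
have [Lb HLb] := entries_bounded (fun i _ => a i 0).
have La0 : 0 <= La := le_trans (normr_ge0 _) (HLa 0 0).
have Lb0 : 0 <= Lb := le_trans (normr_ge0 _) (HLb 0 0).
have eps3 : 0 < eps / 3 / (La + 1) by rewrite !divr_gt0// ltr_pwDr.
have [N [HN1 HN2]] : exists N,
    (\int[leb4 R]_(p in cell4) (f (mix (chi theta N p.2) p.1))%:E <
      (theta * c + (1 - theta) * d + del / 2)%:E)%E /\ `|theta - t N| <= eps / 3 / (La + 1).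
  have n1 : \forall N \near \oo, (\int[leb4 R]_(p in cell4) (f (mix (chi theta N p.2) p.1))%:E <
      (theta * c + (1 - theta) * d + del / 2)%:E)%E.
    exact: (cvgF _ (open_ereal_lt_ereal limF)).
  have n2 : \forall N \near \oo, `|theta - t N| <= eps / 3 / (La + 1).
    by have /cvgrPdist_le/(_ _ eps3) := t_cvg.
  by have [N []] := filter_ex (filterI n1 n2); exists N.
have cchi : continuous (chi theta N) by exact: continuous_chi.
have chi01 s := chi_ge0_le1 theta N s.
have [Ld Ld0 HLd] := periodic_bounded1 (@continuous_dchi R theta N) (dchi_periodic theta N).
have [phi [dphi pphi]] : exists G : R -> R,
    (forall x : R, is_derive x 1 G (chi theta N x - t N)) /\ forall x, G (x + 1) = G x.
  apply: (@periodic_antiderivative R (fun s => chi theta N s - t N)) => //.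
  - by move=> s; apply: cvgB; [exact: cchi|exact: cvg_cst].
  - by move=> s; rewrite chi_periodic.
have [Lp Lp0 HLp] := periodic_bounded1 (fun s => is_derive_continuous (dphi s)) pphi.
(* The first bound controls the error of replacing [n] by [z / M.+1], the second makes the coarse
   part of the map at most 1/2 in sup norm. *)
have [M HM] := exists_natr_ge (Num.max (Lb * 3 / eps) (2 * Lp * Lb)).
have M0 : 0 < M.+1%:R :> R by [].
have MLb : Lb / M.+1%:R <= eps / 3.
  rewrite ler_pdivrMr// mulrC -ler_pdivrMr ?divr_gt0// invf_div mulrA.
  by apply: le_trans HM; rewrite le_max lexx.
have MLp : Lp * (Lb / M.+1%:R) <= 2^-1.
  have h : 2 * Lp * Lb <= M.+1%:R by apply: le_trans HM; rewrite le_max lexx orbT.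
  exact: half_bound.
pose z (j : 'I_3) := Num.floor (M.+1%:R * n j 0).
have zn j : `|(z j)%:~R / M.+1%:R - n j 0| <= M.+1%:R^-1.
  have /andP[h1 h2] := floor_itv (M.+1%:R * n j 0).
  rewrite distrC ger0_norm ?subr_ge0 ?ler_pdivrMr// ?[n j 0 * _]mulrC//.
  rewrite lerBlDr -[X in X + _]div1r -mulrDl ler_pdivlMr// [n j 0 * _]mulrC.
  by rewrite addrC (le_trans (ltW h2))// intrD.
have [Lz HLz] := entries_bounded (fun j _ => (z j)%:~R : R).
have Lz0 : 0 <= Lz := le_trans (normr_ge0 _) (HLz 0 0).
(* The first bound controls the term with [dchi], where the entries of vA - vB are at most 2; the
   second makes the fine part of the map at most 1/2, so that the sup bound 1 is reproduced. *)
have [k HK] := exists_natr_ge (Num.max (2 * Ld * Lz * 3 / eps) 2).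
have k0 : 0 < k.+1%:R :> R by [].
have kLz : Ld * 2 * (Lz / k.+1%:R) <= eps / 3.
  rewrite mulrA ler_pdivrMr// [eps / 3 * _]mulrC -ler_pdivrMr ?divr_gt0// invf_div.
  by apply: le_trans HK; rewrite le_max [Ld * 2]mulrC mulrA lexx.
have k2 : k.+1%:R^-1 <= 2^-1 :> R.
  by rewrite lef_pV2 ?posrE//; apply: le_trans HK; rewrite le_max lexx orbT.
have mM : M.+1%:R != 0 :> R by rewrite pnatr_eq0.
have cdphi : continuous (fun s => chi theta N s - t N).
  by move=> s; apply: cvgB; [exact: cchi|exact: cvg_cst].
have pdphi s : chi theta N (s + 1) - t N = chi theta N s - t N by rewrite chi_periodic.
have C1v (p : pt R * R) := @C1periodic_laminate R vA vB GA GB phi (fun s => chi theta N s - t N)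
  (chi theta N) (dchi theta N) a z M.+1%:R k.+1 C1A C1B (ltn0Sn k) mM dphi cdphi pphi pdphi
  (is_derive_chi theta N) (@continuous_dchi R theta N) (chi_periodic theta N) (dchi_periodic theta N) p.1 p.2.
pose P := theta *: A + (1 - theta) *: B.
pose LG := lam_grad vA vB GA GB (fun s => chi theta N s - t N) (chi theta N) (dchi theta N) a z M.+1%:R k.+1.
have close y s i j : `|(P + LG y s) i j - mix (chi theta N s) y i j| <= eps.
  have ABij : A i j - B i j = a i 0 * n j 0.
    by have := congr1 (fun X : 'M[R]_3 => X i j) AB; rewrite !mxE big_ord1 !mxE.
  (* Since A - B = a n^T, what remains are the errors in the mean of the profile, in the direction,
     and from differentiating the profile; each is at most eps / 3. *)
  have -> : (P + LG y s) i j - mix (chi theta N s) y i j =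
      (theta - t N) * (a i 0 * n j 0) +
      (chi theta N s - t N) * (a i 0 * ((z j)%:~R / M.+1%:R - n j 0)) +
      dchi theta N s * (vA y i 0 - vB y i 0) * ((z j)%:~R / k.+1%:R).
    rewrite /P /LG /mix !mxE.
    move: (chi theta N s) (dchi theta N s) ABij ((z j)%:~R / M.+1%:R) ((z j)%:~R / k.+1%:R) => x w ABij q r.
    have -> : B i j = A i j - a i 0 * n j 0 by rewrite -ABij; ring.
    by ring.
  have -> : eps = eps / 3 + eps / 3 + eps / 3 by field.
  apply: (le_trans (ler_normD _ _)); apply: lerD; first apply: (le_trans (ler_normD _ _)); first apply: lerD.
  - rewrite normrM; apply: (@le_trans _ _ (eps / 3 / (La + 1) * (La + 1))).
      by apply: ler_pM => //; rewrite (le_trans (HLa i j))// lerDl.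
    by rewrite divfK// gt_eqF// ltr_pwDr.
  - apply: le_trans MLb; rewrite !normrM.
    rewrite -[leRHS]mul1r; apply: ler_pM; rewrite ?mulr_ge0 ?normr_ge0 ?norm_sub01//.
    by apply: ler_pM => //; exact: (HLb i 0).
  - apply: le_trans kLz; rewrite normrM [X in X * _ <= _]normrM.
    apply: ler_pM; rewrite ?mulr_ge0 ?normr_ge0//.
      apply: ler_pM => //; apply: (le_trans (ler_normB _ _)).
      by apply: lerD; [exact: vA1|exact: vB1].
    rewrite normrM normfV (ger0_norm (ltW k0)) ler_wpM2r ?invr_ge0//; exact: (HLz j 0).
have mixb y s i j : `|mix (chi theta N s) y i j| <= L + 1.
  by apply: le_trans (mixL _ y i j (chi01 s)) _; rewrite lerDl.
have eps1 : eps <= 1 by rewrite ge_min lexx orbT.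
have fclose y s : f (P + LG y s) <= f (mix (chi theta N s) y) + del / 4.
  rewrite -lerBlDl; apply: le_trans (ler_norm _) _; apply: Huf.
  - move=> i j; rewrite -(subrK (mix (chi theta N s) y i j) ((P + LG y s) i j)) addrC.
    rewrite (le_trans (ler_normD _ _))//; apply: lerD; first exact: mixL.
    exact: le_trans (close y s i j) eps1.
  - by move=> i j; exact: mixb.
  - by move=> i j; apply: le_trans (close y s i j) _; rewrite ge_min lexx.
pose H (p : pt R * R) := f (P + LG p.1 p.2).
have cH : continuous H.
  apply: uniform_on_bounded_continuous => // i j.
  rewrite (_ : (fun p => _) = fun p : pt R * R => P i j + LG p.1 p.2 i j); last by apply/funext => p; rewrite mxE.
  move=> p; apply: cvgD; first exact: cvg_cst.
  exact: (@lam_grad_continuous R vA vB GA GB (fun s => chi theta N s - t N) (chi theta N) (dchi theta N)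
    a z M.+1%:R k.+1 C1A C1B cdphi (is_derive_chi theta N) (@continuous_dchi R theta N) i j p).
have H1 (j : 'I_3) (x : pt R) (s : R) : H (x + e j, s) = H (x, s).
  by rewrite /H /= /LG (lam_gradD _ _ _ _ _ _ _ C1A C1B).
have H2 (x : pt R) (s : R) : H (x, s + 1) = H (x, s).
  by rewrite /H /= /LG (lam_grad1 _ _ _ _ _ _ _ _ pdphi (chi_periodic theta N) (dchi_periodic theta N)).
have HI : (\int[leb4 R]_(p in cell4) (H p)%:E < (theta * c + (1 - theta) * d + del)%:E)%E.
  have mc4 := @measurable_cell4 R.
  have mF : measurable_fun cell4 (fun p : pt (measurableTypeR R) * measurableTypeR R =>
      (f (mix (chi theta N p.2) p.1))%:E).
    by apply/measurable_EFinP; apply: measurable_funTS; apply: continuous_measurable4; exact: cmix.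
  apply: (@le_lt_trans _ _ (\int[leb4 R]_(p in cell4) ((f (mix (chi theta N p.2) p.1))%:E + (del / 4)%:E))%E).
    apply: ge0_le_integral => //.
    - by move=> p _; rewrite lee_fin f0.
    - by apply/measurable_EFinP; apply: measurable_funTS; exact: continuous_measurable4.
    - exact: emeasurable_funD.
    - by move=> p _; rewrite -EFinD lee_fin; exact: fclose.
  rewrite ge0_integralD//; last 2 first.
  - by move=> p _; rewrite lee_fin f0.
  - by move=> p _; rewrite lee_fin ltW.
  have -> : (\int[leb4 R]_(p in cell4) (del / 4)%:E = (del / 4)%:E)%E by exact: integral_cell4_cst.
  apply: (@lt_le_trans _ _ ((theta * c + (1 - theta) * d + del / 2)%:E + (del / 4)%:E)%E).
    by rewrite lteD2rE.
  by rewrite -EFinD lee_fin -addrA lerD2l half_quarter_le// ltW.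
have [p Hp] := exists_translation k.+1%:R (zR z) cH (fun p => f0 _) H1 H2 HI.
exists (lam_fun vA vB phi (chi theta N) a z M.+1%:R k.+1 p.1 p.2).
exists (fun x => LG (k.+1%:R *: x + p.1) (dot (zR z) x + p.2)); split.
- exact: C1v.
- move=> x i; rewrite /lam_fun mxE.
  move: (k.+1%:R *: x + p.1) (dot (zR z) x + p.2) => y s.
  apply: le_trans (ler_normD _ _) _; rewrite [leRHS](_ : 1 = 2^-1 + 2^-1 :> R); last by field.
  apply: lerD.
    apply: le_trans MLp; rewrite normrM; apply: ler_pM => //.
    by rewrite normrM normfV (ger0_norm (ltW M0)) ler_wpM2r ?invr_ge0//; exact: (HLb i 0).
  have /andP[x0 x1] := chi01 s.
  rewrite normrM normfV (ger0_norm (ltW k0)) -[leRHS]mul1r; apply: ler_pM => //; rewrite ?invr_ge0//.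
  apply: le_trans (ler_normD _ _) _; rewrite !normrM (ger0_norm x0) (@ger0_norm _ (1 - _)) ?subr_ge0//.
  rewrite [leRHS](_ : 1 = chi theta N s * 1 + (1 - chi theta N s) * 1); last by ring.
  by apply: lerD; apply: ler_wpM2l; rewrite ?subr_ge0// ?vA1 ?vB1.
- exact: ltW.
Qed.

End RankOneConvexity.

(** * Periodic C^1 maps as Sobolev maps *)

Section IntegrationByParts.
Context {R : realType}.
Local Notation mu := (@lebesgue_measure R).
Local Notation mu2 := (sf_prod mu mu).
Local Open Scope ereal_scope.

Lemma bounded_support_integrable d (T : measurableType d) (m : {measure set T -> \bar R})
    (D : set T) (f : T -> R) (C : R) :
  measurable D -> m D < +oo -> measurable_fun setT f -> (forall x, `|f x| <= C)%R ->
  (forall x, ~ D x -> f x = 0%R) -> m.-integrable setT (EFin \o f).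
Proof.
move=> mD Dfin mf fC f0; apply/integrableP; split; first exact/measurable_EFinP.
have C0 : (0 <= `|C|)%R by [].
apply: (@le_lt_trans _ _ (\int[m]_(x in D) cst `|C|%:E x)); last first.
  by rewrite integral_cst// lte_mul_pinfty// lee_fin.
rewrite [leRHS]integral_mkcond; apply: ge0_le_integral => //.
- by apply/measurable_EFinP; apply: measurableT_comp.
- by apply/(measurable_restrictT _ _).1.
- move=> x _; rewrite /patch; case: ifPn => [_|].
    by rewrite lee_fin (le_trans (fC x))// ler_norm.
  by rewrite notin_setE => /f0 /= ->; rewrite normr0.
Qed.

Lemma measurable_cube (r : R) : measurable (cube r).
Proof. by apply: measurableX => //; exact: measurableX. Qed.

Lemma itv_lty (r : R) : mu `[(- r)%R, r] < +oo.
Proof. by rewrite lebesgue_measure_itv; case: ifP => _ /=; rewrite ?ltry. Qed.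

Lemma square_lty (r : R) : mu2 (`[(- r)%R, r] `*` `[(- r)%R, r]) < +oo.
Proof.
have -> : mu2 (`[(- r)%R, r] `*` `[(- r)%R, r]) = mu `[(- r)%R, r] * mu `[(- r)%R, r].
  exact: product_measure1E.
by apply: lte_mul_pinfty; rewrite ?itv_lty// ge0_fin_numE ?itv_lty.
Qed.

Lemma cube_lty (r : R) : leb (cube r) < +oo.
Proof.
have -> : leb (cube r) = mu2 (`[(- r)%R, r] `*` `[(- r)%R, r]) * mu `[(- r)%R, r].
  by apply: product_measure1E => //; exact: measurableX.
by apply: lte_mul_pinfty; rewrite ?itv_lty// ge0_fin_numE ?square_lty.
Qed.

Lemma compact_cube (r : R) : compact (cube r : set (pt R)).
Proof. by apply: compact_setX; [apply: compact_setX|]; exact: segment_compact. Qed.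

Lemma bounded_on_cube (f : pt R -> R) (r : R) : continuous f ->
  exists2 C, (0 <= C)%R & forall x, cube r x -> (`|f x| <= C)%R.
Proof.
move=> cf; have [M [_ HM]] := compact_bounded (continuous_compact (continuous_subspaceT cf) (@compact_cube r)).
exists (`|M| + 1)%R => [|x cx]; first exact: addr_ge0.
apply: (HM (`|M| + 1)%R); first by rewrite (le_lt_trans (ler_norm M))// ltrDl.
by exists x.
Qed.

Lemma integral_derivative0 (h h' : R -> R) (r : R) :
  (forall x : R, is_derive x 1%R h (h' x)) -> continuous h' ->
  (forall x, (r < `|x|)%R -> h x = 0%R) -> (forall x, (r < `|x|)%R -> h' x = 0%R) ->
  \int[mu]_x (h' x)%:E = 0.
Proof.
(* Beyond |r|, so that [h] vanishes at both endpoints of the interval of integration. *)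
move=> dh ch' h0 h'0; pose b := (`|r| + 1)%R.
have rb : (r < b)%R by rewrite (le_lt_trans (ler_norm r))// ltrDl.
have b0 : (0 < b)%R by rewrite ltr_wpDl.
have ch : continuous h by move=> x; exact: is_derive_continuous (dh x).
transitivity (\int[mu]_(x in `[(- b)%R, b]) (h' x)%:E).
  rewrite [RHS]integral_mkcond; apply: eq_integral => x _; rewrite /patch.
  case: ifPn => // /negP xb; rewrite h'0//.
  rewrite (lt_le_trans rb)// leNgt; apply/negP => xb'; apply: xb.
  by rewrite inE/= in_itv/= -ler_norml ltW.
rewrite (@continuous_FTC2 R h' h).
- by rewrite !h0 ?normrN ?gtr0_norm// subee.
- by rewrite (lt_trans _ b0)// oppr_lt0.
- exact: continuous_subspaceT.
- split; first by move=> y _; have [] := dh y.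
    exact/cvg_at_right_filter/ch.
  exact/cvg_at_left_filter/ch.
- by move=> y _; rewrite derive1E; have [_ ->] := dh y.
Qed.

(* Slice along e j and apply the fundamental theorem of calculus on each line. *)
Lemma integral_partial0 (w g : pt R -> R) (j : 'I_3) (r : R) :
  (forall x, is_derive x (e j) w (g x)) -> continuous g ->
  (forall x, ~ cube r x -> w x = 0%R) -> (forall x, ~ cube r x -> g x = 0%R) ->
  \int[leb]_x (g x)%:E = 0.
Proof.
move=> dw cg w0 g0.
have mg := continuous_measurable3 cg.
have [C C0 HC] := bounded_on_cube r cg.
have gC x : (`|g x| <= C)%R.
  by have [/HC//|/g0 ->] := pselect (cube r x); rewrite normr0.
have ig : (lebs R).-integrable setT (EFin \o g).
  exact: (@bounded_support_integrable _ _ (lebs R) (cube r) g C (measurable_cube r) (cube_lty r) mg gC g0).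
have out (x y z t : R) : (r < `|t|)%R ->
    [/\ ~ cube r (t, y, z), ~ cube r (x, t, z) & ~ cube r (x, y, t)].
  move=> rt; have no : ~ (t \in `[(- r)%R, r]).
    by rewrite in_itv/= -ler_norml => /(lt_le_trans rt); rewrite ltxx.
  by split => -[[]] /=.
have lineT (x : pt R) (s : R) : is_derive s 1%R (fun t : R => w (x + t *: e j)%R) (g (x + s *: e j)%R).
  apply/is_derive_lineP => /=.
  rewrite (_ : (fun t => _) = (fun t : R => w (x + s *: e j + t *: e j)%R)).
    by have /is_derive_lineP := dw (x + s *: e j)%R.
  by apply/funext => t; rewrite (_ : t%:A = t) ?scalerDl ?addrA//; exact: mulr1.
have cgl (x : pt R) : continuous (fun t : R => g (x + t *: e j)%R).
  move=> t; apply: continuous_comp; last exact: cg.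
  by apply: cvgD; [exact: cvg_cst|apply: cvgZl; exact: cvg_id].
have zero (x : pt R) (h : R -> pt R) : (forall t, (x + t *: e j)%R = h t) ->
    (forall t, (r < `|t|)%R -> ~ cube r (h t)) -> \int[mu]_t (g (h t))%:E = 0.
  move=> hE hout; under eq_integral do rewrite -hE.
  apply: (@integral_derivative0 (fun t => w (x + t *: e j)%R) _ r) => //.
    by move=> t rt; rewrite hE w0//; exact: hout.
  by move=> t rt; rewrite hE g0//; exact: hout.
have c2 (z : R) : continuous (fun q : R * R => g (q, z)).
  by move=> q; apply: continuous_comp; [exact: cvg_pair cvg_id (cvg_cst _)|exact: cg].
have i2 (z : R) : mu2.-integrable setT (fun q => (g (q, z))%:E).
  apply: (@bounded_support_integrable _ _ mu2 (`[(- r)%R, r] `*` `[(- r)%R, r]) (fun q => g (q, z)) C) => //.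
  - exact: measurableX.
  - exact: square_lty.
  - exact: continuous_measurable2.
  - by move=> q no; apply: g0 => -[].
rewrite lebE; case: (I3P j) => jE; subst j.
- rewrite -(@integral21_prod_meas1 _ _ _ _ R mu2 mu _ ig).
  apply: integral0_eq => z _; rewrite /fubini_G /=.
  rewrite -(@integral21_prod_meas1 _ _ _ _ R mu mu _ (i2 z)).
  apply: integral0_eq => y _; rewrite /fubini_G /=.
  apply: (zero (0, y, z)%R (fun t => (t, y, z))).
    by move=> t; congr (_, _, _); rewrite /= ?scaler0 ?addr0 ?add0r //; exact: mulr1.
  by move=> t rt; have [] := out 0%R y z t rt.
- rewrite -(@integral21_prod_meas1 _ _ _ _ R mu2 mu _ ig).
  apply: integral0_eq => z _; rewrite /fubini_G /=.
  rewrite -(@integral12_prod_meas1 _ _ _ _ R mu mu _ (i2 z)).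
  apply: integral0_eq => x _; rewrite /fubini_F /=.
  apply: (zero (x, 0, z)%R (fun t => (x, t, z))).
    by move=> t; congr (_, _, _); rewrite /= ?scaler0 ?addr0 ?add0r //; exact: mulr1.
  by move=> t rt; have [] := out x 0%R z t rt.
- rewrite -(@integral12_prod_meas1 _ _ _ _ R mu2 mu _ ig).
  apply: integral0_eq => -[x y] _; rewrite /fubini_F /=.
  apply: (zero (x, y, 0)%R (fun t => (x, y, t))).
    by move=> t; congr (_, _, _); rewrite /= ?scaler0 ?addr0 ?add0r //; exact: mulr1.
  by move=> t rt; have [] := out x y 0%R t rt.
Qed.
End IntegrationByParts.

Section WeakGradient.
Context {R : realType}.
Local Open Scope ereal_scope.

Definition C1map (u : pt R -> 'cV[R]_3) (G : pt R -> 'M[R]_3) : Prop :=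
  [/\ forall i, continuous (fun x => u x i 0%R),
      forall i j, continuous (fun x => G x i j)
    & forall i j x, is_derive x (e j) (fun x => u x i 0%R) (G x i j)].

Lemma continuous_L2loc (f : pt R -> R) : continuous f -> L2loc f.
Proof.
move=> cf; have mf := continuous_measurable3 cf; split => // r.
have [C C0 HC] := bounded_on_cube r cf.
apply: (@le_lt_trans _ _ (\int[leb]_(x in cube r) cst (C ^+ 2)%:E x)).
  apply: (@ge0_le_integral _ _ _ (lebs R)); first exact: measurable_cube.
  - by move=> x _; rewrite lee_fin sqr_ge0.
  - by apply/measurable_EFinP; apply: measurable_funTS; exact: measurable_funX.
  - by [].
  - move=> x cx; rewrite lee_fin -[leLHS]real_normK ?num_real//.
    by apply: lerXn2r; rewrite ?nnegrE// HC.
rewrite [X in X < _](_ : _ = (C ^+ 2)%:E * lebs R (cube r)); last first.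
  by apply: (@integral_cst _ _ _ (lebs R)); exact: measurable_cube.
by apply: lte_mul_pinfty; rewrite ?lee_fin ?sqr_ge0//; exact: cube_lty.
Qed.

(** A point outside the closed support has a neighbourhood where [phi] vanishes, so the derivatives
    vanish there too. *)
Lemma test_function_support (phi : pt R -> R) : test_function phi ->
  exists r, forall j x, ~ cube r x -> phi x = 0%R /\ 'D_(e j) phi x = 0%R.
Proof.
move=> [_ cK]; have [M [_ HM]] := compact_bounded cK.
exists (`|M| + 1)%R => j x nx.
have nK : ~ closure [set x | phi x != 0%R] x.
  move=> Kx; apply: nx; have := HM (`|M| + 1)%R _ x Kx.
  rewrite (le_lt_trans (ler_norm M)) ?ltrDl// => /(_ isT).
  case: x {Kx} => -[x y] z; rewrite /= !prod_normE/= !ge_max => /andP[/andP[hx hy] hz].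
  by split => /=; [split|]; rewrite /= in_itv/= -ler_norml.
have near0 : \forall y \near x, phi y = (cst 0%R : pt R -> R) y.
  have oK : open (~` closure [set x | phi x != 0%R]) by apply: closed_openC; exact: closed_closure.
  apply: filterS (open_nbhs_nbhs (conj oK nK)) => y ny.
  by apply/eqP; apply: contrapT => /negP py; apply: ny; exact: subset_closure.
split; first exact: (nbhs_singleton near0).
by rewrite (near_eq_derive _ near0) derive_cst.
Qed.

(** The partial derivative of the compactly supported product of [phi] with a component of [u]
    integrates to zero, and the product rule splits it. *)
Lemma C1map_W12loc (u : pt R -> 'cV[R]_3) (G : pt R -> 'M[R]_3) : C1map u G -> W12loc_grad u G.
Proof.
move=> [cu cG dG]; split => [i|i j|i j phi tphi].
- exact: continuous_L2loc.
- exact: continuous_L2loc.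
have [r Hr] := test_function_support tphi.
case: (tphi) => Cphi _; have [cphi /(_ j) [dphi cDphi]] := Cphi 1%N.
have cD : continuous ('D_(e j) phi) by case: cDphi.
have bsi (f : pt R -> R) : continuous f -> (forall x, ~ cube r x -> f x = 0%R) ->
    (lebs R).-integrable setT (EFin \o f).
  move=> cf f0; have [C C0 HC] := bounded_on_cube r cf.
  apply: (@bounded_support_integrable _ _ _ (lebs R) (cube r) f C (measurable_cube r) (cube_lty r)) => //.
    exact: continuous_measurable3.
  by move=> x; have [/HC//|/f0 ->] := pselect (cube r x); rewrite normr0.
have c1 : continuous (fun x => u x i 0%R * 'D_(e j) phi x)%R.
  by move=> x; apply: cvgM; [exact: cu|exact: cD].
have c2 : continuous (fun x => G x i j * phi x)%R.
  by move=> x; apply: cvgM; [exact: cG|exact: cphi].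
have i1 : (lebs R).-integrable setT (EFin \o (fun x => u x i 0%R * 'D_(e j) phi x)%R).
  by apply: bsi => // x nx; rewrite (Hr j x nx).2 mulr0.
have i2 : (lebs R).-integrable setT (EFin \o (fun x => G x i j * phi x)%R).
  by apply: bsi => // x nx; rewrite (Hr j x nx).1 mulr0.
have dw x : is_derive x (e j) (fun x => u x i 0%R * phi x)%R (u x i 0%R * 'D_(e j) phi x + phi x * G x i j)%R.
  exact: (is_deriveM_fun (dG i j x) (DeriveDef (dphi x) erefl)).
have I0 := @integral_partial0 R (fun x => u x i 0%R * phi x)%R
  (fun x => u x i 0%R * 'D_(e j) phi x + phi x * G x i j)%R j r dw.
have {I0}: \int[leb]_x (u x i 0%R * 'D_(e j) phi x)%:E + \int[leb]_x (G x i j * phi x)%:E = 0.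
  rewrite lebE -(integralD _ i1 i2)//=; apply: etrans (I0 _ _ _).
  - by apply: eq_integral => x _; rewrite -EFinD [(phi x * _)%R]mulrC.
  - move=> x; apply: cvgD; first exact: c1.
    by apply: cvgM; [exact: cphi|exact: cG].
  - by move=> x nx; rewrite (Hr j x nx).1 mulr0.
  - by move=> x nx; rewrite (Hr j x nx).1 (Hr j x nx).2 mulr0 mul0r addr0.
have := integrable_fin_num measurableT i1; have := integrable_fin_num measurableT i2; rewrite lebE /=.
move: (integral _ _ _) (integral _ _ _) => [a| |] [b| |]//= _ _.
by rewrite -EFinD => -[] /eqP; rewrite addr_eq0 => /eqP ->.
Qed.
End WeakGradient.

(** * Energies and approximating sequences *)

Section Norm2.
Context {R : realType}.

Lemma sum_sqr_ge0 m k (M : 'M[R]_(m, k)) : 0 <= \sum_i \sum_j M i j ^+ 2.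
Proof. by apply: sumr_ge0 => i _; apply: sumr_ge0 => j _; exact: sqr_ge0. Qed.

Lemma norm2_ge0 m k (M : 'M[R]_(m, k)) : 0 <= norm2 M.
Proof. exact: sqrtr_ge0. Qed.

Lemma norm2_sqr m k (M : 'M[R]_(m, k)) : norm2 M ^+ 2 = \sum_i \sum_j M i j ^+ 2.
Proof. by rewrite sqr_sqrtr// sum_sqr_ge0. Qed.

Lemma norm2_entry m k (M : 'M[R]_(m, k)) i j : `|M i j| <= norm2 M.
Proof.
rewrite -sqrtr_sqr ler_sqrt ?sum_sqr_ge0// (bigD1 i)//= (bigD1 j)//= -addrA lerDl addr_ge0//.
  by apply: sumr_ge0 => l _; exact: sqr_ge0.
by apply: sumr_ge0 => l _; apply: sumr_ge0 => l' _; exact: sqr_ge0.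
Qed.

Lemma norm2_eq0 m k (M : 'M[R]_(m, k)) : norm2 M = 0 -> M = 0.
Proof.
move=> M0; apply/matrixP => i j; rewrite mxE; apply/eqP.
by rewrite -normr_le0 -M0 norm2_entry.
Qed.

Lemma norm2_0 m k : norm2 (0 : 'M[R]_(m, k)) = 0.
Proof.
by rewrite /norm2 big1 ?sqrtr0// => i _; rewrite big1// => j _; rewrite mxE expr0n.
Qed.

Lemma norm2N m k (M : 'M[R]_(m, k)) : norm2 (- M) = norm2 M.
Proof.
by congr Num.sqrt; apply: eq_bigr => i _; apply: eq_bigr => j _; rewrite mxE sqrrN.
Qed.

Lemma norm2Z m k (c : R) (M : 'M[R]_(m, k)) : norm2 (c *: M) = `|c| * norm2 M.
Proof.
rewrite /norm2 -sqrtr_sqr -sqrtrM ?sqr_ge0//; congr Num.sqrt.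
by rewrite mulr_sumr; apply: eq_bigr => i _; rewrite mulr_sumr; apply: eq_bigr => j _; rewrite mxE exprMn.
Qed.

Lemma norm2D m k (M N : 'M[R]_(m, k)) : norm2 (M + N) <= norm2 M + norm2 N.
Proof.
pose p := norm2 M; pose q := norm2 N; pose s := \sum_i \sum_j M i j * N i j.
have p0 : 0 <= p := norm2_ge0 M; have q0 : 0 <= q := norm2_ge0 N.
(* At (a, b) = (q, -p) this gives Cauchy-Schwarz, at (1, 1) the squared norm of the sum. *)
have E (a b : R) : \sum_i \sum_j (a * M i j + b * N i j) ^+ 2 = a ^+ 2 * p ^+ 2 + 2 * a * b * s + b ^+ 2 * q ^+ 2.
  rewrite /p /q /s !norm2_sqr !mulr_sumr -!big_split/=; apply: eq_bigr => i _.
  by rewrite !mulr_sumr -!big_split/=; apply: eq_bigr => j _; ring.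
have [pE|p1] := eqVneq p 0; first by rewrite [M](norm2_eq0 pE) add0r lerDr norm2_ge0.
have [qE|q1] := eqVneq q 0; first by rewrite [N](norm2_eq0 qE) addr0 lerDl norm2_ge0.
have pq0 : 0 < p * q by rewrite mulr_gt0// lt_def ?p1 ?q1.
have CS : s <= p * q.
  have h : 0 <= q ^+ 2 * p ^+ 2 + 2 * q * (- p) * s + (- p) ^+ 2 * q ^+ 2.
    by rewrite -E; apply: sumr_ge0 => i _; apply: sumr_ge0 => j _; exact: sqr_ge0.
  by rewrite -(ler_pM2l pq0); nra.
rewrite -ler_sqr ?nnegrE ?norm2_ge0 ?addr_ge0// norm2_sqr.
have -> : \sum_i \sum_j (M + N) i j ^+ 2 = p ^+ 2 + 2 * s + q ^+ 2.
  transitivity (\sum_i \sum_j (1 * M i j + 1 * N i j) ^+ 2); last by rewrite E; ring.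
  by apply: eq_bigr => i _; apply: eq_bigr => j _; rewrite mxE !mul1r.
have -> : (norm2 M + norm2 N) ^+ 2 = p ^+ 2 + 2 * (p * q) + q ^+ 2 by rewrite /p /q; ring.
by rewrite lerD2r lerD2l ler_pM2l.
Qed.

Lemma norm2_le (M : 'M[R]_3) (L : R) : 0 <= L -> (forall i j, `|M i j| <= L) -> norm2 M <= 3 * L.
Proof.
move=> L0 ML; rewrite -ler_sqr ?nnegrE ?norm2_ge0 ?mulr_ge0// norm2_sqr.
apply: (@le_trans _ _ (\sum_(i < 3) \sum_(j < 3) L ^+ 2)).
  apply: ler_sum => i _; apply: ler_sum => j _; rewrite -real_normK ?num_real//.
  by apply: lerXn2r; rewrite ?nnegrE.
by rewrite !big_ord_recl !big_ord0 le_eqVlt; apply/orP; left; apply/eqP; ring.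
Qed.

Lemma norm2_dist (M N : 'M[R]_3) : `|norm2 M - norm2 N| <= norm2 (M - N).
Proof.
have h1 := norm2D (M - N) N; have h2 := norm2D (N - M) M.
rewrite subrK in h1; rewrite subrK -[norm2 (N - M)]norm2N opprB in h2.
by rewrite ler_norml; apply/andP; split; lra.
Qed.

(** Guarantees that the infimum in [dist] is taken over a nonempty set. *)
Lemma K_nonempty (S : 'M[R]_3) : K S 0.
Proof.
exists 0; exists 1%:M; last by rewrite scale0r.
by split; rewrite ?det1// trmx1 mul1mx.
Qed.

Section Dist.
Variables (E : set 'M[R]_3) (M0 : 'M[R]_3).
Hypothesis EM0 : E M0.

Lemma dist_ge0 M : 0 <= dist M E.
Proof.
by apply: lb_le_inf; [exists (norm2 (M - M0)); exists M0|move=> _ [B _ <-]; exact: norm2_ge0].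
Qed.

Lemma dist_le M B : E B -> dist M E <= norm2 (M - B).
Proof. by move=> EB; apply: ge_inf; [exists 0 => _ [C _ <-]; exact: norm2_ge0|exists B]. Qed.

Lemma dist_in M : E M -> dist M E = 0.
Proof.
move=> EM; apply/eqP; rewrite eq_le dist_ge0 andbT.
by have := dist_le M EM; rewrite subrr norm2_0.
Qed.

Lemma distD M N : dist (M + N) E <= dist M E + norm2 N.
Proof.
rewrite -lerBlDr; apply: lb_le_inf; first by exists (norm2 (M - M0)); exists M0.
move=> _ [B EB <-]; rewrite lerBlDr; apply: le_trans (dist_le _ EB) _.
by rewrite addrAC norm2D.
Qed.

End Dist.
End Norm2.

Section Energy.
Context {R : realType}.
Variable S : 'M[R]_3.

(* The cubic term makes the squared gradients equi-integrable, the weighted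
   distance drives them to K S in measure. *)
Definition energy (j : nat) (M : 'M[R]_3) : R :=
  norm2 M ^+ 3 + j%:R * Num.min 1 (dist M (K S)).

Let K0 : K S 0 := K_nonempty S.

Lemma min1_dist_ge0 M : 0 <= Num.min 1 (dist M (K S)).
Proof. by rewrite le_min ler01 (dist_ge0 K0). Qed.

Lemma energy_ge0 j M : 0 <= energy j M.
Proof. by rewrite addr_ge0 ?exprn_ge0 ?norm2_ge0// mulr_ge0// min1_dist_ge0. Qed.

Lemma min1D (a b : R) : 0 <= b -> Num.min 1 (a + b) <= Num.min 1 a + b.
Proof. by move=> b0; rewrite /Num.min; case: ifP => h; case: ifP => h'; lra. Qed.

Lemma min1_distD M N : Num.min 1 (dist (M + N) (K S)) <= Num.min 1 (dist M (K S)) + norm2 N.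
Proof.
apply: le_trans (min1D _ (norm2_ge0 N)).
by rewrite le_min ge_min lexx/= ge_min (distD K0) orbT.
Qed.

Lemma min1_dist_lip M N :
  `|Num.min 1 (dist M (K S)) - Num.min 1 (dist N (K S))| <= norm2 (M - N).
Proof.
have h1 := min1_distD N (M - N); have h2 := min1_distD M (N - M).
rewrite [N + _]addrC subrK in h1; rewrite [M + _]addrC subrK -[norm2 (N - M)]norm2N opprB in h2.
by rewrite ler_norml; apply/andP; split; lra.
Qed.

Lemma cube_lip (x y L : R) : 0 <= x <= L -> 0 <= y <= L -> `|x ^+ 3 - y ^+ 3| <= `|x - y| * (3 * L ^+ 2).
Proof.
move=> /andP[x0 xL] /andP[y0 yL].
have -> : x ^+ 3 - y ^+ 3 = (x - y) * (x ^+ 2 + x * y + y ^+ 2) by ring.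
rewrite normrM ler_wpM2l// ger0_norm ?addr_ge0 ?sqr_ge0 ?mulr_ge0//; nra.
Qed.

Lemma energy_uniform j : uniform_on_bounded (energy j).
Proof.
(* Entries at most |L| give norms at most 3 |L|, so [B] is a Lipschitz constant of the energy on
   such matrices. *)
move=> L eps e0; pose B := 3 * (3 * `|L|) ^+ 2 + j%:R.
have B0 : 0 <= B by rewrite addr_ge0// mulr_ge0// sqr_ge0.
have d0 : 0 < eps / (3 * (B + 1)) by rewrite divr_gt0// mulr_gt0// ltr_wpDl.
exists (eps / (3 * (B + 1))) => // M N ML NL MN.
have MNd : norm2 (M - N) <= 3 * (eps / (3 * (B + 1))).
  by apply: norm2_le; [exact: ltW|move=> i k; rewrite !mxE].
have n2 (X : 'M[R]_3) : (forall i k, `|X i k| <= L) -> 0 <= norm2 X <= 3 * `|L|.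
  move=> XL; rewrite norm2_ge0/=; apply: norm2_le => // i k.
  exact: le_trans (XL i k) (ler_norm L).
have h1 := cube_lip (n2 M ML) (n2 N NL).
have h2 := min1_dist_lip M N.
have -> : energy j M - energy j N = (norm2 M ^+ 3 - norm2 N ^+ 3) +
    j%:R * (Num.min 1 (dist M (K S)) - Num.min 1 (dist N (K S))) by rewrite /energy; ring.
apply: le_trans (ler_normD _ _) _; rewrite normrM (@ger0_norm _ j%:R)//.
apply: (@le_trans _ _ (norm2 (M - N) * B)).
  rewrite /B mulrDr; apply: lerD.
    by apply: le_trans h1 _; rewrite ler_wpM2r ?mulr_ge0 ?sqr_ge0// norm2_dist.
  by rewrite mulrC ler_wpM2r.
apply: (@le_trans _ _ (3 * (eps / (3 * (B + 1))) * (B + 1))).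
  by apply: ler_pM => //; rewrite ?norm2_ge0 ?lerDl.
have BB : B + 1 != 0 by rewrite gt_eqF// ltr_wpDl.
by rewrite le_eqVlt; apply/orP; left; apply/eqP; field.
Qed.

Lemma energy_bounded j : forall L, exists C, forall M : 'M[R]_3, (forall i k, `|M i k| <= L) -> energy j M <= C.
Proof.
move=> L; exists ((3 * `|L|) ^+ 3 + j%:R) => M ML; apply: lerD.
  rewrite lerXn2r ?nnegrE ?norm2_ge0 ?mulr_ge0//; apply: norm2_le => // i k.
  exact: le_trans (ML i k) (ler_norm L).
by rewrite ler_piMr// ge_min lexx.
Qed.

Lemma energy_K j M : K S M -> energy j M = norm2 M ^+ 3.
Proof. by move=> KM; rewrite /energy (dist_in K0 KM) /Num.min ltr10 mulr0 addr0. Qed.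

Lemma energy_le j M : energy j M <= norm2 M ^+ 3 + j%:R.
Proof. by rewrite lerD2l ler_piMr// ge_min lexx. Qed.

(** The weighted distance moves by at most j |N| <= 1. For the cube, 4 x^3 + 4 - (x + 1)^3 = 3 (x +
    1) (x - 1)^2 is nonnegative. Neither constant depends on j. *)
Lemma energyD j M N : j.+1%:R * norm2 N <= 1 -> energy j (M + N) <= 4 * energy j M + 5.
Proof.
move=> jN; have n0 := norm2_ge0 N; have m0 := norm2_ge0 M.
have n1 : norm2 N <= 1.
  by apply: le_trans jN; rewrite ler_peMl// ler1n.
have jn : j%:R * norm2 N <= 1 by apply: le_trans jN; rewrite ler_wpM2r// ler_nat.
have c1 : norm2 (M + N) ^+ 3 <= 4 * norm2 M ^+ 3 + 4.
  apply: (@le_trans _ _ ((norm2 M + 1) ^+ 3)).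
    rewrite lerXn2r ?nnegrE ?norm2_ge0 ?addr_ge0//.
    by apply: le_trans (norm2D M N) _; rewrite lerD2l.
  have : 0 <= (norm2 M + 1) * (norm2 M - 1) ^+ 2 by rewrite mulr_ge0 ?sqr_ge0 ?addr_ge0.
  by move: (norm2 M) m0 => x x0; nra.
have c2 : j%:R * Num.min 1 (dist (M + N) (K S)) <= j%:R * Num.min 1 (dist M (K S)) + 1.
  apply: (@le_trans _ _ (j%:R * (Num.min 1 (dist M (K S)) + norm2 N))).
    by rewrite ler_wpM2l// min1_distD.
  by rewrite mulrDr lerD2l.
have c3 : 0 <= j%:R * Num.min 1 (dist M (K S)) by rewrite mulr_ge0// min1_dist_ge0.
by rewrite /energy; lra.
Qed.

Lemma C1periodic_measurable j (A : 'M[R]_3) v G : C1periodic v G ->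
  measurable_fun setT (fun x => (energy j (A + G x))%:E).
Proof.
move=> [_ cG _ _]; apply/measurable_EFinP; apply: continuous_measurable3.
apply: uniform_on_bounded_continuous; first exact: energy_uniform.
move=> i k; rewrite (_ : (fun x => _) = fun x => A i k + G x i k); last by apply/funext => x; rewrite mxE.
by move=> x; apply: cvgD; [exact: cvg_cst|exact: cG].
Qed.

Lemma envelope_le_self j A : envelope_le (energy j) A (energy j A).
Proof.
move=> del del0; exists (fun=> 0), (fun=> 0); split.
- split=> [i x|i k x|i k x|k x] //; [exact: cvg_cst|exact: cvg_cst|].
  by rewrite !mxE; exact: is_derive_cst.
- by move=> x i; rewrite mxE normr0.
- under eq_integral do rewrite addr0.
  by rewrite integral_cell_cst lee_fin lerDl ltW.
Qed.

Lemma envelope_leW f (A : 'M[R]_3) c d : c <= d -> envelope_le f A c -> envelope_le f A d.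
Proof.
move=> cd H del del0; have [v [G [C1 v1 I]]] := H _ del0; exists v, G; split => //.
by apply: le_trans I _; rewrite lee_fin lerD2r.
Qed.

Lemma envelope_le_lim f (A : 'M[R]_3) c : (forall del, 0 < del -> envelope_le f A (c + del)) ->
  envelope_le f A c.
Proof.
move=> H del del0; have d2 : 0 < del / 2 by rewrite divr_gt0.
have [v [G [C1 v1 I]]] := H _ d2 _ d2; exists v, G; split => //.
by apply: le_trans I _; rewrite lee_fin -addrA -splitr.
Qed.

(** The field that is almost optimal at A serves at A + N as well. This lets a matrix inherit a
    bound uniform in j from approximations that depend on j. *)
Lemma envelope_leD j (A N : 'M[R]_3) c : j.+1%:R * norm2 N <= 1 ->
  envelope_le (energy j) A c -> envelope_le (energy j) (A + N) (4 * c + 5).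
Proof.
move=> jN H del del0; have d4 : 0 < del / 4 by rewrite divr_gt0.
have [v [G [C1 v1 I]]] := H _ d4; exists v, G; split => //.
have mc := @measurable_cell R.
have mE := C1periodic_measurable j A C1.
have mE' := C1periodic_measurable j (A + N) C1.
apply: (@le_trans _ _ (\int[lebs R]_(x in cell) (4%:E * (energy j (A + G x))%:E + 5%:E))%E).
  rewrite lebE; apply: ge0_le_integral => //.
  - by move=> x _; rewrite lee_fin energy_ge0.
  - exact: measurable_funTS.
  - by apply: measurable_funTS; apply: emeasurable_funD => //; exact: measurable_funeM.
  - by move=> x _; rewrite -EFinM -EFinD lee_fin addrAC; exact: energyD.
rewrite ge0_integralD//; last 2 first.
- by move=> x _; rewrite lee_fin mulr_ge0// energy_ge0.
- by apply: measurable_funTS; exact: measurable_funeM.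
have -> : (\int[lebs R]_(x in cell) 5%:E = 5%:E)%E by exact: integral_cell_cst.
have -> : (\int[lebs R]_(x in cell) (4%:E * (energy j (A + G x))%:E) =
    4%:E * \int[leb]_(x in cell) (energy j (A + G x))%:E)%E.
  apply: ge0_integralZl_EFin => //.
    by move=> x _; rewrite lee_fin energy_ge0.
  exact: measurable_funTS.
apply: (@le_trans _ _ (4%:E * (c + del / 4)%:E + 5%:E)%E).
  by apply: leeD => //; apply: lee_wpmul2l => //; rewrite lee_fin.
by rewrite -EFinM -EFinD lee_fin; lra.
Qed.

End Energy.

Section Kapp.
Context {R : realType}.
Variable S : 'M[R]_3.

Lemma C1map_affine (A : 'M[R]_3) (v : pt R -> 'cV[R]_3) (G : pt R -> 'M[R]_3) :
  C1periodic v G -> C1map (fun x => v x + A *m vec x) (fun x => A + G x).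
Proof.
move=> [cv cG dv _].
have E i : (fun x => (v x + A *m vec x) i 0) = (fun x => v x i 0 + (dot (fun k => A i k) x + 0)).
  apply/funext => x; rewrite !mxE !big_ord_recl big_ord0 /vec !mxE /dot /=; congr (_ + _).
  rewrite !addr0 addrA; congr (_ + _ + _); congr (A i _ * _); exact: val_inj.
split=> [i|i j|i j x].
- by rewrite E => x; apply: cvgD; [exact: cv|exact: continuous_dot].
- rewrite (_ : (fun x => _) = fun x => A i j + G x i j); last by apply/funext => x; rewrite mxE.
  by move=> x; apply: cvgD; [exact: cvg_cst|exact: cG].
- rewrite E mxE addrC.
  have := @is_derive_comp_dot R id (fun=> 1) (fun k => A i k) 0 x j (fun s => is_derive_id s (1 : R)).
  by rewrite mul1r => d; exact: (is_deriveD_fun (dv i j x) d).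
Qed.

Lemma C1periodic_map (v : pt R -> 'cV[R]_3) (G : pt R -> 'M[R]_3) : C1periodic v G -> C1map v G.
Proof. by case. Qed.

Variables (A : 'M[R]_3) (C : R) (v : nat -> pt R -> 'cV[R]_3) (G : nat -> pt R -> 'M[R]_3).
Hypothesis C1v : forall k, C1periodic (v k) (G k).
Hypothesis v1 : forall k x i, `|v k x i 0| <= 1.
Hypothesis IG : forall k, (\int[leb]_(x in cell) (energy S k.+1 (A + G k x))%:E <= C%:E)%E.

Let mE k : measurable_fun setT (fun x => (energy S k.+1 (A + G k x))%:E) :=
  C1periodic_measurable S k.+1 A (C1v k).

Let mED (D : set (pt R)) k : measurable_fun D (fun x => (energy S k.+1 (A + G k x))%:E).
Proof. by apply: measurable_funTS; exact: mE. Qed.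

Lemma measurable_norm2_sqr (m l : nat) (F : pt R -> 'M[R]_(m, l)) :
  (forall i j, continuous (fun x => F x i j)) -> measurable_fun setT (fun x => norm2 (F x) ^+ 2).
Proof.
move=> cF; rewrite (_ : (fun x => _) = fun x => \sum_i \sum_j (F x i j) ^+ 2); last first.
  by apply/funext => x; rewrite norm2_sqr.
apply: measurable_sum => i; apply: measurable_sum => j; apply: measurable_funX.
exact: continuous_measurable3.
Qed.

Let mN2 (D : set (pt R)) k : measurable_fun D (fun x => (norm2 (A + G k x) ^+ 2)%:E).
Proof.
apply: measurable_funTS; apply/measurable_EFinP; apply: measurable_norm2_sqr.
by have [] := C1map_affine A (C1v k).
Qed.

(** If |M| <= a the first term suffices, otherwise |M|^2 <= |M|^3 / a. The choice a = 1 bounds the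
    gradients in L^2, a large a makes them equi-integrable. *)
Lemma energy_ge_norm2 k (a : R) (M : 'M[R]_3) : 0 < a -> norm2 M ^+ 2 <= a ^+ 2 + a^-1 * energy S k M.
Proof.
move=> a0; have n0 := norm2_ge0 M.
have h : norm2 M ^+ 3 <= energy S k M.
  by rewrite lerDl mulr_ge0// min1_dist_ge0.
apply: (@le_trans _ _ (a ^+ 2 + a^-1 * norm2 M ^+ 3)); last first.
  by rewrite lerD2l ler_wpM2l// invr_ge0 ltW.
have [na|an] := leP (norm2 M) a.
  by rewrite ler_wpDr ?mulr_ge0 ?invr_ge0 ?exprn_ge0 ?(ltW a0)// lerXn2r ?nnegrE// ltW.
rewrite ler_wpDl ?sqr_ge0// mulrC ler_pdivlMr// [leRHS]exprSr.
by rewrite ler_wpM2l ?sqr_ge0// ltW.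
Qed.

Lemma energy_cube (r : R) : exists2 c, 0 < c &
  forall k, (\int[leb]_(x in cube r) (energy S k.+1 (A + G k x))%:E <= c%:E)%E.
Proof.
(* The extra 1 puts the closed cube inside the half-open cube of half-width N + 1, which consists of
   whole cells. *)
have [N rN] := exists_natr_ge (r + 1).
exists (Num.max 1 ((N.+1.*2 ^ 3)%:R * C)) => [|k]; first by rewrite lt_max ltr01.
pose Q : set (pt R) := ((`[(- N.+1%:R)%R, N.+1%:R%R[ `*` `[(- N.+1%:R)%R, N.+1%:R%R[) `*` `[(- N.+1%:R)%R, N.+1%:R%R[)%classic.
have mQ : measurable Q by apply: measurableX => //; exact: measurableX.
have sub : cube r `<=` Q.
  have h (x : R) : `[- r, r]%classic x -> `[- N.+1%:R, N.+1%:R[%classic x.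
    by rewrite /= !in_itv/= => /andP[h1 h2]; apply/andP; split; lra.
  by move=> [[x y] z] [[/= hx hy] hz]; split; [split|]; exact: h.
apply: (@le_trans _ _ (\int[lebs R]_(x in Q) (energy S k.+1 (A + G k x))%:E)%E).
  apply: (@ge0_subset_integral _ _ _ (lebs R)) => //; first exact: measurable_cube.
    exact: mED.
  by move=> x _; rewrite lee_fin energy_ge0.
have -> : (\int[lebs R]_(x in Q) (energy S k.+1 (A + G k x))%:E =
    (N.+1.*2 ^ 3)%:R%:E * \int[leb]_(x in cell) (energy S k.+1 (A + G k x))%:E)%E.
  apply: (@integral_cube_periodic R (fun x => (energy S k.+1 (A + G k x))%:E) N.+1 (mE k)).
  - by move=> x; rewrite lee_fin energy_ge0.
  - by case: (C1v k) => _ _ _ p j x; case: (p j x) => _ ->.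
apply: (@le_trans _ _ ((N.+1.*2 ^ 3)%:R%:E * C%:E)%E).
  by apply: lee_wpmul2l; [rewrite lee_fin|exact: IG].
by rewrite -EFinM lee_fin le_max lexx orbT.
Qed.

Lemma Kapp_bounded : bounded_W12loc (fun k x => v k x + A *m vec x) (fun k x => A + G k x).
Proof.
move=> r; have [c c0 Hc] := energy_cube r.
have [B HB] : exists B, forall k x, cube r x -> norm2 (v k x + A *m vec x) ^+ 2 <= B.
  have cAv i : continuous (fun x => (A *m vec x) i 0).
    rewrite (_ : (fun x => _) = fun x => dot (fun k => A i k) x + 0); first exact: continuous_dot.
    apply/funext => x; rewrite !mxE !big_ord_recl big_ord0 /vec !mxE /dot /=.
    rewrite !addr0 addrA; congr (_ + _ + _); congr (A i _ * _); exact: val_inj.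
  have /choice[b Hb] : forall i, exists b, forall x, cube r x -> `|(A *m vec x) i 0| <= b.
    by move=> i; have [b _ Hb] := bounded_on_cube r (cAv i); exists b.
  exists (\sum_i \sum_(j < 1) (1 + b i) ^+ 2) => k x cx; rewrite norm2_sqr.
  apply: ler_sum => i _; apply: ler_sum => j _; rewrite (ord1 j) -real_normK ?num_real//.
  have bi : 0 <= b i := le_trans (normr_ge0 _) (Hb i x cx).
  rewrite lerXn2r ?nnegrE ?addr_ge0// mxE; apply: le_trans (ler_normD _ _) _.
  by apply: lerD; [exact: v1|exact: Hb].
have [L cubeL] : exists L : R, leb (cube r : set (pt R)) = L%:E.
  have h0 : (0 <= leb (cube r : set (pt R)))%E by exact: (measure_ge0 (lebs R) (cube r)).
  have := @cube_lty R r; move: h0; case: (leb _) => // L _ _; by exists L.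
exists ((`|B| + 1) * L + c) => k.
have mc := @measurable_cube R r.
apply: (@le_trans _ _ (\int[lebs R]_(x in cube r) ((`|B| + 1)%:E + (energy S k.+1 (A + G k x))%:E))%E).
  have [cu cG _] := C1map_affine A (C1v k).
  apply: (@ge0_le_integral _ _ _ (lebs R)) => //.
  - by move=> x _; rewrite lee_fin addr_ge0// sqr_ge0.
  - apply: measurable_funTS; apply/measurable_EFinP; apply: measurable_funD.
      by apply: measurable_norm2_sqr => i j; rewrite (ord1 j).
    exact: measurable_norm2_sqr.
  - by apply: emeasurable_funD => //; exact: mED.
  - move=> x cx; rewrite -EFinD lee_fin -addrA; apply: lerD.
      exact: le_trans (HB k x cx) (ler_norm B).
    by have := energy_ge_norm2 k.+1 (A + G k x) ltr01; rewrite expr1n invr1 mul1r.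
rewrite ge0_integralD//; last 2 first.
- by move=> x _; rewrite lee_fin energy_ge0.
- exact: mED.
have -> : (\int[lebs R]_(x in cube r) (`|B| + 1)%:E = ((`|B| + 1) * L)%:E)%E.
  rewrite EFinM -cubeL lebE; exact: (@integral_cst _ _ _ (lebs R) _ mc).
by rewrite EFinD; apply: leeD => //; exact: Hc.
Qed.

Lemma Kapp_equi_integrable : L2loc_equi_integrable (fun k x => A + G k x).
Proof.
move=> r eps e0; have [c c0 Hc] := energy_cube r.
(* Makes c / a at most eps / 2; the measure bound below makes the remaining term a^2 |E| less than
   eps / 2. *)
pose a := 2 * c / eps + 1; have a0 : 0 < a by rewrite ltr_wpDl// !mulr_ge0 ?invr_ge0 ?(ltW c0) ?(ltW e0).
have e2 : 0 < eps / 2 / a ^+ 2 by rewrite !divr_gt0// exprn_gt0.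
exists (eps / 2 / a ^+ 2) => // k E mE' Ecube Edel.
have ia0 : 0 <= a^-1 by rewrite invr_ge0 ltW.
apply: (@le_lt_trans _ _ (\int[lebs R]_(x in E) ((a ^+ 2)%:E + a^-1%:E * (energy S k.+1 (A + G k x))%:E))%E).
  apply: (@ge0_le_integral _ _ _ (lebs R)) => //.
  - by move=> x _; rewrite lee_fin sqr_ge0.
  - exact: mN2.
  - by apply: emeasurable_funD => //; apply: measurable_funeM; exact: mED.
  - by move=> x Ex; rewrite -EFinM -EFinD lee_fin; exact: energy_ge_norm2.
rewrite ge0_integralD//; last 3 first.
- by move=> x _; rewrite lee_fin sqr_ge0.
- by move=> x _; rewrite lee_fin mulr_ge0// energy_ge0.
- by apply: measurable_funeM; exact: mED.
have -> : (\int[lebs R]_(x in E) (a ^+ 2)%:E = (a ^+ 2)%:E * leb E)%E.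
  exact: (@integral_cst _ _ _ (lebs R) _ mE').
have -> : (\int[lebs R]_(x in E) (a^-1%:E * (energy S k.+1 (A + G k x))%:E) =
    a^-1%:E * \int[lebs R]_(x in E) (energy S k.+1 (A + G k x))%:E)%E.
  apply: ge0_integralZl_EFin => //; last exact: mED.
  by move=> x _; rewrite lee_fin energy_ge0.
have -> : eps%:E = ((a ^+ 2)%:E * (eps / 2 / a ^+ 2)%:E + (eps / 2)%:E)%E.
  by rewrite -EFinM -EFinD; congr EFin; field; rewrite gt_eqF.
have Ec : (\int[lebs R]_(x in E) (energy S k.+1 (A + G k x))%:E <= c%:E)%E.
  apply: le_trans (Hc k); apply: (@ge0_subset_integral _ _ _ (lebs R)) => //.
  - exact: measurable_cube.
  - exact: mED.
  - by move=> x _; rewrite lee_fin energy_ge0.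
have E0 : (0 <= \int[lebs R]_(x in E) (energy S k.+1 (A + G k x))%:E)%E.
  by apply: integral_ge0 => x _; rewrite lee_fin energy_ge0.
have h1 : ((a ^+ 2)%:E * leb E < (a ^+ 2)%:E * (eps / 2 / a ^+ 2)%:E)%E.
  by rewrite lte_pmul2l// lte_fin exprn_gt0.
have h2 : (a^-1%:E * (\int[lebs R]_(x in E) (energy S k.+1 (A + G k x))%:E) <= (eps / 2)%:E)%E.
  apply: (@le_trans _ _ (a^-1%:E * c%:E)%E); first by apply: lee_wpmul2l => //; rewrite lee_fin.
  rewrite -EFinM lee_fin mulrC ler_pdivrMr// /a.
  have -> : eps / 2 * (2 * c / eps + 1) = c + eps / 2 by field; rewrite gt_eqF.
  by rewrite lerDl divr_ge0// ltW.
apply: lte_leD => //.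
rewrite ge0_fin_numE; last by apply: mule_ge0 => //; rewrite lee_fin.
exact: le_lt_trans h2 (ltry _).
Qed.

(** Chebyshev's inequality: where the distance is at least eps, the energy is at least (k + 1)
    min(1, eps), while its integral over the cube is bounded uniformly in k. *)
Lemma Kapp_in_measure : cvg0_locally_in_measure (fun k x => dist (A + G k x) (K S)).
Proof.
move=> r eps e0; have [c c0 Hc] := energy_cube r.
pose m := Num.min 1 eps; have m0 : 0 < m by rewrite lt_min ltr01.
have mc := @measurable_cube R r.
have uf : uniform_on_bounded (fun M : 'M[R]_3 => dist M (K S)).
  move=> L del del0; exists (del / 3) => [|M N _ _ MN]; first by rewrite divr_gt0.
  have MNd : norm2 (M - N) <= 3 * (del / 3).
    by apply: norm2_le => [|i l]; [rewrite divr_ge0// ltW|rewrite !mxE; exact: MN].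
  have h1 := distD (K_nonempty S) N (M - N); have h2 := distD (K_nonempty S) M (N - M).
  rewrite [N + _]addrC subrK in h1; rewrite [M + _]addrC subrK -[norm2 (N - M)]norm2N opprB in h2.
  by rewrite ler_norml; apply/andP; split; lra.
have md k : measurable_fun setT (fun x => dist (A + G k x) (K S)).
  have [_ cG _] := C1map_affine A (C1v k).
  exact: (continuous_measurable3 (uniform_on_bounded_continuous uf cG)).
pose B k : set (pt R) := cube r `&` [set x | eps <= `|dist (A + G k x) (K S)|].
have mB k : measurable (B k).
  have h : measurable_fun setT (fun x => `|dist (A + G k x) (K S)|).
    exact: (measurableT_comp (@normr_measurable R setT) (md k)).
  apply: measurableI => //; rewrite -[X in measurable X]setTI.
  have := h measurableT _ (measurable_itv `[eps, +oo[).
  by rewrite (_ : _ @^-1` _ = [set x | eps <= `|dist (A + G k x) (K S)|])//; apply/seteqP; split => x /=; rewrite in_itv/= andbT.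
pose B' k : set (pt R) := cube r `&` [set x | ((k.+1%:R * m)%:E <= `|(energy S k.+1 (A + G k x))%:E|)%E].
have mB' k : measurable (B' k).
  by apply: emeasurable_fun_c_infty => //; apply: measurableT_comp => //; exact: mED.
have BB' k : B k `<=` B' k.
  move=> x [cx /= ex]; split => //=.
  rewrite lee_fin ger0_norm ?energy_ge0// /energy ler_wpDl ?exprn_ge0 ?norm2_ge0//.
  rewrite ler_wpM2l// /m le_min ge_min lexx/= ge_min; apply/orP; right.
  by move: ex; rewrite ger0_norm// (dist_ge0 (K_nonempty S)).
have bnd k : (leb (B k) <= ((c / m) * harmonic k)%:E)%E.
  have a0 : 0 < k.+1%:R * m by rewrite mulr_gt0.
  have H := @le_integral_abse _ _ _ (lebs R) _ mc _ _ (@mED (cube r) k) a0.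
  have HB : (leb (B k) <= leb (B' k))%E.
    exact: (@le_measure _ _ _ (lebs R) _ _ (mem_set (mB k)) (mem_set (mB' k)) (BB' k)).
  apply: le_trans HB _; rewrite -(@lee_pmul2l _ (k.+1%:R * m)%:E)//.
  rewrite -EFinM (_ : _ * (c / m * _) = c); last first.
    by rewrite /harmonic/=; field; rewrite nat1r pnatr_eq0/= gt_eqF.
  apply: le_trans H _; apply: le_trans (Hc k); rewrite le_eqVlt; apply/orP; left; apply/eqP.
  by apply: eq_integral => x _; rewrite gee0_abs// lee_fin energy_ge0.
apply: (@squeeze_cvge _ _ _ _ (fun=> 0%E) _ (fun k => ((c / m) * harmonic k)%:E)).
- by apply: nearW => k; rewrite bnd andbT; exact: (measure_ge0 (lebs R) (B k)).
- exact: cvg_cst.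
- apply: cvg_EFin; first exact: nearW.
  rewrite -(mulr0 (c / m)); apply: cvgM; [exact: cvg_cst|exact: cvg_harmonic].
Qed.
End Kapp.

(** The k-th field is optimal up to 1 for the energy of index k + 1, so one bound holds along the
    sequence while the weight on the distance tends to infinity. *)
Lemma Kapp_of_envelope (R : realType) (S A : 'M[R]_3) (C : R) : A^T = A ->
  (forall j, envelope_le (energy S j) A C) -> Kapp S A.
Proof.
move=> symA H; split=> //.
have /choice[v /choice[G HvG]] : forall k, exists v G, [/\ C1periodic v G,
    forall x i, `|v x i 0| <= 1
  & (\int[leb]_(x in cell) (energy S k.+1 (A + G x))%:E <= (C + 1)%:E)%E].
  by move=> k; exact: H.
have C1v k : C1periodic (v k) (G k) by have [] := HvG k.
have v1 k x i : `|v k x i 0| <= 1 by have [_ h _] := HvG k; exact: h.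
have IG k : (\int[leb]_(x in cell) (energy S k.+1 (A + G k x))%:E <= (C + 1)%:E)%E by have [] := HvG k.
exists (fun k x => v k x + A *m vec x), (fun k x => A + G k x); split.
- move=> k; exists (v k) => //; split.
    by exists (G k); apply: C1map_W12loc; exact: C1periodic_map (C1v k).
  move=> j; apply: aeW => x; have [_ _ _ p] := C1v k; by have [] := p j x.
- by move=> k; apply: C1map_W12loc; exact: C1map_affine.
- exact: (Kapp_bounded C1v v1 IG).
- exact: (Kapp_equi_integrable C1v IG).
- exact: (Kapp_in_measure C1v IG).
Qed.

(** * Iterated splitting *)

Section Rotations.
Context {R : realType}.
Implicit Types Q P M S : 'M[R]_3.

Lemma SO3_tr Q : SO3 Q -> SO3 Q^T.
Proof. by move=> [h d]; split; rewrite ?det_tr// trmxK; exact: mulmx1C. Qed.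

Lemma SO3_mul P Q : SO3 P -> SO3 Q -> SO3 (P *m Q).
Proof.
move=> [hP dP] [hQ dQ]; split; last by rewrite det_mulmx dP dQ mulr1.
by rewrite trmx_mul mulmxA -(mulmxA Q^T) hP mulmx1.
Qed.

Lemma SO3_1 : SO3 (1%:M : 'M[R]_3).
Proof. by split; rewrite ?det1// trmx1 mulmx1. Qed.

Lemma SO3_trmx_mul Q : SO3 Q -> Q^T *m Q = 1%:M. Proof. by case. Qed.

Lemma SO3_mul_trmx Q : SO3 Q -> Q *m Q^T = 1%:M.
Proof. by move=> [h _]; exact: mulmx1C. Qed.

Lemma norm2_tr m k (M : 'M[R]_(m, k)) : norm2 M = Num.sqrt (\tr (M^T *m M)).
Proof.
rewrite /norm2 exchange_big/=; congr Num.sqrt; apply: eq_bigr => j _.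
by rewrite mxE; apply: eq_bigr => i _; rewrite mxE expr2.
Qed.

Lemma norm2_conj Q M : SO3 Q -> norm2 (Q^T *m M *m Q) = norm2 M.
Proof.
move=> hQ; rewrite !norm2_tr; congr Num.sqrt.
rewrite !trmx_mul trmxK !mulmxA mxtrace_mulC !mulmxA.
by rewrite (SO3_mul_trmx hQ) mul1mx -(mulmxA _ Q Q^T) (SO3_mul_trmx hQ) mulmx1.
Qed.

Lemma tensor_conj Q (n : 'cV[R]_3) : Q^T *m tensor n *m Q = tensor (Q^T *m n).
Proof. by rewrite /tensor trmx_mul trmxK !mulmxA. Qed.

Lemma K_scale S Q r : SO3 Q -> K S (r *: (Q^T *m S *m Q)).
Proof. by move=> hQ; exists r; exists Q. Qed.

Lemma conj_mul P Q M : (P *m Q)^T *m M *m (P *m Q) = Q^T *m (P^T *m M *m P) *m Q.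
Proof. by rewrite trmx_mul !mulmxA. Qed.

Lemma conjD Q M N : Q^T *m (M + N) *m Q = Q^T *m M *m Q + Q^T *m N *m Q.
Proof. by rewrite mulmxDr mulmxDl. Qed.

Lemma conjZ Q M r : Q^T *m (r *: M) *m Q = r *: (Q^T *m M *m Q).
Proof. by rewrite -scalemxAr -scalemxAl. Qed.

Lemma envelope_le_K S Q j r : SO3 Q -> 0 <= r ->
  envelope_le (energy S j) (r *: (Q^T *m S *m Q)) (r ^+ 3 * norm2 S ^+ 3).
Proof.
move=> hQ r0; have := @envelope_le_self _ S j (r *: (Q^T *m S *m Q)).
by rewrite energy_K; [rewrite norm2Z norm2_conj// ger0_norm// exprMn|exact: K_scale].
Qed.

Lemma envelope_le_tensor S j (A B : 'M[R]_3) (n : 'cV[R]_3) (a theta c d : R) :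
  0 < theta < 1 -> A - B = a *: tensor n ->
  envelope_le (energy S j) A c -> envelope_le (energy S j) B d ->
  envelope_le (energy S j) (theta *: A + (1 - theta) *: B) (theta * c + (1 - theta) * d).
Proof.
move=> th AB; apply: (envelope_le_rank1 (a := a *: n) (n := n)) => //.
- exact: energy_ge0.
- exact: energy_uniform.
- exact: energy_bounded.
- by rewrite AB /tensor scalemxAl.
Qed.

(* B splits into a point of K S and a scaled rotation of itself, so the splitting
   can be repeated inside the second phase; the cubic part of the energy is then
   a geometric series of ratio (1 - th) k^3. *)
Section Iterate.
Variables (S B W : 'M[R]_3) (n : 'cV[R]_3) (th l k a Kc : R).
Hypotheses (th01 : 0 < th < 1) (l0 : 0 < l) (k0 : 0 < k) (SW : SO3 W).
Hypothesis BE : B = th *: (l *: S) + (1 - th) *: (k *: (W^T *m B *m W)).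
Hypothesis Bn : l *: S - k *: (W^T *m B *m W) = a *: tensor n.
Hypotheses (rho : (1 - th) * k ^+ 3 < 1) (Kc0 : 0 <= Kc).
Hypothesis KE : Kc = th * (l ^+ 3 * norm2 S ^+ 3) + (1 - th) * k ^+ 3 * Kc.

(** Quantified over scales and rotations because the second phase of such a multiple of [B] is
    another one, with scale [r * k] and rotation [W *m Q]. The term with [Kc] reproduces itself by
    [KE]; the other two are the cost of the phase left unsplit after N steps. *)
Lemma envelope_le_iter j N r Q : 0 < r -> SO3 Q ->
  envelope_le (energy S j) (r *: (Q^T *m B *m Q))
    (r ^+ 3 * Kc + ((1 - th) ^+ N * j%:R + ((1 - th) * k ^+ 3) ^+ N * (r ^+ 3 * norm2 B ^+ 3))).
Proof.
have /andP[t0 t1] := th01.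
elim: N r Q => [|N IH] r Q r0 SQ.
  rewrite !expr0 !mul1r; apply: (envelope_leW _ (@envelope_le_self _ S j _)).
  apply: le_trans (energy_le _ _ _) _.
  rewrite norm2Z norm2_conj// gtr0_norm// exprMn addrC ler_wpDl ?mulr_ge0 ?exprn_ge0//; exact: ltW.
have rk : 0 < r * k by rewrite mulr_gt0.
have H := IH _ (W *m Q) rk (SO3_mul SW SQ).
have rl : 0 <= r * l by rewrite mulr_ge0// ltW.
have HK := envelope_le_K S j SQ rl.
have E : (r * l) *: (Q^T *m S *m Q) - (r * k) *: ((W *m Q)^T *m B *m (W *m Q)) = (r * a) *: tensor (Q^T *m n).
  by rewrite conj_mul -tensor_conj -!scalerA -scalerBr -(conjZ Q (tensor n)) -Bn mulmxBr mulmxBl !conjZ.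
have := envelope_le_tensor th01 E HK H.
have -> : th *: ((r * l) *: (Q^T *m S *m Q)) + (1 - th) *: ((r * k) *: ((W *m Q)^T *m B *m (W *m Q))) =
    r *: (Q^T *m B *m Q).
  rewrite [in RHS]BE conjD !conjZ conj_mul scalerDr !scalerA; congr (_ *: _ + _ *: _); ring.
apply: envelope_leW; rewrite [in leRHS]KE !exprS !exprMn le_eqVlt; apply/orP; left; apply/eqP; ring.
Qed.

(** Both remainders tend to zero as N grows, the second by [rho], and what is left does not involve
    j. *)
Lemma envelope_le_limit j r Q : 0 < r -> SO3 Q ->
  envelope_le (energy S j) (r *: (Q^T *m B *m Q)) (r ^+ 3 * Kc).
Proof.
move=> r0 SQ; apply: envelope_le_lim => del del0; have /andP[t0 t1] := th01.
pose z N := (1 - th) ^+ N * j%:R + ((1 - th) * k ^+ 3) ^+ N * (r ^+ 3 * norm2 B ^+ 3).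
have zc : z N @[N --> \oo] --> 0.
  rewrite -(addr0 0) -[X in X + _](mul0r j%:R) -[X in _ + X](mul0r (r ^+ 3 * norm2 B ^+ 3)).
  apply: cvgD; apply: cvgM; try exact: cvg_cst; apply: cvg_expr.
    by rewrite ger0_norm; lra.
  by rewrite ger0_norm// mulr_ge0 ?exprn_ge0 ?(ltW k0)//; lra.
have /cvgrPdist_le/(_ _ del0)[N _ HN] := zc.
have {HN} := HN N (leqnn N); rewrite /= sub0r normrN => HN.
apply: envelope_leW (envelope_le_iter j N r0 SQ).
by rewrite lerD2l; exact: le_trans (ler_norm _) HN.
Qed.
End Iterate.

(** [th] comes from matching the coefficients of n (x) n in the splitting of B_2. [Kc] is the sum of
    the geometric series; the factor [l2 - l1] of [E2] cancels there against that of [th]. *)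
Lemma iteration_numbers (l1 l2 D s : R) : 0 < l1 -> 0 < l2 -> 0 < D ->
  D = l1 ^+ 2 + l1 * l2 + l2 ^+ 2 - l1 - l2 ->
  (l1 < l2 /\ l2 < 1) \/ (1 < l2 /\ l2 < l1) ->
  let th := (l2 - l1) / (l2 * (1 - l1)) in let k := l2 / l1 in
  let Kc := s * (l1 ^+ 2 * l2 ^+ 2) / D in
  [/\ 0 < th < 1, (1 - th) * k ^+ 3 < 1
    & Kc = th * (l2 ^+ 3 * s) + (1 - th) * k ^+ 3 * Kc].
Proof.
move=> l10 l20 D0 DE H th k Kc.
have l1n : 1 - l1 != 0 by apply/negP => /eqP; case: H => -[]; lra.
have l11 : l1 != 0 by rewrite gt_eqF.
have l21 : l2 != 0 by rewrite gt_eqF.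
have Dn : D != 0 by rewrite gt_eqF.
have E1 : 1 - th = l1 * (1 - l2) / (l2 * (1 - l1)) by rewrite /th; field; rewrite l21 l1n.
have E2 : 1 - (1 - th) * k ^+ 3 = (l2 - l1) * D / (l1 ^+ 2 * (1 - l1)).
  by rewrite E1 /k DE; field; rewrite l11 l21 l1n.
(* For 1 < l2 < l1 the differences [l2 - l1], [1 - l1] and [1 - l2] are all negative, so the
   quotients keep their sign. *)
have pos (x y : R) : (0 < x /\ 0 < 1 - l1) \/ (x < 0 /\ 1 - l1 < 0) -> 0 < y -> 0 < x / (y * (1 - l1)).
  case=> -[hx h1] y0; first by rewrite divr_gt0// mulr_gt0.
  by rewrite -mulrNN -invrN -mulrN divr_gt0 ?oppr_gt0// mulr_gt0 ?oppr_gt0.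
have sg : (0 < l2 - l1 /\ 0 < 1 - l1) \/ (l2 - l1 < 0 /\ 1 - l1 < 0).
  by case: H => -[h1 h2]; [left|right]; split; lra.
have sg2 : (0 < 1 - l2 /\ 0 < 1 - l1) \/ (1 - l2 < 0 /\ 1 - l1 < 0).
  by case: H => -[h1 h2]; [left|right]; split; lra.
split.
- apply/andP; split; first exact: pos.
  by rewrite -subr_gt0 E1 -mulrA mulr_gt0//; exact: pos.
- rewrite -subr_gt0 E2 mulrAC mulr_gt0//; apply: pos => //; exact: exprn_gt0.
- have -> : (1 - th) * k ^+ 3 = 1 - (l2 - l1) * D / (l1 ^+ 2 * (1 - l1)) by rewrite -E2; ring.
  by rewrite /Kc /th; field; rewrite Dn l11 l21 l1n.
Qed.
End Rotations.

Lemma envelope_le_pair (R : realType) (S W : 'M[R]_3) (n : 'cV[R]_3) (l1 l2 : R) :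
  let D := l1 ^+ 2 + l1 * l2 + l2 ^+ 2 - l1 - l2 in
  0 < l1 -> 0 < l2 -> 0 < D -> l1 < l2 < 1 \/ 1 < l2 < l1 -> SO3 W ->
  W^T *m (l2 *: S + (1 - l2) *: tensor n) *m W = l1 *: S + (1 - l1) *: tensor n ->
  forall j r Q, 0 < r -> SO3 Q ->
  envelope_le (energy S j) (r *: (Q^T *m (l1 *: S + (1 - l1) *: tensor n) *m Q))
    (r ^+ 3 * (norm2 S ^+ 3 * (l1 ^+ 2 * l2 ^+ 2) / D)).
Proof.
move=> D l10 l20 D0 H SW E j r Q r0 SQ.
have H' : (l1 < l2 /\ l2 < 1) \/ (1 < l2 /\ l2 < l1) by case: H => /andP; [left|right].
have [th01 rho KE] := iteration_numbers (norm2 S ^+ 3) l10 l20 D0 erefl H'.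
have l1n : 1 - l1 != 0 by apply/negP => /eqP; case: H' => -[]; lra.
have l11 : l1 != 0 by rewrite gt_eqF.
have l21 : l2 != 0 by rewrite gt_eqF.
(* The iterated matrix is the one with parameter [l2]; the matrix in the goal is a rotation of
   it. *)
rewrite -E -conj_mul; apply: (envelope_le_limit (W := W) (n := n) (a := - (l2 / l1 * (1 - l1))) th01 l20 _ SW _ _ rho _ KE) => //.
- exact: divr_gt0.
- rewrite E; apply/matrixP => a b; move: (tensor n) => N; rewrite !mxE.
  by field; rewrite l1n l11 l21.
- rewrite E; apply/matrixP => a b; move: (tensor n) => N; rewrite !mxE.
  by field; rewrite l11.
- by rewrite divr_ge0 ?(ltW D0)// mulr_ge0 ?exprn_ge0 ?norm2_ge0// mulr_ge0 ?sqr_ge0.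
- exact: SO3_mul.
Qed.

(** * The case of equal parameters *)

(* When both lambdas equal l, nearby pairs (a, m) with a != m still satisfy all the
   constraints. For a given sum p = a + m these force a m = q p and
   s1 m3^2 + s3 m1^2 = sigma p, and the discriminant p^2 - 4 q p is a positive
   multiple of (p - p0) (p - p1), hence positive on one side of p0 = 2 l. *)
Section Degenerate.
Context {R : realType}.
Variables (s1 s2 s3 l t n1 n3 : R).
Hypotheses (s10 : 0 < s1) (s12 : s1 < s2) (s23 : s2 < s3) (s_1 : s1 + s2 + s3 = 1).
Hypotheses (l0 : 0 < l) (l1 : l != 1) (t0 : 0 < t) (tE : t = 1 - 2 * l * s2).
Hypotheses (E2 : t * s2 * (3 * l - 2) = s1 * s3 * l) (n_1 : n1 ^+ 2 + n3 ^+ 2 = 1).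
Hypothesis E1 : l * s1 * s3 + (1 - l) * (s1 * n3 ^+ 2 + s3 * n1 ^+ 2) = s2 * t.

Let sigma0 : s1 * n3 ^+ 2 + s3 * n1 ^+ 2 = 3 * s2 * t.
Proof.
have l1' : 1 - l != 0 by rewrite subr_eq0 eq_sym.
by apply: (mulfI l1'); move: E1 E2; move: (s1 * n3 ^+ 2 + s3 * n1 ^+ 2) => x h1 h2; lra.
Qed.

(** Equality would force (s2 - si)^2 = 0. With [sigma0] this excludes n1 = 0 and n3 = 0, for which
    the form s1 n3^2 + s3 n1^2 would equal s1 or s3. *)
Let sigma_neq (si sk : R) : 0 < si -> si + s2 + sk = 1 -> s1 * s3 = si * sk -> si != s2 -> 3 * s2 * t != si.
Proof.
move=> si0 ssum sE sne; apply/eqP => H.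
have h : 4 * s2 ^+ 2 = (3 * s2 - si) * (si + s2).
  have h1 : 3 * l - 2 = 3 * (sk * l).
    apply: (mulfI (lt0r_neq0 si0)).
    have e1 : si * (3 * l - 2) = 3 * (t * s2 * (3 * l - 2)) by rewrite -H; ring.
    by rewrite e1 E2 sE; ring.
  have h2 : l * (si + s2) = 2 / 3 by rewrite (_ : si + s2 = 1 - sk); lra.
  have h3 : 3 * s2 - si = 6 * l * s2 ^+ 2 by rewrite -H tE; ring.
  have -> : (3 * s2 - si) * (si + s2) = 6 * s2 ^+ 2 * (l * (si + s2)) by rewrite h3; ring.
  by rewrite h2; field.
have : (s2 - si) ^+ 2 = 0 by lra.
by move/eqP; rewrite sqrf_eq0 subr_eq0 eq_sym (negbTE sne).
Qed.

Let p0 : R := 2 * l.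
Let Dn (p : R) := s1 * s3 + s2 * (1 - s2 * p).
(** The two equations [block_det] for (a, m) and (m, a) are linear in s1 m3^2 + s3 m1^2. Eliminating
    that form and dividing by a - m gives [q]; subtracting the equations and dividing by a - m gives
    [sigma]. *)
Let q (p : R) := s2 * (1 - s2 * p) * (p ^+ 2 - p) / Dn p.
Let sigma (p : R) := (s2 + p * (s1 * s3 - s2 ^+ 2)) / (p - 1).
Let h (p : R) := - (3 * s2 ^+ 2 * p ^+ 2) + p * (3 * s2 + 4 * s2 ^+ 2 - s1 * s3) - 4 * s2.

Let s20 : 0 < s2 := lt_trans s10 s12.
Let s30 : 0 < s3 := lt_trans s20 s23.

Let l23 : 0 < 3 * l - 2.
Proof.
have : 0 < t * s2 * (3 * l - 2) by rewrite E2 !mulr_gt0.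
by rewrite pmulr_rgt0// mulr_gt0.
Qed.

Let Dn0 : Dn p0 = s1 * s3 + s2 * t. Proof. by rewrite /Dn /p0 tE; ring. Qed.
Let Dn0_gt0 : 0 < Dn p0. Proof. by rewrite Dn0 addr_gt0// mulr_gt0. Qed.

Let q0 : q p0 = l ^+ 2.
Proof.
have d : Dn p0 != 0 by rewrite gt_eqF.
apply: (mulIf d); rewrite divfK// Dn0 /p0.
have -> : s2 * (1 - s2 * (2 * l)) = s2 * t by rewrite tE; ring.
have -> : l ^+ 2 * (s1 * s3 + s2 * t) = l * (s1 * s3 * l) + l ^+ 2 * (s2 * t) by ring.
by rewrite -E2; ring.
Qed.

Let h0 : h p0 = 0.
Proof.
have -> : h p0 = 2 * (t * s2 * (3 * l - 2) - s1 * s3 * l) by rewrite /h /p0 tE; ring.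
by rewrite E2 subrr mulr0.
Qed.

Let sigma_p0 : sigma p0 = 3 * s2 * t.
Proof.
have d : p0 - 1 != 0.
  apply: lt0r_neq0; rewrite /p0; have aux (x : R) : 0 < 3 * x - 2 -> 0 < 2 * x - 1 by move=> ?; lra.
 exact: aux.
apply: (mulIf d); rewrite divfK// /p0.
have -> : s2 + 2 * l * (s1 * s3 - s2 ^+ 2) = s2 * t + 2 * (s1 * s3 * l) - 0 by rewrite tE; ring.
by rewrite -E2; ring.
Qed.

(** The other root of [h]: by Vieta the product of the roots is 4 / (3 s2). *)
Let p1 := 4 / (3 * s2 * p0).

Let hE p : h p = - (3 * s2 ^+ 2 * (p - p0) * (p - p1)).
Proof.
have l_0 : l != 0 by rewrite gt_eqF.
have s_0 : s2 != 0 by rewrite gt_eqF.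
have c : 3 * s2 + 4 * s2 ^+ 2 - s1 * s3 = (3 * s2 ^+ 2 * p0 ^+ 2 + 4 * s2) / p0.
  have d : p0 != 0 by rewrite mulf_neq0// pnatr_eq0.
  apply: (mulIf d); rewrite divfK//; move: h0; rewrite /h; lra.
by rewrite /h c /p1 /p0; field; rewrite l_0 s_0.
Qed.

Let deltaE p : 0 < Dn p -> p ^+ 2 - 4 * q p = - (p * h p) / Dn p.
Proof.
by move=> d; rewrite /q /h; move: (d); rewrite /Dn => d'; field; rewrite -/(Dn p) gt_eqF.
Qed.

Definition pair_quadric (a m : R) := a ^+ 2 + a * m + m ^+ 2 - a - m.

Let n1_neq0 : n1 != 0.
Proof.
apply/eqP => z; have : 3 * s2 * t != s1 by apply: (@sigma_neq _ s3) => //; rewrite lt_eqF.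
by rewrite -sigma0; move: n_1; rewrite z expr0n add0r mulr0 addr0 => ->; rewrite mulr1 eqxx.
Qed.

Let n3_neq0 : n3 != 0.
Proof.
apply/eqP => z; have : 3 * s2 * t != s3.
  by apply: (@sigma_neq _ s1) => //; [rewrite -s_1; ring|rewrite mulrC|rewrite gt_eqF].
by rewrite -sigma0; move: n_1; rewrite z expr0n addr0 mulr0 add0r => ->; rewrite mulr1 eqxx.
Qed.

(** The side from which p approaches p0 with (p - p0) (p - p1) > 0; a double root is covered too. *)
Let sg : R := if p0 <= p1 then -1 else 1.
Let pk (k : nat) : R := p0 + sg * harmonic k.
(** Selects which root of the quadratic is a and which is m, so that m lies between a and 1. *)
Let ep : R := if l < 1 then 1 else -1.
Let dk k := pk k ^+ 2 - 4 * q (pk k).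
Let ak k := (pk k - ep * Num.sqrt (dk k)) / 2.
Let mk k := (pk k + ep * Num.sqrt (dk k)) / 2.
(** Solving m1^2 + m3^2 = 1 and s1 m3^2 + s3 m1^2 = sigma determines both squares; [w1] and [w3] are
    their ratios to n1^2 and n3^2. Rescaling n1 and n3, rather than taking roots of the squares,
    preserves signs in the limit. *)
Let w1 k := (sigma (pk k) - s1) / ((s3 - s1) * n1 ^+ 2).
Let w3 k := (s3 - sigma (pk k)) / ((s3 - s1) * n3 ^+ 2).
Let m1 k := n1 * Num.sqrt (w1 k).
Let m3 k := n3 * Num.sqrt (w3 k).

Let pk_cvg : pk k @[k --> \oo] --> p0.
Proof.
rewrite -[X in _ --> X]addr0 -[X in _ + X](mulr0 sg); apply: cvgD; first exact: cvg_cst.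
by apply: cvgM; [exact: cvg_cst|exact: cvg_harmonic].
Qed.

Let Dn_cvg : Dn (pk k) @[k --> \oo] --> Dn p0.
Proof.
apply: cvgD; first exact: cvg_cst.
apply: cvgM; first exact: cvg_cst.
apply: cvgB; first exact: cvg_cst.
by apply: cvgM; first exact: cvg_cst.
Qed.

Let q_cvg : q (pk k) @[k --> \oo] --> l ^+ 2.
Proof.
rewrite -q0; apply: cvgM; last by apply: cvgV; [rewrite gt_eqF|exact: Dn_cvg].
apply: cvgM; last by apply: cvgB => //; exact: (cvgM pk_cvg pk_cvg).
apply: cvgM; first exact: cvg_cst.
apply: cvgB; first exact: cvg_cst.
by apply: cvgM; first exact: cvg_cst.
Qed.

Let p01 : 0 < p0 - 1.
Proof.
rewrite /p0; have aux (x : R) : 0 < 3 * x - 2 -> 0 < 2 * x - 1 by move=> ?; lra.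
exact: aux.
Qed.

Let sigma_cvg : sigma (pk k) @[k --> \oo] --> s1 * n3 ^+ 2 + s3 * n1 ^+ 2.
Proof.
rewrite sigma0 -sigma_p0; apply: cvgM; last first.
  by apply: cvgV; [rewrite gt_eqF|apply: cvgB => //; exact: cvg_cst].
apply: cvgD; first exact: cvg_cst.
by apply: cvgM => //; exact: cvg_cst.
Qed.

Let dk_cvg : dk k @[k --> \oo] --> 0.
Proof.
have -> : 0 = p0 ^+ 2 - 4 * l ^+ 2 :> R by rewrite /p0; ring.
apply: cvgB; first exact: (cvgM pk_cvg pk_cvg).
by apply: cvgM => //; exact: cvg_cst.
Qed.

Let sdk_cvg : ep * Num.sqrt (dk k) @[k --> \oo] --> 0.
Proof.
rewrite -(mulr0 ep); apply: cvgM; first exact: cvg_cst.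
rewrite -[X in _ --> X](@sqrtr0 R); apply: continuous_cvg => //; exact: sqrt_continuous.
Qed.

Let ak_cvg : ak k @[k --> \oo] --> l.
Proof.
have -> : l = (p0 - 0) / 2 by rewrite /p0; field.
by apply: cvgM; [exact: cvgB|exact: cvg_cst].
Qed.

Let mk_cvg : mk k @[k --> \oo] --> l.
Proof.
have -> : l = (p0 + 0) / 2 by rewrite /p0; field.
by apply: cvgM; [exact: cvgD|exact: cvg_cst].
Qed.

Let s31 : 0 < s3 - s1. Proof. by rewrite subr_gt0 (lt_trans s12). Qed.

Let w1_cvg : w1 k @[k --> \oo] --> (1 : R).
Proof.
have d : (s3 - s1) * n1 ^+ 2 != 0 by rewrite mulf_neq0 ?expf_neq0// gt_eqF.
have -> : 1 = (s1 * n3 ^+ 2 + s3 * n1 ^+ 2 - s1) / ((s3 - s1) * n1 ^+ 2).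
  apply: (mulIf d); rewrite divfK// mul1r (_ : n3 ^+ 2 = 1 - n1 ^+ 2); [ring|rewrite -n_1; ring].
by apply: cvgM; [apply: cvgB => //; exact: cvg_cst|exact: cvg_cst].
Qed.

Let w3_cvg : w3 k @[k --> \oo] --> (1 : R).
Proof.
have d : (s3 - s1) * n3 ^+ 2 != 0 by rewrite mulf_neq0 ?expf_neq0// gt_eqF.
have -> : 1 = (s3 - (s1 * n3 ^+ 2 + s3 * n1 ^+ 2)) / ((s3 - s1) * n3 ^+ 2).
  apply: (mulIf d); rewrite divfK// mul1r (_ : n1 ^+ 2 = 1 - n3 ^+ 2); [ring|by rewrite -n_1 addrK].
by apply: cvgM; [apply: cvgB => //; exact: cvg_cst|exact: cvg_cst].
Qed.

Let m1_cvg : m1 k @[k --> \oo] --> n1.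
Proof.
rewrite -[X in _ --> X]mulr1; apply: cvgM; first exact: cvg_cst.
rewrite -[X in _ --> X](@sqrtr1 R); apply: continuous_cvg => //; exact: sqrt_continuous.
Qed.

Let m3_cvg : m3 k @[k --> \oo] --> n3.
Proof.
rewrite -[X in _ --> X]mulr1; apply: cvgM; first exact: cvg_cst.
rewrite -[X in _ --> X](@sqrtr1 R); apply: continuous_cvg => //; exact: sqrt_continuous.
Qed.
(** On the left is the determinant of the block of a S + (1 - a) x (x) x in coordinates 1 and 3, for
    x = (x1, 0, x3) of norm one. With the trace it says that the eigenvalues are a s2, m s2 and 1 -
    s2 (a + m), a set symmetric in a and m. *)
Definition block_det (a m x3 x1 : R) := a * (a * (s1 * s3) + (1 - a) * (s1 * x3 ^+ 2 + s3 * x1 ^+ 2)) = m * s2 * (1 - s2 * (a + m)).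

Let block_detP (a m x1 x3 : R) : 0 < Dn (a + m) -> a + m - 1 != 0 -> a * m = q (a + m) ->
  s1 * x3 ^+ 2 + s3 * x1 ^+ 2 = sigma (a + m) -> block_det a m x3 x1.
Proof.
move=> D0 pn qE sE; rewrite /block_det sE.
have H : s2 * (1 - s2 * (a + m)) * ((a + m) ^+ 2 - (a + m) - a * m) = s1 * s3 * (a * m).
  have Dn_n : Dn (a + m) != 0 by rewrite gt_eqF.
  have : a * m * Dn (a + m) = s2 * (1 - s2 * (a + m)) * ((a + m) ^+ 2 - (a + m)).
    by rewrite {1}qE /q divfK.
  by rewrite /Dn; move: (s2 * (1 - s2 * (a + m))) => y e; lra.
have sE' : sigma (a + m) * (a + m - 1) = s2 + (a + m) * (s1 * s3 - s2 ^+ 2) by rewrite divfK.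
apply: (mulIf pn); apply/eqP; rewrite -subr_eq0; apply/eqP.
transitivity (a * (1 - a) * (sigma (a + m) * (a + m - 1) - (s2 + (a + m) * (s1 * s3 - s2 ^+ 2))) +
  (s1 * s3 * (a * m) - s2 * (1 - s2 * (a + m)) * ((a + m) ^+ 2 - (a + m) - a * m))).
  by move: (sigma _) => x; ring.
by rewrite sE' H !subrr mulr0 add0r.
Qed.

Let near_gt (f : nat -> R) (x y : R) : f k @[k --> \oo] --> x -> y < x -> \forall k \near \oo, y < f k.
Proof. by move=> fx yx; exact: (cvgr_gt _ fx). Qed.

Let near_lt (f : nat -> R) (x y : R) : f k @[k --> \oo] --> x -> x < y -> \forall k \near \oo, f k < y.
Proof. by move=> fx yx; exact: (cvgr_lt _ fx). Qed.

Let pair_quadric_cvg : pair_quadric (ak k) (mk k) @[k --> \oo] --> pair_quadric l l.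
Proof.
apply: cvgB => //; apply: cvgB => //; apply: cvgD; last exact: (cvgM mk_cvg mk_cvg).
by apply: cvgD; [exact: (cvgM ak_cvg ak_cvg)|exact: cvgM].
Qed.

Let pair_quadric0 : 0 < pair_quadric l l.
Proof.
have -> : pair_quadric l l = l * (3 * l - 2) by rewrite /pair_quadric; ring.
by rewrite mulr_gt0.
Qed.

Let bound_cvg : ak k ^+ 2 * mk k ^+ 2 / pair_quadric (ak k) (mk k) @[k --> \oo] --> l ^+ 2 * l ^+ 2 / pair_quadric l l.
Proof.
apply: cvgM; last by apply: cvgV => //; rewrite gt_eqF.
by apply: cvgM; [exact: (cvgM ak_cvg ak_cvg)|exact: (cvgM mk_cvg mk_cvg)].
Qed.

Let dk_gt0 : \forall k \near \oo, 0 < dk k.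
Proof.
have D0 := near_gt Dn_cvg Dn0_gt0.
have pk0 : \forall k \near \oo, 0 < pk k by apply: near_gt pk_cvg _; rewrite /p0 mulr_gt0.
near=> k.
have hk : 0 < harmonic k :> R by rewrite /harmonic/= invr_gt0.
have Dk : 0 < Dn (pk k) by near: k.
rewrite /dk deltaE// divr_gt0// hE mulrN opprK mulr_gt0//; first by near: k.
have -> : 3 * s2 ^+ 2 * (pk k - p0) * (pk k - p1) = 3 * s2 ^+ 2 * ((pk k - p0) * (pk k - p1)) by ring.
rewrite pmulr_rgt0; last by rewrite mulr_gt0// exprn_gt0.
rewrite /pk /sg; case: ifPn => [hp|/negbTE hp].
  by rewrite -mulrNN mulr_gt0//; lra.
by rewrite mulr_gt0//; move/negbT: hp; rewrite -ltNge => hp; lra.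
Unshelve. all: by end_near. Qed.

Let ordered : \forall k \near \oo, ak k < mk k < 1 \/ 1 < mk k < ak k.
Proof.
have := dk_gt0; have [l_1|l_1|l_1] := ltgtP l 1; last by move: l1; rewrite l_1 eqxx.
- have H := near_lt mk_cvg l_1; apply: filterS2 H => k mk1 d; left; rewrite mk1 andbT.
  have : 0 < Num.sqrt (dk k) by rewrite sqrtr_gt0.
  by rewrite /ak /mk /ep l_1; lra.
- have H := near_gt mk_cvg l_1; apply: filterS2 H => k mk1 d; right; rewrite mk1/=.
  have : 0 < Num.sqrt (dk k) by rewrite sqrtr_gt0.
  have lF : (l < 1) = false by apply/negbTE; rewrite -leNgt ltW.
  by rewrite /ak /mk /ep lF; lra.
Qed.

Let close (f : nat -> R) (x eps : R) : 0 < eps -> f k @[k --> \oo] --> x -> \forall k \near \oo, `|x - f k| <= eps.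
Proof. by move=> e0 /cvgrPdist_le/(_ _ e0). Qed.

Let w1_ge0 : \forall k \near \oo, 0 < w1 k := near_gt w1_cvg ltr01.
Let w3_ge0 : \forall k \near \oo, 0 < w3 k := near_gt w3_cvg ltr01.

Let entry_cvg (x y : R) (f g : nat -> R) : f k @[k --> \oo] --> x -> g k @[k --> \oo] --> y ->
  (1 - ak k) * (f k * g k) @[k --> \oo] --> (1 - l) * (x * y).
Proof.
move=> fx gy; apply: cvgM; last exact: cvgM.
by apply: cvgB => //; exact: cvg_cst.
Qed.

Lemma degenerate_approx : exists M, forall eps, 0 < eps -> exists a m m1 m3,
  [/\ [/\ 0 < a, 0 < m, 0 < pair_quadric a m & a < m < 1 \/ 1 < m < a],
      m1 ^+ 2 + m3 ^+ 2 = 1, a ^+ 2 * m ^+ 2 / pair_quadric a m <= M,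
      block_det a m m3 m1 /\ block_det m a m3 m1
    & [/\ `|l - a| <= eps, `|(1 - l) * (n1 * n1) - (1 - a) * (m1 * m1)| <= eps,
          `|(1 - l) * (n1 * n3) - (1 - a) * (m1 * m3)| <= eps
        & `|(1 - l) * (n3 * n3) - (1 - a) * (m3 * m3)| <= eps ] ].
Proof.
(* One more than the limit of the quantity to be bounded; the limit is finite because
   [pair_quadric l l] = l (3 l - 2) is positive. *)
exists (l ^+ 2 * l ^+ 2 / pair_quadric l l + 1) => eps e0.
near \oo => k; exists (ak k), (mk k), (m1 k), (m3 k).
have d0 : 0 < dk k by near: k; exact: dk_gt0.
have w10 : 0 < w1 k by near: k; exact: w1_ge0.
have w30 : 0 < w3 k by near: k; exact: w3_ge0.
have D0 : 0 < Dn (pk k) by near: k; exact: near_gt Dn_cvg Dn0_gt0.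
have ep2 : ep ^+ 2 = 1 by rewrite /ep; case: ifP; rewrite ?sqrrN expr1n.
have amp : ak k + mk k = pk k by rewrite /ak /mk; field.
have amq : ak k * mk k = q (pk k).
  have -> : ak k * mk k = (pk k ^+ 2 - ep ^+ 2 * Num.sqrt (dk k) ^+ 2) / 4 by rewrite /ak /mk; field.
  by rewrite ep2 mul1r sqr_sqrtr ?(ltW d0)// /dk; field.
have pn : pk k - 1 != 0.
  apply: lt0r_neq0; rewrite subr_gt0; near: k; apply: near_gt pk_cvg _.
  by rewrite -subr_gt0.
have m1E : m1 k ^+ 2 = (sigma (pk k) - s1) / (s3 - s1).
  rewrite exprMn sqr_sqrtr ?(ltW w10)// /w1; field.
  by rewrite n1_neq0 gt_eqF.
have m3E : m3 k ^+ 2 = (s3 - sigma (pk k)) / (s3 - s1).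
  rewrite exprMn sqr_sqrtr ?(ltW w30)// /w3; field.
  by rewrite n3_neq0 gt_eqF.
have s31n : s3 - s1 != 0 by rewrite gt_eqF.
have sE : s1 * m3 k ^+ 2 + s3 * m1 k ^+ 2 = sigma (pk k).
  by rewrite m1E m3E; move: (sigma _) => x; field.
split.
- split; last 1 first.
  + by near: k; exact: ordered.
  + by near: k; exact: near_gt ak_cvg l0.
  + by near: k; exact: near_gt mk_cvg l0.
  + by near: k; exact: near_gt pair_quadric_cvg pair_quadric0.
- by rewrite m1E m3E; move: (sigma _) => x; field.
- apply: ltW; near: k; apply: near_lt bound_cvg _; by rewrite ltrDl.
- have amp' : mk k + ak k = pk k by rewrite addrC.
  by split; apply: block_detP; rewrite ?amp ?amp' ?amq// mulrC.
- split; near: k.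
  + exact: close ak_cvg.
  + by apply: close => //; exact: entry_cvg.
  + by apply: close => //; exact: entry_cvg.
  + by apply: close => //; exact: entry_cvg.
Unshelve. all: by end_near. Qed.
End Degenerate.

(** * Explicit matrices and their diagonalisation *)

Section Mx3.
Context {R : realType}.

Definition mx3 (a b c d e f g h i : R) : 'M[R]_3 :=
  \matrix_(r, s) nth 0 (nth [::] [:: [:: a; b; c]; [:: d; e; f]; [:: g; h; i]] r) s.

Lemma mx3P (M N : 'M[R]_3) : M 0 0 = N 0 0 -> M 0 1 = N 0 1 -> M 0 2 = N 0 2 ->
  M 1 0 = N 1 0 -> M 1 1 = N 1 1 -> M 1 2 = N 1 2 ->
  M 2 0 = N 2 0 -> M 2 1 = N 2 1 -> M 2 2 = N 2 2 -> M = N.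
Proof.
move=> *; apply/matrixP => i j.
by case: (I3P i) => ->; case: (I3P j) => ->.
Qed.

Lemma mx3_mul a b c d e f g h i a' b' c' d' e' f' g' h' i' :
  mx3 a b c d e f g h i *m mx3 a' b' c' d' e' f' g' h' i' =
  mx3 (a * a' + b * d' + c * g') (a * b' + b * e' + c * h') (a * c' + b * f' + c * i')
      (d * a' + e * d' + f * g') (d * b' + e * e' + f * h') (d * c' + e * f' + f * i')
      (g * a' + h * d' + i * g') (g * b' + h * e' + i * h') (g * c' + h * f' + i * i').
Proof. by apply: mx3P; rewrite !mxE !big_ord_recl big_ord0 !mxE /= addr0 addrA. Qed.

Lemma mx3_tr a b c d e f g h i :
  (mx3 a b c d e f g h i)^T = mx3 a d g b e h c f i.
Proof. by apply: mx3P; rewrite !mxE. Qed.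

Lemma mx3D a b c d e f g h i a' b' c' d' e' f' g' h' i' :
  mx3 a b c d e f g h i + mx3 a' b' c' d' e' f' g' h' i' =
  mx3 (a + a') (b + b') (c + c') (d + d') (e + e') (f + f') (g + g') (h + h') (i + i').
Proof. by apply: mx3P; rewrite !mxE. Qed.

Lemma mx3Z k a b c d e f g h i :
  k *: mx3 a b c d e f g h i =
  mx3 (k * a) (k * b) (k * c) (k * d) (k * e) (k * f) (k * g) (k * h) (k * i).
Proof. by apply: mx3P; rewrite !mxE. Qed.

Lemma diag3E a b c : diag3 a b c = mx3 a 0 0 0 b 0 0 0 c.
Proof. by apply: mx3P; rewrite !mxE. Qed.

Lemma tensorE (n : 'cV[R]_3) (x := n 0 0) (y := n 1 0) (z := n 2 0) :
  tensor n = mx3 (x * x) (x * y) (x * z) (y * x) (y * y) (y * z) (z * x) (z * y) (z * z).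
Proof. by apply: mx3P; rewrite !mxE big_ord1 !mxE. Qed.

Lemma mx3_1 : 1%:M = mx3 1 0 0 0 1 0 0 0 1.
Proof. by apply: mx3P; rewrite !mxE. Qed.

Lemma det_mx2 (M : 'M[R]_2) : \det M = M 0 0 * M 1 1 - M 0 1 * M 1 0.
Proof.
rewrite (expand_det_row _ 0) !big_ord_recl big_ord0 /cofactor !det_mx11 !mxE /=.
rewrite expr0 expr1 !mul1r mulN1r mulrN addr0.
by congr (M _ _ * M _ _ - M _ _ * M _ _); exact: val_inj.
Qed.

Lemma det_mx3 a b c d e f g h i : \det (mx3 a b c d e f g h i) =
  a * (e * i - f * h) - b * (d * i - f * g) + c * (d * h - e * g).
Proof.
rewrite (expand_det_row _ 0) !big_ord_recl big_ord0 /cofactor !det_mx2 !mxE /=.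
ring.
Qed.

Lemma trace_mx3 a b c d e f g h i : \tr (mx3 a b c d e f g h i) = a + e + i.
Proof. by rewrite /mxtrace !big_ord_recl big_ord0 !mxE /= addr0 addrA. Qed.

(** The hypotheses make x and y the eigenvalues of the block in coordinates 1 and 3; a unit
    eigenvector (u, v) for x gives a rotation of that plane. *)
Lemma diagonalize_block (a b c d x y : R) : x + y = a + c -> x * y = a * c - b ^+ 2 ->
  exists2 Q, SO3 Q & Q^T *m mx3 a 0 b 0 d 0 b 0 c *m Q = diag3 x d y.
Proof.
move=> sxy pxy.
have yE : y = a + c - x by rewrite -sxy; ring.
have key : (x - a) * (x - c) = b ^+ 2.
  have -> : b ^+ 2 = a * c - x * y by rewrite pxy; ring.
  by rewrite yE; ring.
(* For b nonzero, (b, x - a) is an eigenvector; for b = 0, x is one of the diagonal entries and a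
   basis vector serves. *)
have [u [v [uv e1 e2]]] : exists u v, [/\ u ^+ 2 + v ^+ 2 = 1, a * u + b * v = x * u & b * u + c * v = x * v].
  have [b0|bn] := eqVneq b 0.
    move/eqP: key; rewrite b0 expr0n mulf_eq0 !subr_eq0 => /orP[/eqP ->|/eqP ->].
      by exists 1, 0; split; ring.
    by exists 0, 1; split; ring.
  pose N := Num.sqrt (b ^+ 2 + (x - a) ^+ 2).
  have N2 : N ^+ 2 = b ^+ 2 + (x - a) ^+ 2 by rewrite sqr_sqrtr// addr_ge0// sqr_ge0.
  have N0 : N != 0.
    by rewrite -sqrf_eq0 N2 paddr_eq0 ?sqr_ge0// sqrf_eq0 (negbTE bn).
  exists (b / N), ((x - a) / N); split.
  - by rewrite !expr_div_n -mulrDl -N2 divff// sqrf_eq0.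
  - by field.
  - transitivity ((b ^+ 2 + c * (x - a)) / N); first by field.
    by rewrite -key; field.
exists (mx3 u 0 (- v) 0 1 0 v 0 u).
  split; first by rewrite mx3_tr mx3_mul mx3_1; congr mx3; try ring; rewrite -uv; ring.
  by rewrite det_mx3 -[RHS]uv; ring.
rewrite mx3_tr !mx3_mul diag3E.
have f1 : u * (a * u + b * v) + v * (b * u + c * v) = x by rewrite e1 e2 -[RHS]mulr1 -uv; ring.
have f2 : u * (b * u + c * v) - v * (a * u + b * v) = 0 by rewrite e1 e2; ring.
have f3 : u * (c * u - b * v) - v * (b * u - a * v) = y.
  transitivity ((a + c) * (u ^+ 2 + v ^+ 2) - (u * (a * u + b * v) + v * (b * u + c * v))); first by ring.
  by rewrite uv f1 mulr1 yE.
congr mx3; try ring.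
- by rewrite -f1; ring.
- by rewrite -[RHS]f2; ring.
- by rewrite -[RHS]f2; ring.
- by rewrite -f3; ring.
Qed.

Lemma swap_diag3 (x y z : R) : exists2 P, SO3 P & P^T *m diag3 x y z *m P = diag3 y x z.
Proof.
exists (mx3 0 1 0 (-1) 0 0 0 0 1).
  split; first by rewrite mx3_tr mx3_mul mx3_1; congr mx3; ring.
  by rewrite det_mx3; ring.
by rewrite mx3_tr !diag3E !mx3_mul; congr mx3; ring.
Qed.

(** A diagonal entry of the rotated matrix is an average of x, y, z, weighted by the squares of a
    column of [P]. *)
Lemma diag3_conj_bound (P : 'M[R]_3) (x y z lo hi : R) i : SO3 P ->
  lo <= x <= hi -> lo <= y <= hi -> lo <= z <= hi ->
  lo <= (P^T *m diag3 x y z *m P) i i <= hi.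
Proof.
move=> [SP _] /andP[x0 x1] /andP[y0 y1] /andP[z0 z1].
have := congr1 (fun M : 'M[R]_3 => M i i) SP.
rewrite /diag3 mul_mx_diag !mxE eqxx !big_ord_recl !big_ord0 !mxE /= => e.
move: (P ord0 i) (P (lift ord0 ord0) i) (P (lift ord0 (lift ord0 ord0)) i) e => p q r e.
have pos (k u v w : R) : 0 <= u -> 0 <= v -> 0 <= w -> k = p ^+ 2 * u + q ^+ 2 * v + r ^+ 2 * w -> 0 <= k.
  by move=> u0 v0 w0 ->; rewrite !addr_ge0// mulr_ge0// sqr_ge0.
apply/andP; split; rewrite -subr_ge0.
  apply: (@pos _ (x - lo) (y - lo) (z - lo)); rewrite ?subr_ge0//.
  by rewrite -[X in _ - X]mulr1 -[X in _ - _ * X]e; ring.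
apply: (@pos _ (hi - x) (hi - y) (hi - z)); rewrite ?subr_ge0//.
by rewrite -[X in X - _]mulr1 -[X in _ * X - _]e; ring.
Qed.

(** The product hypothesis makes l s2 an eigenvalue. Subtracting it leaves l diag(s1 - s2, 0, s3 -
    s2) + (1 - l) n (x) n, whose determinant is a nonzero multiple of the square of the second entry
    of [n]. *)
Lemma rank_one_middle (s1 s2 s3 l : R) (n : 'cV[R]_3) (x y z : R) (Q : 'M[R]_3) :
  s1 < s2 -> s2 < s3 -> l != 0 -> l != 1 -> SO3 Q ->
  (x - l * s2) * (y - l * s2) * (z - l * s2) = 0 ->
  Q^T *m diag3 x y z *m Q = l *: diag3 s1 s2 s3 + (1 - l) *: tensor n ->
  n 1 0 = 0.
Proof.
move=> s12 s23 ln0 ln1 SQ lE QE.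
have : \det (Q^T *m diag3 x y z *m Q + (- (l * s2)) *: 1%:M) = 0.
  have -> : Q^T *m diag3 x y z *m Q + (- (l * s2)) *: 1%:M = Q^T *m (diag3 x y z + (- (l * s2)) *: 1%:M) *m Q.
    by rewrite conjD conjZ mulmx1 SO3_trmx_mul.
  rewrite !det_mulmx det_tr; case: SQ => _ ->; rewrite mul1r mulr1.
  by rewrite diag3E mx3_1 !mx3Z mx3D det_mx3 -[RHS]lE; ring.
rewrite QE diag3E tensorE mx3_1 !mx3Z !mx3D det_mx3 => h.
have : l ^+ 2 * (1 - l) * (s1 - s2) * (s3 - s2) * (n 1 0) ^+ 2 = 0 by rewrite -h; ring.
move/eqP; rewrite mulf_eq0 sqrf_eq0 => /orP[|/eqP//].
rewrite !mulf_eq0 (negbTE ln0)/= !subr_eq0 [1 == l]eq_sym (negbTE ln1)/=.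
by rewrite (lt_eqF s12) (gt_eqF s23).
Qed.

End Mx3.

Section DegenerateMatrix.
Context {R : realType}.

Definition middle_free (x z : R) : 'cV[R]_3 := \col_i [:: x; 0; z]`_i.

Lemma rank_one_blockE (s1 s2 s3 l x z : R) :
  l *: diag3 s1 s2 s3 + (1 - l) *: tensor (middle_free x z) =
  mx3 (l * s1 + (1 - l) * (x * x)) 0 ((1 - l) * (x * z)) 0 (l * s2) 0
      ((1 - l) * (x * z)) 0 (l * s3 + (1 - l) * (z * z)).
Proof. by rewrite diag3E tensorE !mx3Z mx3D !mxE/=; congr mx3; ring. Qed.

Lemma middle_freeE (n : 'cV[R]_3) : n 1 0 = 0 -> n = middle_free (n 0 0) (n 2 0).
Proof.
by move=> n0; apply/matrixP => i j; rewrite (ord1 j); case: (I3P i) => ->; rewrite !mxE//=.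
Qed.

Lemma diagonalize_rank_one (s1 s2 s3 a m x z : R) : s1 + s2 + s3 = 1 ->
  x ^+ 2 + z ^+ 2 = 1 -> block_det s1 s2 s3 a m z x ->
  exists2 P, SO3 P & P^T *m (a *: diag3 s1 s2 s3 + (1 - a) *: tensor (middle_free x z)) *m P =
    diag3 (m * s2) (a * s2) (1 - s2 * (a + m)).
Proof.
move=> ss xz bd; rewrite rank_one_blockE; apply: diagonalize_block.
  have -> : a * s1 + (1 - a) * (x * x) + (a * s3 + (1 - a) * (z * z)) =
    a * (s1 + s2 + s3) - a * s2 + (1 - a) * (x ^+ 2 + z ^+ 2) by ring.
  by rewrite ss xz; ring.
by rewrite -bd; ring.
Qed.

(** Both matrices are diagonalised by rotations to the same eigenvalues, the first two exchanged. *)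
Lemma rank_one_conjugate (s1 s2 s3 a m x z : R) : s1 + s2 + s3 = 1 ->
  x ^+ 2 + z ^+ 2 = 1 -> block_det s1 s2 s3 a m z x -> block_det s1 s2 s3 m a z x ->
  exists2 W, SO3 W &
    W^T *m (m *: diag3 s1 s2 s3 + (1 - m) *: tensor (middle_free x z)) *m W =
    a *: diag3 s1 s2 s3 + (1 - a) *: tensor (middle_free x z).
Proof.
move=> ss xz bd1 bd2.
have [P1 SP1 E1] := diagonalize_rank_one ss xz bd1.
have [P2 SP2 E2] := diagonalize_rank_one ss xz bd2.
have [P SP E] := swap_diag3 (a * s2) (m * s2) (1 - s2 * (a + m)).
exists (P2 *m P *m P1^T); first by apply: SO3_mul; [exact: SO3_mul|exact: SO3_tr].
rewrite !conj_mul E2 [m + a]addrC E -E1 -conj_mul.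
by rewrite SO3_mul_trmx// trmx1 mul1mx mulmx1.
Qed.

(** The approximating pair varies with j, but its envelope bound does not; passing back to the limit
    matrix only costs the constants 4 and 5 of [envelope_leD]. *)
Lemma envelope_le_degenerate (s1 s2 s3 l t : R) (n : 'cV[R]_3) (S := diag3 s1 s2 s3) :
  0 < s1 -> s1 < s2 -> s2 < s3 -> s1 + s2 + s3 = 1 -> 0 < l -> l != 1 -> 0 < t ->
  t = 1 - 2 * l * s2 -> t * s2 * (3 * l - 2) = s1 * s3 * l ->
  n 1 0 = 0 -> n 0 0 ^+ 2 + n 2 0 ^+ 2 = 1 ->
  l * s1 * s3 + (1 - l) * (s1 * n 2 0 ^+ 2 + s3 * n 0 0 ^+ 2) = s2 * t ->
  forall r, 0 < r -> exists C, forall j Q, SO3 Q ->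
    envelope_le (energy S j) (r *: (Q^T *m (l *: S + (1 - l) *: tensor n) *m Q)) C.
Proof.
move=> s10 s12 s23 ss l0 l1 t0 tE E2 n0 n1 E1 r r0.
have [M HM] := degenerate_approx s10 s12 s23 ss l0 l1 t0 tE E2 n1 E1.
exists (4 * (r ^+ 3 * (norm2 S ^+ 3 * M)) + 5) => j Q SQ.
(* Entries within twice this tolerance give a norm of at most six times it, and r (j + 1) times that
   norm must not exceed 1. *)
have e0 : 0 < (6 * r * j.+1%:R)^-1 by rewrite invr_gt0 !mulr_gt0.
have [a [m [m1 [m3 [[a0 m0 D0 ord] m11 DM [bd1 bd2] [c1 c2 c3 c4]]]]]] := HM _ e0.
have [W SW WE] := rank_one_conjugate ss m11 bd1 bd2.
have H := envelope_le_pair a0 m0 D0 ord SW WE j r0 SQ.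
have {}H : envelope_le (energy S j) (r *: (Q^T *m (a *: S + (1 - a) *: tensor (middle_free m1 m3)) *m Q))
    (r ^+ 3 * (norm2 S ^+ 3 * M)).
  apply: envelope_leW H; rewrite ler_wpM2l ?exprn_ge0 ?(ltW r0)// -mulrA.
  by rewrite ler_wpM2l ?exprn_ge0 ?norm2_ge0.
set B := l *: S + _; set B' := a *: S + _ in H.
have -> : r *: (Q^T *m B *m Q) = r *: (Q^T *m B' *m Q) + r *: (Q^T *m (B - B') *m Q).
  by rewrite -scalerDr -conjD addrC subrK.
apply: envelope_leD H; rewrite norm2Z norm2_conj// gtr0_norm//.
have s30 : 0 < s3 by lra.
have sb s : 0 < s < 1 -> `|l * s - a * s| <= (6 * r * j.+1%:R)^-1.
  move=> /andP[sp s1']; rewrite -mulrBl normrM (gtr0_norm sp).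
  by apply: le_trans c1; rewrite ler_piMr// ltW.
have B12 : norm2 (B - B') <= 3 * (2 * (6 * r * j.+1%:R)^-1).
  apply: norm2_le => [|i k]; first by rewrite mulr_ge0// ltW.
  have tri (x y x' y' : R) : `|x - x'| <= (6 * r * j.+1%:R)^-1 -> `|y - y'| <= (6 * r * j.+1%:R)^-1 ->
      `|x + y - (x' + y')| <= 2 * (6 * r * j.+1%:R)^-1.
    by move=> h1 h2; rewrite opprD addrACA mulr_natl mulr2n; apply: le_trans (ler_normD _ _) (lerD h1 h2).
  have w (x : R) : x <= (6 * r * j.+1%:R)^-1 -> x <= 2 * (6 * r * j.+1%:R)^-1.
    by move=> h; apply: le_trans h _; rewrite ler_peMl ?ler1n// ltW.
  rewrite /B /B' /S [in X in X - _](middle_freeE n0) !rank_one_blockE.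
  have b1 : 0 < s1 < 1 by rewrite s10/=; lra.
  have b2 : 0 < s2 < 1 by apply/andP; split; lra.
  have b3 : 0 < s3 < 1 by rewrite s30/=; lra.
  by case: (I3P i) => ->; case: (I3P k) => ->; rewrite !mxE/= ?subrr ?normr0;
     do ?[exact: w (sb _ b2)|exact: w c3|exact: tri (sb _ b1) c2|exact: tri (sb _ b3) c4|rewrite mulr_ge0// ltW].
apply: (@le_trans _ _ (j.+1%:R * (r * (3 * (2 * (6 * r * j.+1%:R)^-1))))).
  by rewrite !ler_pM2l.
rewrite le_eqVlt; apply/orP; left; apply/eqP; field.
by rewrite (gt_eqF r0) /= nat1r pnatr_eq0.
Qed.
End DegenerateMatrix.

(** * Conditions (a) and (b), and the assembly of the proof *)

Section Conditions.
Context {R : realType}.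
Variables (s1 s2 s3 t1 t2 t3 : R).
Hypotheses (s10 : 0 < s1) (s12 : s1 < s2) (s23 : s2 < s3).
Let S := diag3 s1 s2 s3.
Let T := diag3 t1 t2 t3.
Hypothesis T_S : T2 S T.

Let s20 : 0 < s2 := lt_trans s10 s12.
Let s30 : 0 < s3 := lt_trans s20 s23.

Lemma T2_order : [/\ s1 <= t1, t1 <= t2, t2 <= t3, t3 <= s3 & t1 + t2 + t3 = 1].
Proof.
by case: T_S => _; rewrite /d1 /d2 /d3 !mxE/= => /and4P[? ? ? ?] ? _; split.
Qed.

(** The product of z and the denominator is s1 s3 x y / s2 > 0, so z > 0 makes the denominator
    positive; divided by s2^2 it becomes [pair_quadric]. *)
Let quadric_of_F x y z : 0 < x -> 0 < y -> 0 < z -> F_denom S x y != 0 -> z = F S x y ->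
  0 < pair_quadric (x / s2) (y / s2) /\
  z * s2 * pair_quadric (x / s2) (y / s2) = s1 * s3 * (x / s2) * (y / s2).
Proof.
move=> x0 y0 z0 Fn zE; rewrite /F /F_denom /d1 /d2 /d3 !mxE/= in Fn zE *.
set D := _ - _ in Fn zE.
have s2n : s2 != 0 by rewrite gt_eqF.
have DE : D = s2 ^+ 2 * pair_quadric (x / s2) (y / s2).
  by rewrite /D /pair_quadric; field.
have D0 : 0 < D.
  have : 0 < z * D.
    have -> : z * D = s1 * s3 / s2 * (x * y) by rewrite zE; field; rewrite s2n Fn.
    by rewrite !mulr_gt0// invr_gt0.
  by rewrite pmulr_rgt0.
split; first by move: D0; rewrite DE pmulr_rgt0// exprn_gt0.
have -> : pair_quadric (x / s2) (y / s2) = D / s2 ^+ 2 by rewrite DE; field.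
by rewrite zE; field; rewrite s2n Fn.
Qed.

Lemma condition_a_lambda : condition_a S T ->
  [/\ t1 / s2 <= t2 / s2, t2 / s2 <= 1, 0 < pair_quadric (t1 / s2) (t2 / s2)
    & t3 * s2 * pair_quadric (t1 / s2) (t2 / s2) = s1 * s3 * (t1 / s2) * (t2 / s2)].
Proof.
have [st1 t12 t23 ts3 _] := T2_order; have t10 := lt_le_trans s10 st1.
have t20 := lt_le_trans t10 t12; have t30 := lt_le_trans t20 t23.
case; rewrite /alpha_plus /alpha_minus /d1 /d2 /d3 !mxE/= => -[_ ap] Fn /(quadric_of_F t10 t20 t30 Fn)[q0 qE].
split => //; first by rewrite ler_pM2r// invr_gt0.
(* The minimum [alpha_plus] being t2 / s2, it is at most t3 / s3, and t3 <= s3. *)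
have : t2 / s2 <= t3 / s3 by rewrite -[leLHS]ap ge_min lexx orbT.
by move=> h; apply: le_trans h _; rewrite ler_pdivrMr// mul1r.
Qed.

Lemma condition_b_lambda : condition_b S T ->
  [/\ t2 / s2 <= t3 / s2, 1 <= t2 / s2, 0 < pair_quadric (t3 / s2) (t2 / s2)
    & t1 * s2 * pair_quadric (t3 / s2) (t2 / s2) = s1 * s3 * (t3 / s2) * (t2 / s2)].
Proof.
have [st1 t12 t23 ts3 _] := T2_order; have t10 := lt_le_trans s10 st1.
have t20 := lt_le_trans t10 t12; have t30 := lt_le_trans t20 t23.
case; rewrite /beta_plus /beta_minus /d1 /d2 /d3 !mxE/= => -[bm _] Fn /(quadric_of_F t30 t20 t10 Fn)[q0 qE].
split => //; first by rewrite ler_pM2r// invr_gt0.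
have : t1 / s1 <= t2 / s2 by rewrite -[leRHS]bm le_max lexx.
by move=> h; apply: le_trans h; rewrite ler_pdivlMr// mul1r.
Qed.
End Conditions.

Lemma norm2_middle_free (R : realType) (n : 'cV[R]_3) : norm2 n = 1 -> n 1 0 = 0 ->
  n 0 0 ^+ 2 + n 2 0 ^+ 2 = 1.
Proof.
move=> /(congr1 (fun x => x ^+ 2)) + n0; rewrite norm2_sqr expr1n => <-.
rewrite (middle_freeE n0) !big_ord_recl !big_ord0 !mxE/=; ring.
Qed.

(** If a parameter is 1, the matrix is S or a rotation of S and lies in [K S]. Otherwise distinct
    parameters allow the iteration and equal ones require the approximation. *)
Lemma envelope_le_rotated (R : realType) (s1 s2 s3 t l1 l2 : R) (S := diag3 s1 s2 s3) (n : 'cV[R]_3)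
    (R1 R2 T : 'M[R]_3) :
  0 < s1 -> s1 < s2 -> s2 < s3 -> s1 + s2 + s3 = 1 -> 0 < l1 -> 0 < l2 ->
  0 < pair_quadric l1 l2 -> l1 <= l2 <= 1 \/ 1 <= l2 <= l1 ->
  norm2 n = 1 -> (l1 != 1 -> n 1 0 = 0) -> 0 < t ->
  t + (l1 + l2) * s2 = 1 -> t * s2 * pair_quadric l1 l2 = s1 * s3 * l1 * l2 ->
  \det T = l1 * s2 * (l2 * s2) * t ->
  SO3 R1 -> SO3 R2 ->
  R1^T *m T *m R1 = l1 *: S + (1 - l1) *: tensor n ->
  R2^T *m T *m R2 = l2 *: S + (1 - l2) *: tensor n ->
  forall r, 0 < r -> exists C, forall j Q, SO3 Q ->
    envelope_le (energy S j) (r *: (Q^T *m (R1^T *m T *m R1) *m Q)) C.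
Proof.
move=> s10 s12 s23 ss l10 l20 D0 ord n1 n0 t0 tE E2 dT SR1 SR2 h1 h2 r r0.
have SW : SO3 (R2^T *m R1) by apply: SO3_mul => //; exact: SO3_tr.
have WE : (R2^T *m R1)^T *m (R2^T *m T *m R2) *m (R2^T *m R1) = R1^T *m T *m R1.
  by rewrite -conj_mul (mulmxA R2) SO3_mul_trmx// mul1mx.
have [l11|l11] := eqVneq l1 1.
  exists (r ^+ 3 * norm2 S ^+ 3) => j Q SQ.
  by rewrite h1 l11 subrr scale0r addr0 scale1r; apply: envelope_le_K => //; exact: ltW.
have [l21|l21] := eqVneq l2 1.
  exists (r ^+ 3 * norm2 S ^+ 3) => j Q SQ.
  rewrite -WE h2 l21 subrr scale0r addr0 scale1r -conj_mul; apply: envelope_le_K; last exact: ltW.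
  exact: SO3_mul.
have [l12|l12] := eqVneq l1 l2.
  have n0' := n0 l11; have n1' := norm2_middle_free n1 n0'.
  have lE : pair_quadric l1 l2 = l1 * (3 * l1 - 2) by rewrite -l12 /pair_quadric; ring.
  rewrite h1; apply: (envelope_le_degenerate (t := t)) => //.
  - by have := tE; rewrite -l12; lra.
  - by apply: (mulfI (lt0r_neq0 l10)); rewrite -[in RHS]mulrA; move: E2; rewrite lE -l12 => E2; lra.
  - have s20 : 0 < s2 by exact: lt_trans s12.
    (* The two expressions for the determinant share this factor; cancelling it leaves the identity
       for the entries of [n]. *)
    have ln : l1 * (l1 * s2) != 0 by rewrite !mulf_neq0// gt_eqF.
    apply: (mulfI ln); have : \det (R1^T *m T *m R1) = \det T.
      by rewrite !det_mulmx det_tr; case: SR1 => _ ->; rewrite mul1r mulr1.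
    rewrite h1 dT -l12 [in X in X -> _](middle_freeE n0') rank_one_blockE det_mx3 => e.
    by transitivity (l1 * s2 * (l1 * s2) * t); [rewrite -e; ring|ring].
exists (r ^+ 3 * (norm2 S ^+ 3 * (l1 ^+ 2 * l2 ^+ 2) / pair_quadric l1 l2)) => j Q SQ.
rewrite h1; apply: (envelope_le_pair (W := R2^T *m R1)) => //; last by rewrite -h1 -h2.
by case: ord => /andP[h h']; [left|right]; rewrite !lt_def h h' ?[1 == _]eq_sym ?l21 ?l12 1?eq_sym ?l12 ?l21.
Qed.

Lemma envelope_le_segment (R : realType) (S M N : 'M[R]_3) (n : 'cV[R]_3) j (a th C : R) :
  0 <= th <= 1 -> N - M = a *: tensor n ->
  envelope_le (energy S j) M C -> envelope_le (energy S j) N C ->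
  envelope_le (energy S j) ((1 - th) *: M + th *: N) C.
Proof.
move=> /andP[th0 th1] NM HM HN.
have [->|t0] := eqVneq th 0; first by rewrite subr0 scale1r scale0r addr0.
have [->|t1] := eqVneq th 1; first by rewrite subrr scale0r scale1r add0r.
have th01 : 0 < th < 1 by rewrite lt_def t0 th0 lt_def eq_sym t1 th1.
rewrite addrC; have := envelope_le_tensor th01 NM HN HM.
by rewrite -mulrDl [th + (1 - th)]addrC subrK mul1r.
Qed.

Lemma in_segment_range (R : realType) (k th x y lo hi c : R) : 0 < k -> 0 <= th <= 1 -> 0 < c ->
  lo <= x <= hi -> lo <= y <= hi -> k = (1 - th) * c + th ->
  lo <= k^-1 * ((1 - th) * (c * x) + th * y) <= hi.
Proof.
move=> k0 /andP[th0 th1] c0 /andP[x0 x1] /andP[y0 y1] kE.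
have w0 : 0 <= (1 - th) * c by rewrite mulr_ge0 ?subr_ge0// ltW.
rewrite mulrC ler_pdivlMr// ler_pdivrMr// kE; apply/andP; split; rewrite -subr_ge0.
  rewrite (_ : _ - _ = (1 - th) * c * (x - lo) + th * (y - lo)); last by ring.
  by rewrite addr_ge0// mulr_ge0// subr_ge0.
rewrite (_ : _ - _ = (1 - th) * c * (hi - x) + th * (hi - y)); last by ring.
by rewrite addr_ge0// mulr_ge0// subr_ge0.
Qed.

(** [Kstar] consists of diagonal matrices, so a point of the segment has to be rotated to one. It
    keeps the block form in coordinates 1 and 3, with eigenvalues from the quadratic formula; for l
    = 1 it is S. *)
Lemma diagonalize_segment (R : realType) (s1 s2 s3 l th : R) (n : 'cV[R]_3) (S := diag3 s1 s2 s3) :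
  (l != 1 -> n 1 0 = 0) ->
  exists2 Q, SO3 Q & exists x y z,
    Q^T *m ((1 - th) *: (l *: S) + th *: (l *: S + (1 - l) *: tensor n)) *m Q = diag3 x y z.
Proof.
have [->|l1 /(_ isT) n0] := eqVneq l 1.
  move=> _; exists 1%:M; first exact: SO3_1.
  exists s1, s2, s3; rewrite trmx1 mul1mx mulmx1 subrr scale0r addr0 !scale1r -scalerDl subrK.
  by rewrite scale1r.
rewrite (middle_freeE n0) rank_one_blockE /S diag3E !mx3Z mx3D.
rewrite !mulr0 !addr0.
set a := (X in mx3 X); set b := (X in mx3 _ _ X); set d := (X in mx3 _ _ _ _ X); set c := (X in mx3 _ _ _ _ _ _ _ _ X).
pose w := Num.sqrt ((a - c) ^+ 2 + 4 * b ^+ 2).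
have w2 : w ^+ 2 = (a - c) ^+ 2 + 4 * b ^+ 2 by rewrite sqr_sqrtr// addr_ge0 ?sqr_ge0// mulr_ge0// sqr_ge0.
have [||Q SQ QE] := @diagonalize_block R a b c d ((a + c - w) / 2) ((a + c + w) / 2).
- by field.
- transitivity (((a + c) ^+ 2 - w ^+ 2) / 4); first by field.
  by rewrite w2; field.
by exists Q => //; exists ((a + c - w) / 2), d, ((a + c + w) / 2).
Qed.

Theorem corollary4p7 (R : realType) (s1 s2 s3 : R)
  (hs1 : 0 < s1) (hs12 : s1 < s2) (hs23 : s2 < s3) (hs : s1 + s2 + s3 = 1)
  (S : 'M[R]_3) (hS : S = diag3 s1 s2 s3)
  (t1 t2 t3 : R) (T : 'M[R]_3) (hT : T = diag3 t1 t2 t3) (hT2 : T2 S T)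
  (lambda1 lambda2 : R)
  (hlambda : (condition_a S T /\ (lambda1, lambda2) = (t1 / s2, t2 / s2)) \/
             (condition_b S T /\ (lambda1, lambda2) = (t3 / s2, t2 / s2)))
  (R1 R2 : 'M[R]_3) (hR1 : SO3 R1) (hR2 : SO3 R2)
  (n : 'cV[R]_3) (hn : norm2 n = 1)
  (h1 : R1^T *m T *m R1 = lambda1 *: S + (1 - lambda1) *: tensor n)
  (h2 : R2^T *m T *m R2 = lambda2 *: S + (1 - lambda2) *: tensor n)
  (A : 'M[R]_3) (hA : segment (lambda1 *: S) (R1^T *m T *m R1) A) :
  exists2 Q : 'M[R]_3, SO3 Q & Kstar S ((\tr A)^-1 *: (Q^T *m A *m Q)).
Proof.
subst S T; have [st1 t12 t23 ts3 t_1] := T2_order hT2.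
have s20 : 0 < s2 := lt_trans hs1 hs12.
have s30 : 0 < s3 := lt_trans s20 hs23.
have t10 := lt_le_trans hs1 st1; have t20 := lt_le_trans t10 t12; have t30 := lt_le_trans t20 t23.
have s13 := lt_trans hs12 hs23.
have s2n : s2 != 0 by rewrite gt_eqF.
(* [t] is the remaining eigenvalue of T: t3 in case (a), t1 in case (b). *)
have [l10 l20 [t [t0 tE E2 dT]] D0 ord] :
    [/\ 0 < lambda1, 0 < lambda2,
      exists t, [/\ 0 < t, t + (lambda1 + lambda2) * s2 = 1,
        t * s2 * pair_quadric lambda1 lambda2 = s1 * s3 * lambda1 * lambda2
        & \det (diag3 t1 t2 t3) = lambda1 * s2 * (lambda2 * s2) * t],
      0 < pair_quadric lambda1 lambda2 & lambda1 <= lambda2 <= 1 \/ 1 <= lambda2 <= lambda1].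
  rewrite diag3E det_mx3.
  case: hlambda => -[cond [-> ->]].
    have [h h' q0 qE] := condition_a_lambda hs1 hs12 hs23 hT2 cond.
    split; [by rewrite divr_gt0|by rewrite divr_gt0| |by []|by rewrite h h'; left].
    exists t3; split => //; last by field.
    by rewrite -mulrDl divfK// -t_1 addrC.
  have [h h' q0 qE] := condition_b_lambda hs1 hs12 hs23 hT2 cond.
  split; [by rewrite divr_gt0|by rewrite divr_gt0| |by []|by rewrite h h'; right].
  exists t1; split => //; last by field.
  by rewrite -mulrDl divfK// -t_1 [t3 + t2]addrC addrA.
have n0 : lambda1 != 1 -> n 1 0 = 0.
  move=> l11; apply: (rank_one_middle hs12 hs23 (lt0r_neq0 l10) l11 hR1 _ h1).
  (* [lambda1] times s2 is t1 or t3, an eigenvalue of T. *)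
  by case: hlambda => -[_ [-> _]]; rewrite divfK// subrr ?mul0r ?mulr0.
have [th th01 AE] := hA.
have [Q SQ [x [y [z QE]]]] := diagonalize_segment s1 s2 s3 th n0.
rewrite -h1 AE in QE.
have th01' : 0 <= th <= 1 by move: th01; rewrite /= in_itv.
have /andP[th0 th1] := th01'.
have trB : \tr (R1^T *m diag3 t1 t2 t3 *m R1) = 1.
  by rewrite mxtrace_mulC mulmxA SO3_mul_trmx// mul1mx diag3E trace_mx3.
have trA : \tr A = (1 - th) * lambda1 + th.
  by rewrite -AE mxtraceD !mxtraceZ trB mulr1 diag3E trace_mx3 hs mulr1.
have A0 : 0 < \tr A.
  rewrite trA; have [->|tn] := eqVneq th 0; first by rewrite subr0 mul1r addr0.
  by rewrite ltr_wpDl ?lt_def ?tn// mulr_ge0 ?subr_ge0// ltW.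
set k := \tr A in trA A0 *.
have k0 : 0 < k^-1 by rewrite invr_gt0.
have kE : k^-1 *: (Q^T *m A *m Q) = diag3 (k^-1 * x) (k^-1 * y) (k^-1 * z).
  by rewrite QE !diag3E mx3Z !mulr0.
exists Q => //; exists (k^-1 * x), (k^-1 * y), (k^-1 * z); split => //.
- rewrite kE; have [C HC] := envelope_le_rotated hs1 hs12 hs23 hs l10 l20 D0 ord hn n0 t0 tE E2 dT hR1 hR2 h1 h2 k0.
  have SAE : k^-1 *: (Q^T *m A *m Q) = (1 - th) *: ((k^-1 * lambda1) *: (Q^T *m diag3 s1 s2 s3 *m Q)) +
      th *: (k^-1 *: (Q^T *m (R1^T *m diag3 t1 t2 t3 *m R1) *m Q)).
    by rewrite -AE conjD !conjZ scalerDr !scalerA; congr (_ *: _ + _ *: _); ring.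
  have kl0 : 0 <= k^-1 * lambda1 by rewrite mulr_ge0// ltW.
  have symA : (k^-1 *: (Q^T *m A *m Q))^T = k^-1 *: (Q^T *m A *m Q) by rewrite kE diag3E mx3_tr.
  rewrite -kE; apply: (Kapp_of_envelope (C := Num.max ((k^-1 * lambda1) ^+ 3 * norm2 (diag3 s1 s2 s3) ^+ 3) C) symA) => j.
  rewrite SAE; apply: (envelope_le_segment (n := Q^T *m n) (a := k^-1 * (1 - lambda1)) th01').
  + rewrite h1 conjD !conjZ tensor_conj scalerDr !scalerA.
    by rewrite [X in X - _]addrC addrK.
  + by apply: envelope_leW (envelope_le_K _ j SQ kl0); rewrite le_max lexx.
  + by apply: envelope_leW (HC j Q SQ); rewrite le_max lexx orbT.
(* Divided by its trace, A is a convex combination of S and a rotation of T, both with spectrum in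
   [s1, s3]. *)
- have rng i : s1 <= (diag3 (k^-1 * x) (k^-1 * y) (k^-1 * z)) i i <= s3.
    have E : (k^-1 *: (Q^T *m A *m Q)) i i = k^-1 * ((1 - th) * (lambda1 * (Q^T *m diag3 s1 s2 s3 *m Q) i i) +
        th * ((R1 *m Q)^T *m diag3 t1 t2 t3 *m (R1 *m Q)) i i).
      by rewrite conj_mul -AE conjD !conjZ; move: (_ *m _) (_ *m _) => M N; rewrite !mxE.
    rewrite -kE E; apply: in_segment_range trA => //.
      by apply: diag3_conj_bound; rewrite ?lexx ?(ltW hs12) ?(ltW hs23) ?(ltW s13).
    apply: diag3_conj_bound; first exact: SO3_mul.
    - by rewrite st1 (le_trans t12 (le_trans t23 ts3)).
    - by rewrite (le_trans st1 t12) (le_trans t23 ts3).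
    - by rewrite (le_trans st1 (le_trans t12 t23)).
  by have := rng 0; have := rng 1; have := rng 2; rewrite !mxE/= /d1 /d3 !mxE/=.
- have : \tr (k^-1 *: (Q^T *m A *m Q)) = 1.
    rewrite mxtraceZ mxtrace_mulC mulmxA SO3_mul_trmx// mul1mx mulVf//; exact: lt0r_neq0.
  by rewrite kE diag3E trace_mx3.
Qed.
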